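(* Let $0<p\le1$, $0<q\le\infty$, and let $f$ be a distribution on $\mathbb{R}^n$ given by $f=\sum_j\lambda_j a_j(x)$, where the $\lambda_j$ are scalars, the $a_j$'s are $H^p$ atoms with defining (supporting) intervals $I_j$, and the convergence is in the sense of distributions. For $k\in\mathbb{Z}$ let $$\mathcal{I}_k=\{j:2^k\le|\lambda_j|/|I_j|^{1/p}<2^{k+1}\},$$ and for $\lambda=\{\lambda_j\}$ put $$\|\lambda\|_{[p,q]}=\Big(\sum_{k\in\mathbb{Z}}\Big[\sum_{j\in\mathcal{I}_k}|\lambda_j|^p\Big]^{q/p}\Big)^{1/q}$$ (with the usual interpretation $\sup_k\big[\sum_{j\in\mathcal{I}_k}|\lambda_j|^p\big]^{1/p}$ when $q=\infty$). Assume that the family $\{I_j\}$ has bounded overlap at each level $\mathcal{I}_k$ uniformly in $k$ (i.e. there is a constant $C$ with $\sum_{j\in\mathcal{I}_k}\chi_{I_j}(x)\le C$ for all $x\in\mathbb{R}^n$ and all $k\in\mathbb{Z}$), and that $\|\lambda\|_{[p,q]}<\infty$. Then $f\in H^{p,q}(\mathbb{R}^n)$, and $$\|f\|_{H^{p,q}}\le c\,\|\lambda\|_{[p,q]},$$ where $c$ depends only on $n,p,q$, the overlap constant $C$, and the choice of maximal function used to define the quasinorm of $H^{p,q}$.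
   Context: For a measurable function $g$ on $\mathbb{R}^n$, $m(g,\lambda)=|\{x\in\mathbb{R}^n:|g(x)|>\lambda\}|$, and the Lorentz space $L^{p,q}$ ($0<p<\infty$, $0<q\le\infty$) consists of those $g$ with finite quasinorm, which up to equivalence is $\big(\sum_{k\in\mathbb{Z}}[2^k m(g,2^k)^{1/p}]^q\big)^{1/q}$ for $q<\infty$ and $\sup_{k\in\mathbb{Z}}2^k m(g,2^k)^{1/p}$ for $q=\infty$. The Hardy-Lorentz space $H^{p,q}=H^{p,q}(\mathbb{R}^n)$, $0<p\le1$, $0<q\le\infty$, consists of those (tempered) distributions $f$ whose radial maximal function $Mf(x)=\sup_{t>0}|(f*\varphi_t)(x)|$ belongs to $L^{p,q}$, where $\varphi$ is a fixed compactly supported smooth function with nonvanishing integral and $\varphi_t(x)=t^{-n}\varphi(x/t)$. Its quasinorm is $\|f\|_{H^{p,q}}=\|\{2^k m(Mf,2^k)^{1/p}\}_{k\in\mathbb{Z}}\|_{\ell^q}$. ''Interval'' means a cube in $\mathbb{R}^n$, and $|I|$ is its Lebesgue measure. An $H^p$ atom with defining interval $I$ is a function $a$ with $\mathrm{supp}(a)\subseteq I$, $|I|^{1/p}|a(x)|\le1$, and vanishing moments up to order $N=[n(1/p-1)]$ (integer part), i.e. $\int x^\alpha a(x)\,dx=0$ for all multi-indices $|\alpha|\le N$. *)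

(* Defs.v *)
From HB Require Import structures.
From mathcomp Require Import all_boot all_order all_algebra archimedean.
From mathcomp Require Import all_classical all_reals all_analysis.
From mathcomp Require Import measurable_realfun.
From mathcomp.real_closed Require Import complex.

Set Implicit Arguments.
Unset Strict Implicit.
Unset Printing Implicit Defensive.

Import Order.TTheory GRing.Theory Num.Theory.
Import numFieldNormedType.Exports.

Local Open Scope classical_set_scope.
Local Open Scope ring_scope.
Local Open Scope complex_scope.

(* Lebesgue measure on R^n: the outer measure obtained from countable covers by
   closed boxes, restricted to the sigma-algebra of its Caratheodory measurable
   sets, that is, the Lebesgue measurable sets. *)

Section lebesgue_Rn.
Context {R : realType} {n : nat}.
Implicit Types (l r : 'rV[R]_n) (A : set 'rV[R]_n).

Definition box l r : set 'rV[R]_n :=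
  [set x | forall i, l 0 i <= x 0 i <= r 0 i].

Definition box_vol l r : R := \prod_(i < n) Num.max 0 (r 0 i - l 0 i).

Definition box_cover A (F : set ('rV[R]_n * 'rV[R]_n)) : Prop :=
  countable F /\ A `<=` \bigcup_(b in F) box b.1 b.2.

Definition lebesgue_outer A : \bar R :=
  ereal_inf [set \esum_(b in F) (box_vol b.1 b.2)%:E | F in box_cover A]%E.

Let vol0 (b : 'rV[R]_n * 'rV[R]_n) : (0 <= (box_vol b.1 b.2)%:E)%E.
Proof.
by rewrite lee_fin; apply: prodr_ge0 => i _; rewrite le_max lexx.
Qed.

Let sub_esum (D E : set ('rV[R]_n * 'rV[R]_n)) : D `<=` E ->
  (\esum_(b in D) (box_vol b.1 b.2)%:E <= \esum_(b in E) (box_vol b.1 b.2)%:E)%E.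
Proof.
move=> DE; apply: ge_ereal_sup => _ [X [fX XD] <-].
by apply: ereal_sup_ubound; exists X => //; split=> // ? /XD/DE.
Qed.

Let lebesgue_outer_ge0 A : (0 <= lebesgue_outer A)%E.
Proof. by apply/le_ereal_inf_tmp => _ [F _ <-]; apply: esum_ge0. Qed.

Let lebesgue_outer0 : (lebesgue_outer set0 = 0)%E.
Proof.
apply/eqP; rewrite eq_le lebesgue_outer_ge0 andbT.
apply: ereal_inf_lbound; exists set0; last exact: esum_set0.
by split; [exact: countable0|].
Qed.

Let le_lebesgue_outer : {homo lebesgue_outer : A B / A `<=` B >-> (A <= B)%E}.
Proof.
move=> A B AB; apply/le_ereal_inf_tmp => _ [F [cF BF] <-].
by apply: ereal_inf_lbound; exists F => //; split=> // ? /AB/BF.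
Qed.

Let lebesgue_outer_sigma_subadditive : sigma_subadditive lebesgue_outer.
Proof.
move=> A; have [[i ioo]|] := pselect (exists i, lebesgue_outer (A i) = +oo%E).
  rewrite (eseries_pinfty _ _ ioo) ?leey// => k _.
  by rewrite -ltNye (lt_le_trans _ (lebesgue_outer_ge0 _)).
rewrite -forallNE => Aoo.
apply/lee_addgt0Pr => _/posnumP[e].
rewrite (le_trans _ (epsilon_trick _ _ _))//.
have [F PF] : {F : nat -> set ('rV[R]_n * 'rV[R]_n) & forall k,
    box_cover (A k) (F k) /\ (\esum_(b in F k) (box_vol b.1 b.2)%:E <=
      lebesgue_outer (A k) + (e%:num / (2 ^ k.+1)%:R)%:E)%E}.
  apply: (@choice _ _ (fun k F => box_cover (A k) F /\
    (\esum_(b in F) (box_vol b.1 b.2)%:E <=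
      lebesgue_outer (A k) + (e%:num / (2 ^ k.+1)%:R)%:E)%E)) => k.
  have ek : (0 < e%:num / (2 ^ k.+1)%:R)%R by [].
  have fk : lebesgue_outer (A k) \is a fin_num.
    rewrite ge0_fin_numE// lt_neqAle leey andbT; exact/eqP/Aoo.
  have [_ [F AF <-] lt] := lb_ereal_inf_adherent ek fk.
  by exists F; split => //; exact: ltW.
pose G := seqDU F.
apply: (@le_trans _ _ (\esum_(b in \bigcup_k F k) (box_vol b.1 b.2)%:E)%E).
  apply: ereal_inf_lbound; exists (\bigcup_k F k) => //; split.
    by apply: bigcup_countable => // k _; exact: (PF k).1.1.
  move=> x [k _ /(PF k).1.2 [b Fb bx]]; exists b => //; by exists k.
rewrite seqDU_bigcup_eq (nneseries_sum_bigcup (trivIset_seqDU F) vol0).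
apply: lee_nneseries => [k _ _|k _]; first by apply: esum_ge0 => b _; exact: vol0.
by rewrite (le_trans _ (PF k).2)//; apply: sub_esum; exact: subset_seqDU.
Qed.

HB.instance Definition _ := isOuterMeasure.Build R 'rV[R]_n lebesgue_outer
  lebesgue_outer0 lebesgue_outer_ge0 le_lebesgue_outer
  lebesgue_outer_sigma_subadditive.

End lebesgue_Rn.

(* R^n with the sigma-algebra of Lebesgue measurable sets. *)
Definition Rn (R : realType) (n : nat) : Type :=
  caratheodory_type (@lebesgue_outer R n).

HB.instance Definition _ (R : realType) (n : nat) :=
  Measurable.copy (Rn R n) (caratheodory_type (@lebesgue_outer R n)).

Definition lebesgue (R : realType) (n : nat) : set (Rn R n) -> \bar R :=
  @lebesgue_outer R n.

HB.instance Definition _ (R : realType) (n : nat) :=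
  Measure.copy (@lebesgue R n)
    (((@lebesgue_outer R n : {outer_measure set 'rV[R]_n -> \bar R})
      : set (caratheodory_type (@lebesgue_outer R n)) -> \bar R)).

Section complex_functions.
Context {R : realType} {n : nat}.
Implicit Types (g : 'rV[R]_n -> R) (psi : 'rV[R]_n -> R[i]).

(* The modulus as an element of R; the library's `|z| lies in R[i]. *)
Definition cabs (z : R[i]) : R := Normc.normc z.

Definition csupp psi : set 'rV[R]_n := closure [set x | psi x != 0].

Definition cmeasurable psi : Prop :=
  measurable_fun setT ((fun x => complex.Re (psi x)) : Rn R n -> R) /\
  measurable_fun setT ((fun x => complex.Im (psi x)) : Rn R n -> R).

Definition cintegral psi : R[i] :=
  (\int[@lebesgue R n]_x complex.Re (psi x)) +i*
  (\int[@lebesgue R n]_x complex.Im (psi x)).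

(* d_(s_1) (d_(s_2) (... g)), where s lists the successive directions. *)
Fixpoint partials (s : seq 'I_n) g : 'rV[R]_n -> R :=
  if s is i :: s' then (fun x => 'D_('e_i) (partials s' g) x) else g.

Definition smooth g : Prop := forall s : seq 'I_n,
  continuous (partials s g) /\
  forall (i : 'I_n) x, derivable (partials s g) x 'e_i.

Definition csmooth psi : Prop :=
  smooth (fun x => complex.Re (psi x)) /\ smooth (fun x => complex.Im (psi x)).

Definition cpartials (s : seq 'I_n) psi (x : 'rV[R]_n) : R[i] :=
  partials s (fun y => complex.Re (psi y)) x +i*
  partials s (fun y => complex.Im (psi y)) x.

Definition test_function psi : Prop := csmooth psi /\ compact (csupp psi).

Definition schwartz psi : Prop := csmooth psi /\
  forall (s : seq 'I_n) (k : nat), exists M : R,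
    forall x, (1 + `|x|) ^+ k * cabs (cpartials s psi x) <= M.

End complex_functions.

Section distributions.
Context {R : realType} {n : nat}.
Implicit Types (psi phi : 'rV[R]_n -> R[i]) (f F : ('rV[R]_n -> R[i]) -> R[i]).

(* A distribution is given by its values on test functions; what the underlying
   total function does elsewhere is irrelevant. *)
Definition linear_on (D : set ('rV[R]_n -> R[i])) f : Prop :=
  forall (c : R[i]) psi1 psi2, D psi1 -> D psi2 ->
    f (fun x => c * psi1 x + psi2 x) = c * f psi1 + f psi2.

Definition is_distribution f : Prop :=
  linear_on test_function f /\
  forall K : set 'rV[R]_n, compact K -> exists (B : R) (N : nat),
    forall psi (M : R), test_function psi -> csupp psi `<=` K ->
      (forall s x, (size s <= N)%N -> cabs (cpartials s psi x) <= M) ->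
      cabs (f psi) <= B * M.

Definition tempered_distribution F : Prop :=
  linear_on schwartz F /\
  exists (B : R) (N : nat), forall psi (M : R), schwartz psi ->
    (forall s x, (size s <= N)%N ->
       (1 + `|x|) ^+ N * cabs (cpartials s psi x) <= M) ->
    cabs (F psi) <= B * M.

Definition is_tempered f : Prop :=
  is_distribution f /\
  exists F, tempered_distribution F /\ forall psi, test_function psi -> F psi = f psi.

Definition dilate phi (t : R) : 'rV[R]_n -> R[i] :=
  fun x => (t ^- n)%:C * phi (t^-1 *: x).

Definition dconv f phi : 'rV[R]_n -> R[i] := fun x => f (fun y => phi (x - y)).

Definition radial_maximal phi f (x : 'rV[R]_n) : \bar R :=
  ereal_sup [set (cabs (dconv f (dilate phi t) x))%:E | t in [set t : R | 0 < t]].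

End distributions.

Section hardy_lorentz.
Context {R : realType} {n : nat}.
Implicit Types (p : R) (q : \bar R).
Local Open Scope ereal_scope.

Definition distrib_fun (g : 'rV[R]_n -> \bar R) (t : R) : \bar R :=
  @lebesgue R n [set x | t%:E < `|g x|].

(* The quasinorm of l^q(Z); only 0 < q <= +oo is meaningful. *)
Definition ell_qnorm q (u : int -> \bar R) : \bar R :=
  if q is r%:E then (\esum_(k in [set: int]) u k `^ r) `^ r^-1
  else ereal_sup (range u).

Definition lorentz_qnorm p q (g : 'rV[R]_n -> \bar R) : \bar R :=
  ell_qnorm q
    (fun k : int => (2 ^ k : R)%:E * distrib_fun g (2 ^ k)%R `^ p^-1).

Definition lorentz p q (g : 'rV[R]_n -> \bar R) : Prop :=
  measurable_fun setT (g : Rn R n -> \bar R) /\ lorentz_qnorm p q g < +oo.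

Definition hardy_lorentz_qnorm phi p q (f : ('rV[R]_n -> R[i]) -> R[i]) :=
  lorentz_qnorm p q (radial_maximal phi f).

Definition hardy_lorentz phi p q (f : ('rV[R]_n -> R[i]) -> R[i]) : Prop :=
  is_tempered f /\ lorentz p q (radial_maximal phi f).

End hardy_lorentz.

Section atoms.
Context {R : realType} {n : nat}.
Implicit Types (p : R) (q : \bar R) (I : set 'rV[R]_n) (lam : nat -> R[i]).

(* A cube with sides parallel to the axes; each of its faces may or may not
   belong to it. *)
Definition cube I : Prop :=
  exists (u : 'rV[R]_n) (l : R) (bl br : 'I_n -> bool), 0 < l /\
    I = [set x : 'rV[R]_n | forall i : 'I_n, x 0 i \in
           Interval (BSide (bl i) (u 0 i)) (BSide (br i) (u 0 i + l))].

Definition vol I : R := fine (@lebesgue R n I).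

Definition moment_order p : nat := Num.truncn (n%:R * (p^-1 - 1) : R).

Definition atom p I (a : 'rV[R]_n -> R[i]) : Prop :=
  [/\ cube I, cmeasurable a, csupp a `<=` I,
      forall x, vol I `^ p^-1 * cabs (a x) <= 1 &
      forall alpha : 'I_n -> nat, (\sum_(i < n) alpha i <= moment_order p)%N ->
        cintegral (fun x => (\prod_(i < n) x 0 i ^+ alpha i)%:C * a x) = 0].

(* The set called I_k in the definition of ||lambda||_[p,q]. *)
Definition level p lam (I : nat -> set 'rV[R]_n) (k : int) : set nat :=
  [set j | 2 ^ k <= cabs (lam j) / vol (I j) `^ p^-1 < 2 ^ (k + 1)].

Definition coef_qnorm p q lam (I : nat -> set 'rV[R]_n) : \bar R :=
  (let S k := \esum_(j in level p lam I k) (cabs (lam j) `^ p)%R%:E in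
   if q is r%:E then
     (\esum_(k in [set: int]) S k `^ (r / p)) `^ r^-1
   else ereal_sup [set S k `^ p^-1 | k in [set: int]])%E.

Definition bounded_overlap p lam (I : nat -> set 'rV[R]_n) (C : R) : Prop :=
  forall (k : int) (x : 'rV[R]_n),
    (\esum_(j in level p lam I k) (\1_(I j) x)%:E <= C%:E)%E.

(* f = sum_j lam_j a_j in the sense of distributions. *)
Definition atomic_sum (f : ('rV[R]_n -> R[i]) -> R[i]) lam
    (a : nat -> 'rV[R]_n -> R[i]) : Prop :=
  forall psi, test_function psi ->
    (fun m : nat => cabs (\sum_(j < m) lam j * cintegral (fun x => a j x * psi x)
                          - f psi)) @ \oo --> (0 : R).

End atoms.

(* Main.v *)
From mathcomp Require Import all_boot all_order all_algebra archimedean.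
From mathcomp Require Import all_classical all_reals all_analysis.
From mathcomp Require Import measurable_realfun lra ring.
From mathcomp.real_closed Require Import complex.
Require Import Defs.

(** Everything follows from absolute convergence.  Let
    [b_j = |lambda_j| / |I_j|^(1/p)] be the height of the j-th term, so that the
    k-th level consists of the j with [2^k <= b_j < 2^(k+1)], and let [S_k] be
    the sum of the [|lambda_j|^p] over it.

    To estimate [m(Mf, 2^k)], split the sum at the level [k - s].  By bounded
    overlap the lower levels form a function bounded by a multiple of [2^(k-s)],
    so for [s] large they contribute at most [2^k / 2] to [f * phi_t].  For the
    upper levels, the vanishing moments and Taylor's formula give
    [|a_j * phi_t (x)| <= A |I_j|^(-1/p) 2^(-i(n+N+1))] for some [i] such that
    x lies in the dilate of [I_j] by about [2^i], uniformly in t.  Since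
    [p (n+N+1) > n], one can take [r < p <= 1] with [r (n+N+1) > n]; a sum of
    non-negative terms exceeds 1 only if the sum of their r-th powers is at
    least 1, and Markov's inequality applied to the latter gives
    [2^(kp) m(Mf, 2^k) <= K \sum_(i >= 0) 2^(-i(p-r)) S_(k-s+i)].  The right-hand
    side is bounded in [l^(q/p)], for every [q > 0], by the norm of [S].

    The same two estimates, with a Schwartz function instead of [phi_t], show
    that the series converges absolutely against Schwartz functions, so that f
    is tempered.  Finally [f * phi_t] is continuous because f is a distribution,
    hence [Mf] is lower semicontinuous. *)

Set Implicit Arguments.
Unset Strict Implicit.
Unset Printing Implicit Defensive.

Import Order.TTheory GRing.Theory Num.Theory.
Import numFieldNormedType.Exports.

Local Open Scope classical_set_scope.
Local Open Scope ring_scope.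

(** Why r has to lie strictly below p: with r = p the factor 2^(-i(p-r)) disappears, the bound for
    m(Mf, 2^k) becomes the plain sum of all S_j with j >= k - s, and no l^(q/p) norm controls such
    tails. There is room below p because the integer part in the order N of the moments gives
    n/(n+N+1) < p. All constants are fixed before f and its decomposition. The overlap constant
    enters the norm estimate only through the shift s of the splitting level. The measure of a cube
    is not computed. Covers bound it from above and scaling compares it with the unit cube, so only
    the positivity of the latter is missing; it follows from the non-vanishing integral of phi,
    since otherwise all integrals would be zero. For temperedness the upper levels are summed
    differently: finiteness of the norm bounds all S_k by some T, so a cube of level k has volume at
    most T 2^(-kp), and the gain |I_j|^((n+N+1)/n) from Taylor's formula beats the height because
    p(n+N+1) > n. As f is given on test functions only, its extension is defined as the limit of the
    series. *)

Section esum_lemmas.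
Context {R : realType}.
Local Open Scope ereal_scope.

Lemma esum_subset {T : choiceType} (A B : set T) (a : T -> \bar R) :
  A `<=` B -> \esum_(i in A) a i <= \esum_(i in B) a i.
Proof.
move=> AB; apply: ge_ereal_sup => _ [X [fX XA] <-].
by apply: ereal_sup_ubound; exists X => //; split=> // ? /XA/AB.
Qed.

(** An inequality only, since [g] may identify points; a choice of preimages embeds the image into
    [F]. *)
Lemma esum_image_le {T T' : choiceType} (x0 : T) (F : set T) (g : T -> T')
    (a : T' -> \bar R) :
  \esum_(y in g @` F) a y <= \esum_(x in F) a (g x).
Proof.
have [s sP] : {s : T' -> T & forall y, (g @` F) y -> F (s y) /\ g (s y) = y}.
  apply: (@choice _ _ (fun y x => (g @` F) y -> F x /\ g x = y)) => y.
  have [[x Fx gx]|nF] := pselect ((g @` F) y); first by exists x.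
  by exists x0.
have sinj : set_inj (g @` F) s.
  move=> y1 y2 /set_mem Fy1 /set_mem Fy2 e.
  by rewrite -(sP _ Fy1).2 -(sP _ Fy2).2 e.
rewrite (_ : esum _ _ = \esum_(y in g @` F) a (g (s y))); last first.
  by apply: eq_esum => y Fy; rewrite (sP _ Fy).2.
rewrite -(@esum_image R T' T _ s (fun x => a (g x)) sinj); apply: esum_subset.
by move=> _ [y Fy <-]; case: (sP _ Fy).
Qed.

Lemma esumZl {T : choiceType} (D : set T) (a : T -> \bar R) (c : R) :
  (0 <= c)%R -> (forall i, 0 <= a i) ->
  \esum_(i in D) (c%:E * a i) = c%:E * \esum_(i in D) a i.
Proof.
move=> c0 a0; have le (e : R) (b : T -> \bar R) : (0 <= e)%R ->
    (forall i, 0 <= b i) ->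
    \esum_(i in D) (e%:E * b i) <= e%:E * \esum_(i in D) b i.
  move=> e0 b0; apply: ge_ereal_sup => _ [X [fX XD] <-].
  rewrite -ge0_mule_fsumr// lee_wpmul2l ?lee_fin//.
  by apply: ereal_sup_ubound; exists X.
apply/eqP; rewrite eq_le le//=; have [->|cN0] := eqVneq c 0%R.
  by rewrite mul0e esum_ge0// => i _; rewrite mul0e.
have c_gt0 : (0 < c)%R by rewrite lt_neqAle eq_sym cN0.
rewrite -lee_pdivlMl//.
rewrite (@eq_esum _ _ _ a (fun i => c^-1%:E * (c%:E * a i))); last first.
  by move=> i _; rewrite muleA -EFinM mulVf// mul1e.
by apply: le => [|i]; rewrite ?invr_ge0// mule_ge0.
Qed.

End esum_lemmas.

(** * Lebesgue measure on boxes: measurable sets and scaling *)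

Section boxes.
Context {R : realType} {n : nat}.
Implicit Types (l r x : 'rV[R]_n) (A : set 'rV[R]_n).

Lemma box_vol_ge0 l r : 0 <= box_vol l r.
Proof. by apply: prodr_ge0 => i _; rewrite le_max lexx. Qed.

(** A cover may be transformed box by box, as long as the new boxes cover [A]; cutting by
    hyperplanes and scaling both go through this bound. *)
Lemma lebesgue_outer_cover (F : set ('rV[R]_n * 'rV[R]_n))
    (g : 'rV[R]_n * 'rV[R]_n -> 'rV[R]_n * 'rV[R]_n) A :
  countable F -> (forall x, A x -> exists2 b, F b & box (g b).1 (g b).2 x) ->
  (lebesgue_outer A <= \esum_(b in F) (box_vol (g b).1 (g b).2)%:E)%E.
Proof.
move=> cF AF; apply: (@le_trans _ _ (\esum_(b in g @` F) (box_vol b.1 b.2)%:E)%E).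
  apply: ereal_inf_lbound; exists (g @` F) => //; split.
    exact: (card_le_trans (card_image_le _ _) cF).
  move=> x /AF[b Fb bx]; exists (g b) => //; by exists b.
exact: (esum_image_le (0, 0)).
Qed.

Lemma lebesgue_outer_box_le l r : (lebesgue_outer (box l r) <= (box_vol l r)%:E)%E.
Proof.
have := @lebesgue_outer_cover [set (l, r)] id (box l r) (countable1 _).
rewrite esum_set1 ?lee_fin ?box_vol_ge0//; apply => x bx; by exists (l, r).
Qed.

Definition cap_coord (i : 'I_n) (c : R) r : 'rV[R]_n :=
  \row_j (if j == i then Num.min (r 0 j) c else r 0 j).
Definition cup_coord (i : 'I_n) (c : R) l : 'rV[R]_n :=
  \row_j (if j == i then Num.max (l 0 j) c else l 0 j).

(** The truncation at 0 in [box_vol] makes the identity hold also when the hyperplane misses the box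
    or the box is empty. *)
Lemma box_vol_split (i : 'I_n) (c : R) l r :
  box_vol l r = box_vol l (cap_coord i c r) + box_vol (cup_coord i c l) r.
Proof.
rewrite /box_vol (bigD1 i)//= [in X in _ = X + _](bigD1 i)//=.
rewrite [in X in _ = _ + X](bigD1 i)//= !mxE !eqxx.
rewrite [X in _ = _ * X + _](eq_bigr (fun j => Num.max 0 (r 0 j - l 0 j))); last first.
  by move=> j /negbTE ji; rewrite !mxE ji.
rewrite [X in _ = _ + _ * X](eq_bigr (fun j => Num.max 0 (r 0 j - l 0 j))); last first.
  by move=> j /negbTE ji; rewrite !mxE ji.
rewrite -mulrDl; congr (_ * _).
move: (l 0 i) (r 0 i) => a b.
by rewrite /Num.max /Num.min; do ! case: ifPn; rewrite -?leNgt => *; lra.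
Qed.

(** Caratheodory's criterion is tested on covers: the hyperplane cuts each box in two, the pieces
    cover the two parts of [X], and the volumes add up. *)
Lemma measurable_halfspace (i : 'I_n) (c : R) :
  measurable ([set x | x 0 i <= c] : set (Rn R n)).
Proof.
apply: (@le_caratheodory_measurable R 'rV[R]_n (@lebesgue_outer R n)) => X /=.
apply/le_ereal_inf_tmp => _ [F [cF XF] <-].
rewrite (eq_esum (b := fun b => ((box_vol b.1 (cap_coord i c b.2))%:E +
   (box_vol (cup_coord i c b.1) b.2)%:E)%E)); last first.
  by move=> b _; rewrite -EFinD -box_vol_split.
rewrite esumD; try by move=> *; rewrite lee_fin box_vol_ge0.
apply: leeD.
- apply: (@lebesgue_outer_cover F (fun b => (b.1, cap_coord i c b.2))) => //.
  move=> x [/XF[b Fb bx] /= xc]; exists b => // j /=.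
  rewrite mxE; have /andP[-> ?] /= := bx j.
  by case: eqVneq => [->|//]; rewrite le_min; apply/andP; split => //; case/andP: (bx i).
- apply: (@lebesgue_outer_cover F (fun b => (cup_coord i c b.1, b.2))) => //.
  move=> x [/XF[b Fb bx] /= /negP]; rewrite -ltNge => xc; exists b => // j /=.
  rewrite mxE; have /andP[? ->] /= := bx j.
  case: eqVneq => [->|_]; rewrite ?andbT// ge_max; apply/andP; split; last exact: ltW.
  by case/andP: (bx i).
Qed.

Lemma measurable_coord (i : 'I_n) :
  measurable_fun setT ((fun x : 'rV[R]_n => x 0 i) : Rn R n -> R).
Proof.
apply: (measurability (@RGenOInfty.G R)); first exact: RGenOInfty.measurableE.
move=> _ [_ [a -> <-]]; rewrite setTI.
rewrite (_ : _ @^-1` _ = ~` [set x : Rn R n | (x : 'rV[R]_n) 0 i <= a]).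
  exact: measurableC (measurable_halfspace i a).
by apply/seteqP; split=> x /=; rewrite in_itv/= andbT ltNge => /negP.
Qed.

Lemma measurable_itvs (J : 'I_n -> interval R) :
  measurable ([set x : 'rV[R]_n | forall i, x 0 i \in J i] : set (Rn R n)).
Proof.
rewrite (_ : [set x | _] = \bigcap_(i in [set: 'I_n])
   ((fun x : 'rV[R]_n => x 0 i) @^-1` [set` J i])); last first.
  by apply/seteqP; split=> [x xJ i _|x xJ i]; [exact: xJ|exact: (xJ i)].
apply: fin_bigcap_measurable => // i _; rewrite -[X in measurable X]setTI.
exact: measurable_coord.
Qed.

Lemma measurable_box l r : measurable (box l r : set (Rn R n)).
Proof.
rewrite (_ : box l r = [set x | forall i, x 0 i \in `[l 0 i, r 0 i]]).
  exact: measurable_itvs.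
by apply/seteqP; split=> x bx i; have := bx i; rewrite in_itv.
Qed.

Lemma measurable_open A : open A -> measurable (A : set (Rn R n)).
Proof.
move=> oA.
(* There are countably many boxes with rational corners, and around each point of [A] one of them
   fits inside [A]. *)
pose rv (v : 'rV[rat]_n) : 'rV[R]_n := map_mx ratr v.
pose D := [set b : 'rV[rat]_n * 'rV[rat]_n | box (rv b.1) (rv b.2) `<=` A].
rewrite (_ : A = \bigcup_(b in D) box (rv b.1) (rv b.2)).
  rewrite bigcup_mkcond; apply: countable_bigcupT_measurable; first exact: countableP.
  by move=> b; case: ifP => _; [exact: measurable_box|exact: measurable0].
apply/seteqP; split=> [x Ax|x [b Db bx]]; last exact: Db.
have /nbhs_ballP[e /= e0 eA] := open_nbhs_nbhs (conj oA Ax).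
have [q qP] : {q : 'I_n -> rat * rat & forall i,
    x 0 i - e < ratr (q i).1 < x 0 i /\ x 0 i < ratr (q i).2 < x 0 i + e}.
  apply: (@choice _ _ (fun i q => x 0 i - e < ratr q.1 < x 0 i /\
    x 0 i < ratr q.2 < x 0 i + e)) => i.
  have [q1] : exists q : rat, ratr q \in `]x 0 i - e, x 0 i[.
    by apply: rat_in_itvoo; rewrite ltrBlDr ltrDl.
  have [q2] : exists q : rat, ratr q \in `]x 0 i, x 0 i + e[.
    by apply: rat_in_itvoo; rewrite ltrDl.
  by rewrite !in_itv => h2 h1; exists (q1, q2).
have bE (y : 'rV[R]_n) : box (rv (\row_i (q i).1)) (rv (\row_i (q i).2)) y <->
    forall i, ratr (q i).1 <= y 0 i <= ratr (q i).2.
  by split=> h i; have := h i; rewrite !mxE.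
exists (\row_i (q i).1, \row_i (q i).2).
  move=> y /bE yb; apply: eA; split => // i j; rewrite ord1.
  have [/andP[h1 h2] /andP[h3 h4]] := qP j; have /andP[h5 h6] := yb j.
  by rewrite /ball/= ltr_distlC; apply/andP; split; lra.
by apply/bE => i; have [/andP[_ /ltW->] /andP[/ltW->]] := qP i.
Qed.

Lemma measurable_continuous (g : 'rV[R]_n -> R) :
  continuous g -> measurable_fun setT (g : Rn R n -> R).
Proof.
move=> cg; apply: (measurability (@RGenOInfty.G R)); first exact: RGenOInfty.measurableE.
move=> _ [_ [a -> <-]]; rewrite setTI.
apply: measurable_open; apply: open_comp => [x _|]; first exact: cg.
by rewrite set_itvE; exact: open_gt.
Qed.

Lemma box_vol_cube (u : 'rV[R]_n) (l : R) : 0 <= l ->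
  box_vol u (u + const_mx l) = l ^+ n.
Proof.
move=> l0; rewrite /box_vol (eq_bigr (fun=> l)) ?prodr_const ?card_ord// => i _.
by rewrite !mxE addrAC subrr add0r max_r.
Qed.

(** The affine map between the two cubes sends covers to covers and multiplies volumes by the n-th
    power of the ratio. Used in both directions, it compares any cube with the unit cube. *)
Lemma lebesgue_outer_scale (u u' : 'rV[R]_n) (l l' : R) : 0 < l -> 0 < l' ->
  (@lebesgue_outer R n (box u' (u' + const_mx l')) <=
   ((l' / l) ^+ n)%:E * @lebesgue_outer R n (box u (u + const_mx l)))%E.
Proof.
move=> l0 l'0; set s := l' / l; have s0 : 0 < s by rewrite divr_gt0.
rewrite -lee_pdivrMl ?exprn_gt0//.
apply/le_ereal_inf_tmp => _ [F [cF XF] <-].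
rewrite lee_pdivrMl ?exprn_gt0// -esumZl; last 2 first.
  by rewrite exprn_ge0// ltW.
  by move=> b; rewrite lee_fin box_vol_ge0.
pose g (b : 'rV[R]_n * 'rV[R]_n) := (u' + s *: (b.1 - u), u' + s *: (b.2 - u)).
rewrite (@eq_esum _ _ _ _ (fun b => (box_vol (g b).1 (g b).2)%:E)); last first.
  move=> b _; have -> : s ^+ n = \prod_(i < n) s by rewrite prodr_const card_ord.
  rewrite -EFinM /box_vol -big_split/=.
  congr (_%:E); apply: eq_bigr => i _; rewrite !mxE maxr_pMr ?ltW// mulr0.
  by congr Num.max; ring.
apply: lebesgue_outer_cover => // x xb.
have /XF[b Fb bx] : box u (u + const_mx l) (u + s^-1 *: (x - u')).
  move=> i; have := xb i; rewrite !mxE /s invf_div => /andP[h1 h2].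
  apply/andP; split.
    by rewrite lerDl mulr_ge0 ?subr_ge0// ltW ?divr_gt0.
  by rewrite lerD2l mulrAC ler_pdivrMr// ler_pM2l//; lra.
exists b => // i; have := bx i; rewrite !mxE => /andP[h1 h2].
have -> : x 0 i = u' 0 i + s * (s^-1 * (x 0 i - u' 0 i)).
  by rewrite mulVKf ?gt_eqF//; ring.
move: h1 h2; set y := s^-1 * _ => h1 h2.
by apply/andP; split; rewrite lerD2l ler_pM2l//; lra.
Qed.
End boxes.

(** * Cubes and the positivity of their volume *)

Section cubes.
Context {R : realType} {n : nat}.
Implicit Types (u x : 'rV[R]_n) (I : set 'rV[R]_n).

Lemma coord_le_norm x i : `|x 0 i| <= `|x|.
Proof.
rewrite [leRHS]/Num.norm/= mx_normrE.
exact: (le_bigmax _ (fun ij => `|x ij.1 ij.2|) (0, i)).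
Qed.

Lemma norm_le_coord x (r : R) : 0 <= r -> (forall i, `|x 0 i| <= r) -> `|x| <= r.
Proof.
move=> r0 xr; rewrite [leLHS]/Num.norm/= mx_normrE; apply: bigmax_le => // -[a b] _ /=.
by rewrite ord1.
Qed.

(** Its value is left open: it serves in lower bounds for volumes of cubes, where positivity is
    enough. *)
Definition unit_vol : R := fine (@lebesgue_outer R n (box 0 (0 + const_mx 1))).

Lemma unit_volE : @lebesgue_outer R n (box 0 (0 + const_mx 1)) = unit_vol%:E.
Proof.
rewrite fineK// ge0_fin_numE ?outer_measure_ge0//.
by apply: le_lt_trans (lebesgue_outer_box_le _ _) _; rewrite ltry.
Qed.

Lemma unit_vol_ge0 : 0 <= unit_vol.
Proof. by apply: fine_ge0; exact: outer_measure_ge0. Qed.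

Lemma lebesgue_cube_le u (l : R) : 0 <= l ->
  (@lebesgue R n (box u (u + const_mx l)%R) <= (l ^+ n)%:E)%E.
Proof. by move=> l0; rewrite -(box_vol_cube u l0); exact: lebesgue_outer_box_le. Qed.

Lemma lebesgue_cube_ge u (l : R) : 0 < l ->
  ((unit_vol * l ^+ n)%:E <= @lebesgue R n (box u (u + const_mx l)%R))%E.
Proof.
move=> l0; have := @lebesgue_outer_scale R n u 0 l 1 l0 ltr01.
rewrite unit_volE expr_div_n expr1n div1r -lee_pdivrMl ?invr_gt0 ?exprn_gt0//.
by rewrite invrK -EFinM mulrC.
Qed.

(** What is kept of a cube: a corner, a side length, and its volume up to constant factors. Which
    faces belong to it is forgotten, at the price of halving the side in the lower bound. *)
Definition cube_spec I u (l : R) :=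
  [/\ 0 < l, measurable (I : set (Rn R n)), I `<=` box u (u + const_mx l),
      (@lebesgue R n I = (vol I)%:E)%E & unit_vol * (l / 2) ^+ n <= vol I <= l ^+ n].

Lemma cubeP I : cube I -> exists u l, cube_spec I u l.
Proof.
move=> [u [l [bl [br [l0 IE]]]]]; exists u, l.
have mI : measurable (I : set (Rn R n)) by rewrite IE; exact: measurable_itvs.
have Isub : I `<=` box u (u + const_mx l).
  move=> x; rewrite IE => xI i; have := xI i; rewrite !mxE in_itv/= => /andP[].
  by move=> /lteifW -> /lteifW ->.
(* The concentric closed cube of half the side avoids all faces of [I]. *)
have subI : box (u + const_mx (l / 4)) (u + const_mx (l / 4) + const_mx (l / 2)) `<=` I.
  move=> x; rewrite IE => xI i; have := xI i; rewrite !mxE in_itv/= => /andP[h1 h2].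
  by apply/andP; split; apply: lteifS; lra.
have Ile : (@lebesgue R n I <= (l ^+ n)%:E)%E.
  by apply: le_trans (lebesgue_cube_le u (ltW l0)); exact: le_outer_measure.
have Ige : ((unit_vol * (l / 2) ^+ n)%:E <= @lebesgue R n I)%E.
  apply: le_trans (lebesgue_cube_ge (u + const_mx (l / 4)) _) _; first by lra.
  exact: le_outer_measure.
have IE' : (@lebesgue R n I = (vol I)%:E)%E.
  rewrite /vol fineK// ge0_fin_numE ?measure_ge0//.
  by rewrite (le_lt_trans Ile)// ltry.
by split => //; rewrite -!lee_fin -IE' Ige.
Qed.

(** Scaling makes every cube null, and countably many cubes exhaust the space. *)
Lemma unit_vol_eq0 : unit_vol = 0 -> forall A, @lebesgue R n A = 0%E.
Proof.
move=> v0 A; apply/eqP; rewrite -measure_le0.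
have A_sub : A `<=` \bigcup_k box (const_mx (- k.+1%:R)) (const_mx (- k.+1%:R) + const_mx (2 * k.+1%:R : R)).
  move=> x _; exists (Num.truncn `|x|) => // i; rewrite !mxE.
  have : `|x 0 i| <= (Num.truncn `|x|).+1%:R.
    by apply: le_trans (coord_le_norm x i) _; rewrite ltW// truncnS_gt.
  by rewrite ler_norml => /andP[? ?]; apply/andP; split => //; lra.
apply: le_trans (le_outer_measure _ _ _ A_sub) _.
apply: le_trans (outer_measure_sigma_subadditive _ _) _.
rewrite eseries0// => k _ _; apply/eqP; rewrite -measure_le0.
apply: le_trans (@lebesgue_outer_scale R n 0 _ 1 _ _ _) _ => //.
by rewrite unit_volE v0 mule0.
Qed.

(** This replaces a computation of the volume of the unit cube: if it were 0, the measure would be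
    zero and every integral would vanish. *)
Lemma unit_vol_gt0 (phi : 'rV[R]_n -> R[i]) : cintegral phi != 0 -> 0 < unit_vol.
Proof.
move=> phi0; rewrite lt_neqAle unit_vol_ge0 andbT eq_sym.
apply: contra phi0 => /eqP /unit_vol_eq0 v0.
have int0 (g : 'rV[R]_n -> R) : \int[@lebesgue R n]_x g x = 0.
  rewrite /Rintegral (eq_measure_integral (@mzero _ (Rn R n) R)).
    by rewrite integral_measure_zero.
  by move=> A _ _; exact: v0.
by rewrite /cintegral !int0.
Qed.

End cubes.

(** * Taylor's formula in one variable *)

Section one_variable.
Context {R : realType}.
Implicit Types (H dH : R -> R) (F : nat -> R -> R).

Lemma derive_line_bound H dH (K y : R) :
  (forall t : R, is_derive t 1 H (dH t)) ->
  (forall t, `|t| <= `|y| -> `|dH t| <= K) -> `|H y - H 0| <= K * `|y|.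
Proof.
move=> dHP HK.
have cH : continuous H.
  by move=> t; apply/differentiable_continuous/derivable1_diffP; case: (dHP t).
have MV a b : a < b -> exists2 c, c \in `]a, b[%R & H b - H a = dH c * (b - a).
  by move=> ab; apply: MVT => //; exact: continuous_subspaceT.
have [y0|y0|->] := ltgtP y 0; last by rewrite subrr !normr0 mulr0.
- have [c] := MV _ _ y0; rewrite in_itv/= => /andP[c1 c2].
  rewrite sub0r distrC => ->; rewrite normrM normrN ler_wpM2r// HK//.
  by rewrite (ltr0_norm y0) (ltr0_norm c2) lerN2 ltW.
- have [c] := MV _ _ y0; rewrite in_itv/= => /andP[c1 c2].
  rewrite subr0 => ->; rewrite normrM ler_wpM2r// HK//.
  by rewrite (gtr0_norm y0) (gtr0_norm c1) ltW.
Qed.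

(** The derivative of the remainder of [F 0] is the remainder of [F 1] of one order less, so the
    mean value theorem gives the induction step. No factorial is gained in the bound, which affects
    constants only. *)
Lemma taylor_line F (m : nat) (M y : R) :
  (forall i (t : R), is_derive t 1 (F i) (F i.+1 t)) ->
  (forall t, `|F m t| <= M) ->
  `|F 0%N y - \sum_(i < m) F i 0 / i`!%:R * y ^+ i| <= M * `|y| ^+ m.
Proof.
elim: m F y => [|m IH] F y dF FM.
  by rewrite big_ord0 subr0 expr0 mulr1.
pose T : {poly R} := \poly_(i < m.+1) (F i 0 / i`!%:R).
have TE x : T.[x] = \sum_(i < m.+1) F i 0 / i`!%:R * x ^+ i by rewrite horner_poly.
have T'E x : T^`().[x] = \sum_(i < m) F i.+1 0 / i`!%:R * x ^+ i.
  rewrite (_ : T^`() = \poly_(i < m) (F i.+1 0 / i`!%:R)) ?horner_poly//.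
  apply/polyP => i; rewrite coef_deriv !coef_poly ltnS; case: ifP; rewrite ?mul0rn//.
  move=> _; rewrite -[_ *+ i.+1]mulr_natr factS natrM invfM -!mulrA; congr (_ * _).
  by rewrite mulrCA mulVf ?mulr1 ?pnatr_eq0.
have dH (t : R) : is_derive t 1 (F 0%N - horner T) (F 1%N t - T^`().[t]).
  exact: is_deriveB.
have T0 : T.[0] = F 0%N 0.
  by rewrite horner_coef0 coef_poly/= fact0 divr1.
have := @derive_line_bound _ _ (M * `|y| ^+ m) y dH.
rewrite !fctE T0 subrr subr0 -TE exprSr mulrA; apply => t ty.
rewrite T'E; apply: le_trans (IH (fun i => F i.+1) t _ _) _ => //.
rewrite ler_wpM2l ?lerXn2r ?nnegrE//.
exact: le_trans (FM 0).
Qed.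

End one_variable.

(** * Taylor's formula in several variables *)

Section multi.
Context {R : realType} {n : nat}.
Implicit Types (g : 'rV[R]_n -> R) (x v : 'rV[R]_n).

Lemma derivable_line g x v (t : R) : derivable g (x + t *: v) v ->
  is_derive t 1 (fun s : R => g (x + s *: v)) ('D_v g (x + t *: v)).
Proof.
have E : (fun h : R => h^-1 *: (((fun s => g (x + s *: v)) \o shift t) (h *: 1) - g (x + t *: v)))
  = (fun h : R => h^-1 *: ((g \o shift (x + t *: v)) (h *: v) - g (x + t *: v))).
  apply/funext => h /=; congr (_ *: (g _ - _)).
  have -> : h *: (1 : R) = h by exact: mulr1.
  by rewrite scalerDl addrCA.
move=> dg; split; first by rewrite /derivable E.
by rewrite /derive E.
Qed.

Lemma partials_cat s1 s2 g : partials (s1 ++ s2) g = partials s1 (partials s2 g).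
Proof. by elim: s1 => //= i s ->. Qed.

Lemma smooth_partials s g : smooth g -> smooth (partials s g).
Proof. by move=> sg s'; rewrite -partials_cat; exact: sg. Qed.

(** Polynomial functions of degree less than [m], as lists of monomials: the moments of an atom are
    given on monomials, and induction on the list extends them to polynomials. *)
Definition polylt (m : nat) (P : 'rV[R]_n -> R) := exists s : seq (R * ('I_n -> nat)),
  (forall t, List.In t s -> (\sum_(i < n) t.2 i < m)%N) /\
  forall x, P x = \sum_(t <- s) t.1 * \prod_(i < n) x 0 i ^+ t.2 i.

Lemma polylt_cst (m : nat) (c : R) : polylt m.+1 (fun=> c).
Proof.
exists [:: (c, fun=> 0%N)]; split; first by move=> t /= [<-|//] /=; rewrite big1.
by move=> x; rewrite big_seq1/= big1 ?mulr1.
Qed.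

Lemma polylt0 (m : nat) : polylt m (fun=> 0).
Proof. by exists [::]; split => // x; rewrite big_nil. Qed.

Lemma polyltW (m m' : nat) P : (m <= m')%N -> polylt m P -> polylt m' P.
Proof. by move=> mm' [s [sm sE]]; exists s; split => // t /sm /leq_trans; apply. Qed.

Lemma polyltD (m : nat) P Q : polylt m P -> polylt m Q -> polylt m (fun x => P x + Q x).
Proof.
move=> [s [sm sE]] [s' [s'm s'E]]; exists (s ++ s'); split => [t|x].
  by move/List.in_app_iff => [/sm|/s'm].
by rewrite big_cat/= sE s'E.
Qed.

Lemma polyltZ (m : nat) (c : R) P : polylt m P -> polylt m (fun x => c * P x).
Proof.
move=> [s [sm sE]]; exists [seq (c * t.1, t.2) | t <- s]; split => [t|x].
  by move/List.in_map_iff => [t' [<- /sm]].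
by rewrite big_map sE mulr_sumr; apply: eq_bigr => t _; rewrite mulrA.
Qed.

Lemma polylt_mulcoord (m : nat) (k : 'I_n) P : polylt m P -> polylt m.+1 (fun x => x 0 k * P x).
Proof.
move=> [s [sm sE]]; exists [seq (t.1, fun i => (t.2 i + (i == k))%N) | t <- s]; split => [t|x].
  move/List.in_map_iff => [t' [<- /sm]] /=.
  rewrite big_split/=.
  have -> : (\sum_(i < n) (i == k) = 1)%N.
    by rewrite (bigD1 k)//= eqxx big1// => i /negbTE ->.
  by rewrite addn1.
rewrite big_map sE mulr_sumr; apply: eq_bigr => t _ /=.
under [in RHS]eq_bigr do rewrite exprD.
rewrite big_split/= [X in _ = _ * (_ * X)](bigD1 k)//= eqxx expr1.
rewrite [X in _ = _ * (_ * (_ * X))]big1 ?mulr1; last by move=> i /negbTE ->.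
by rewrite mulrCA [x 0 k * _]mulrC.
Qed.

Lemma polylt_mulX (m : nat) (k : 'I_n) (c : R) i P :
  polylt m P -> polylt (m + i) (fun x => (x 0 k - c) ^+ i * P x).
Proof.
elim: i m P => [|i IH] m P mP.
  by rewrite addn0 (_ : (fun x => _) = P)//; apply/funext => x; rewrite expr0 mul1r.
rewrite addnS -addSn (_ : (fun x => _) =
   (fun x => (x 0 k - c) ^+ i * (x 0 k * P x + (- c) * P x))).
  apply/IH/polyltD; first exact: polylt_mulcoord.
  by apply/polyltZ; exact: polyltW mP.
by apply/funext => x; rewrite exprSr -mulrA mulrDl.
Qed.

Lemma polylt_sum (m k : nat) (P : 'I_k -> 'rV[R]_n -> R) :
  (forall i, polylt m (P i)) -> polylt m (fun x => \sum_(i < k) P i x).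
Proof.
elim: k P => [|k IH] P mP.
  by rewrite (_ : (fun x => _) = fun=> 0); [exact: polylt0|apply/funext => x; rewrite big_ord0].
rewrite (_ : (fun x => _) = (fun x => P ord0 x + \sum_(i < k) P (lift ord0 i) x)).
  by apply: polyltD => //; exact: IH.
by apply/funext => x; rewrite big_ord_recl.
Qed.

(** Releases the variables one at a time, so that the one-variable formula suffices. *)
Definition freeze x0 (k : nat) x : 'rV[R]_n := \row_(i < n) if (i < k)%N then x 0 i else x0 0 i.

(** Induction on the number of released coordinates: expand in the new one, then replace the i-th
    coefficient, a function of the earlier coordinates, by a polynomial of degree less than [m - i].
    Only derivatives of total order [m] are bounded, in the order in which they arise, so mixed
    partials are never interchanged. *)
Lemma taylor_freeze (k m : nat) g (M : R) x0 : (k <= n)%N -> 0 <= M -> smooth g ->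
  (forall s x, size s = m -> `|partials s g x| <= M) ->
  exists2 P, polylt m P & forall (l : R) x, `|x - x0| <= l ->
    `|g (freeze x0 k x) - P x| <= (m.+1 ^ k)%:R * (M * l ^+ m).
Proof.
elim: k m g M => [|k IH] m g M kn M0 sg gM.
  have fE x : freeze x0 0 x = x0 by apply/rowP => i; rewrite mxE.
  (* With no coordinate released, [g] is evaluated at [x0] only. For order 0 the only polynomial
     allowed is 0 and the bound on [g] itself is used; otherwise the constant [g x0] is exact. *)
  case: m gM => [|m] gM.
    exists (fun=> 0); first exact: polylt0.
    by move=> l x _; rewrite fE subr0 mul1r expr0 mulr1; exact: (gM [::]).
  exists (fun=> g x0); first exact: polylt_cst.
  move=> l x xl; rewrite fE subrr normr0 mulr_ge0// mulr_ge0//.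
  by rewrite exprn_ge0// (le_trans _ xl).
pose k0 := Ordinal kn.
pose gi i := partials (nseq i k0) g.
have [P PP] : {P : 'I_m -> 'rV[R]_n -> R & forall i : 'I_m, polylt (m - i)%N (P i) /\
   forall (l : R) x, `|x - x0| <= l -> `|gi i (freeze x0 k x) - P i x| <=
      ((m - i).+1 ^ k)%:R * (M * l ^+ (m - i))}.
  apply: (@choice _ _ (fun (i : 'I_m) P => polylt (m - i)%N P /\
   forall (l : R) x, `|x - x0| <= l -> `|gi i (freeze x0 k x) - P x| <=
      ((m - i).+1 ^ k)%:R * (M * l ^+ (m - i)))) => i.
  have [|||s x sz|P P1 P2] := IH (m - i)%N (gi i) M; last by exists P.
  - exact: ltnW.
  - exact: M0.
  - exact: smooth_partials.
  - by rewrite /gi -partials_cat gM// size_cat size_nseq sz subnK// ltnW.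
exists (fun x => \sum_(i < m) (i`!%:R)^-1 * ((x 0 k0 - x0 0 k0) ^+ i * P i x)).
  apply: polylt_sum => i; apply: polyltZ; have [Pi _] := PP i.
  by have := polylt_mulX k0 (x0 0 k0) i Pi; rewrite subnK// ltnW.
move=> l x xl; set y := x 0 k0 - x0 0 k0.
have l0 : 0 <= l by apply: le_trans xl.
have yl : `|y| <= l.
  by apply: le_trans xl; have := coord_le_norm (x - x0) k0; rewrite !mxE.
have fS : freeze x0 k.+1 x = freeze x0 k x + y *: 'e_k0.
  apply/rowP => i; rewrite !mxE eqxx/= ltnS leq_eqVlt -val_eqE/=.
  case: eqVneq => [ik|ik]/=.
    have -> : i = k0 by apply: val_inj.
    by rewrite /= ltnn mulr1 /y; ring.
  by rewrite mulr0 addr0.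
pose F i (t : R) := gi i (freeze x0 k x + t *: 'e_k0).
have dF i (t : R) : is_derive t 1 (F i) (F i.+1 t).
  apply: derivable_line; exact: (sg (nseq i k0)).2.
have FmM t : `|F m t| <= M by rewrite gM// size_nseq.
have := taylor_line y dF FmM; rewrite fS -/(F 0%N y) => h1.
(* The remainder in the new coordinate counts once and each of the [m] coefficients counts
   [m.+1 ^ k] times; together this is at most [m.+1 ^ k.+1]. *)
apply: le_trans (_ : M * l ^+ m + \sum_(i < m) (m.+1 ^ k)%:R * (M * l ^+ m) <= _).
  set A := \sum_(i < m) F i 0 / _ * _ in h1.
  rewrite -(subrKA A) (le_trans (ler_normD _ _))// lerD//.
    by apply: le_trans h1 _; rewrite ler_wpM2l// lerXn2r// nnegrE.
  rewrite /A -sumrB (le_trans (ler_norm_sum _ _ _))//; apply: ler_sum => i _.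
  have -> : F i 0 = gi i (freeze x0 k x) by rewrite /F scale0r addr0.
  set a := (i`!%:R)^-1; set b := gi i _; set c := P i x.
  have -> : b * a * y ^+ i - a * (y ^+ i * c) = a * (y ^+ i * (b - c)) by ring.
  rewrite normrM -[leRHS]mul1r ler_pM//.
    by rewrite /a ger0_norm// invf_le1 ?ltr0n ?fact_gt0// ler1n fact_gt0.
  rewrite normrM normrX.
  apply: le_trans (_ : l ^+ i * (((m - i).+1 ^ k)%:R * (M * l ^+ (m - i))) <= _).
    by rewrite ler_pM// ?exprn_ge0// ?lerXn2r// ?nnegrE//; have [_] := PP i; apply.
  rewrite mulrCA; apply: ler_pM => //.
  - by rewrite mulr_ge0 ?exprn_ge0// mulr_ge0// exprn_ge0.
  - by rewrite !natrX lerXn2r ?nnegrE ?ler0n // ler_nat ltnS leq_subr.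
  - by rewrite mulrCA -exprD subnKC// ltnW.
rewrite sumr_const card_ord -[_ *+ m]mulr_natl; set K := M * _; set a := (m.+1 ^ k)%:R * K.
rewrite [m%:R * a]mulrA -[X in X + _]mul1r -mulrDl ler_wpM2r ?mulr_ge0 ?exprn_ge0//.
rewrite -natrM -[1]/(1%:R) -natrD ler_nat.
by rewrite expnS mulSn leq_add2r expn_gt0.
Qed.

Lemma taylor (m : nat) g (M : R) x0 : 0 <= M -> smooth g ->
  (forall s x, size s = m -> `|partials s g x| <= M) ->
  exists2 P, polylt m P & forall (l : R) x, `|x - x0| <= l ->
    `|g x - P x| <= (m.+1 ^ n)%:R * (M * l ^+ m).
Proof.
move=> M0 sg gM; have [P mP gP] := taylor_freeze x0 (leqnn n) M0 sg gM.
exists P => // l x /gP; rewrite (_ : freeze x0 n x = x)//.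
by apply/rowP => i; rewrite mxE ltn_ord.
Qed.

End multi.

Section complex_modulus.
Context {R : realType}.
Implicit Types z w : R[i].

Lemma cabsM z w : cabs (z * w) = cabs z * cabs w. Proof. exact: Normc.normcM. Qed.
Lemma cabsD z w : cabs (z + w) <= cabs z + cabs w. Proof. exact: le_normcD. Qed.
Lemma cabsN z : cabs (- z) = cabs z. Proof. exact: normcN. Qed.
Lemma cabs0 : cabs 0 = 0 :> R. Proof. exact: Normc.normc0. Qed.
Lemma cabs_ge0 z : 0 <= cabs z. Proof. by case: z => a b; exact: sqrtr_ge0. Qed.
Lemma cabs_eq0 z : cabs z = 0 -> z = 0. Proof. exact: Normc.eq0_normc. Qed.

Lemma cabs_Re z : `|complex.Re z| <= cabs z.
Proof.
by case: z => a b; rewrite /cabs/= -sqrtr_sqr ler_sqrt ?addr_ge0 ?sqr_ge0// lerDl sqr_ge0.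
Qed.

Lemma cabs_Im z : `|complex.Im z| <= cabs z.
Proof.
by case: z => a b; rewrite /cabs/= -sqrtr_sqr ler_sqrt ?addr_ge0 ?sqr_ge0// lerDr sqr_ge0.
Qed.

Lemma cabs_le z : cabs z <= `|complex.Re z| + `|complex.Im z|.
Proof.
case: z => a b; rewrite /cabs/= -[leRHS]ger0_norm ?addr_ge0// -sqrtr_sqr.
rewrite ler_sqrt ?sqr_ge0// sqrrD !real_normK ?num_real//.
by rewrite lerD2r lerDl mulrn_wge0// mulr_ge0.
Qed.

Lemma cReM z w : complex.Re (z * w) = complex.Re z * complex.Re w - complex.Im z * complex.Im w.
Proof. by case: z w => [a b] [c d]. Qed.
Lemma cImM z w : complex.Im (z * w) = complex.Re z * complex.Im w + complex.Im z * complex.Re w.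
Proof. by case: z w => [a b] [c d]. Qed.
Lemma cReD z w : complex.Re (z + w) = complex.Re z + complex.Re w.
Proof. by case: z w => [a b] [c d]. Qed.
Lemma cImD z w : complex.Im (z + w) = complex.Im z + complex.Im w.
Proof. by case: z w => [a b] [c d]. Qed.

End complex_modulus.

(** * Derivatives of smooth functions: affine changes of variable, bounds, Lipschitz estimates *)

Section smooth_functions.
Context {R : realType} {n : nat}.
Implicit Types (g h : 'rV[R]_n -> R) (x v : 'rV[R]_n).

Lemma is_derive_line g x v (d : R) :
  is_derive (0 : R) 1 (fun s : R => g (x + s *: v)) d -> is_derive x v g d.
Proof.
have E : (fun h : R => h^-1 *: (((fun s : R => g (x + s *: v)) \o shift 0) (h *: 1) - g (x + (0 : R) *: v)))
  = (fun h : R => h^-1 *: ((g \o shift x) (h *: v) - g x)).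
  apply/funext => h /=; rewrite scale0r !addr0; congr (_ *: (g _ - _)).
  have -> : h *: (1 : R) = h by exact: mulr1.
  by rewrite addrC.
case; rewrite /derivable /derive E => d1 d2; exact: DeriveDef.
Qed.

(** The chain rule. The [is_derive] half is what smoothness of the composition needs, since the
    value of ['D] alone does not show derivability. *)
Lemma partials_affine g (a c : R) b (s : seq 'I_n) : smooth g ->
  partials s (fun y => a * g (b + c *: y)) =
  (fun y => a * c ^+ size s * partials s g (b + c *: y)) /\
  forall i x, is_derive x 'e_i (partials s (fun y => a * g (b + c *: y)))
    (a * c ^+ (size s).+1 * partials (i :: s) g (b + c *: x)).
Proof.
move=> sg.
have D (K : R) h i x : smooth h ->
    is_derive x 'e_i (fun y => K * h (b + c *: y)) (K * c * partials [:: i] h (b + c *: x)).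
  move=> sh; apply: is_derive_line.
  have dh : is_derive (c * 0 : R) 1 (fun s : R => h (b + c *: x + s *: 'e_i))
      (partials [:: i] h (b + c *: x)).
    have := @derivable_line R n h (b + c *: x) 'e_i (c * 0).
    by rewrite mulr0 scale0r addr0; apply; exact: (sh [::]).2.
  have dc : is_derive (0 : R) 1 ( *%R c) c.
    by apply: is_derive_eq; rewrite /GRing.scale/= mulr1.
  have -> : (fun s : R => K * h (b + c *: (x + s *: 'e_i))) =
      K \*: ((fun s : R => h (b + c *: x + s *: 'e_i)) \o *%R c).
    by apply/funext => t /=; rewrite scalerDr scalerA addrA.
  by apply: is_derive_eq; rewrite /GRing.scale/= -mulrA [c * _]mulrC.
have F : partials s (fun y => a * g (b + c *: y)) =
  (fun y => a * c ^+ size s * partials s g (b + c *: y)).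
  elim: s => [|i s IH] /=; first by apply/funext => y; rewrite mulr1.
  apply/funext => x; rewrite IH.
  have [_ ->] := D (a * c ^+ size s) _ i x (smooth_partials s sg).
  by rewrite exprSr mulrA.
split=> // i x; rewrite F exprSr mulrA.
exact: D (a * c ^+ size s) _ i x (smooth_partials s sg).
Qed.

Lemma smooth_affine g (a c : R) b : smooth g -> smooth (fun y => a * g (b + c *: y)).
Proof.
move=> sg s; split; last by move=> i x; have [_ /(_ i x)[]] := partials_affine a c b s sg.
rewrite (partials_affine a c b s sg).1 => x.
have caff : {for x, continuous (fun y : 'rV[R]_n => b + c *: y)}.
  exact: (cvgD (cvg_cst b) (cvgZl_tmp (k := c) cvg_id)).
apply: (cvgMl_tmp (g := fun y => partials s g (b + c *: y))).
  exact: nbhs_filter.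
exact: (cvg_comp _ _ caff ((sg s).1 _)).
Qed.

Lemma partials_lin g h (a b : R) (s : seq 'I_n) : smooth g -> smooth h ->
  partials s (fun y => a * g y + b * h y) =
  (fun y => a * partials s g y + b * partials s h y).
Proof.
move=> sg sh; elim: s => [//|i s IH] /=; rewrite IH; apply/funext => x.
have [_ <-//] : is_derive x 'e_i (a \*: partials s g + b \*: partials s h)
  (a *: 'D_('e_i) (partials s g) x + b *: 'D_('e_i) (partials s h) x).
apply: is_deriveD; apply: is_deriveZ; apply: DeriveDef => //.
  exact: (sg s).2.
exact: (sh s).2.
Qed.

Lemma smooth_lin g h (a b : R) : smooth g -> smooth h ->
  smooth (fun y => a * g y + b * h y).
Proof.
move=> sg sh s; rewrite partials_lin//; split=> [x|i x].
  exact: (cvgD (cvgMl_tmp (a := a) ((sg s).1 x)) (cvgMl_tmp (a := b) ((sh s).1 x))).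
have : derivable (a \*: partials s g + b \*: partials s h) x 'e_i.
  by apply: derivableD; apply: derivableZ; [exact: (sg s).2|exact: (sh s).2].
by [].
Qed.

Lemma partials_supp g (r : R) s : (forall x, r < `|x| -> g x = 0) ->
  forall x, r < `|x| -> partials s g x = 0.
Proof.
move=> g0; elim: s => [//|i s IH] x rx /=.
have : \forall y \near x, (cst 0 : 'rV[R]_n -> R) y = partials s g y.
  have op : open [set y : 'rV[R]_n | r < `|y|].
    apply: (@open_comp _ _ (fun y : 'rV[R]_n => `|y|) [set t | r < t]); last exact: open_gt.
    by move=> y _; exact: norm_continuous.
  by apply: filterS (open_nbhs_nbhs (conj op rx)) => y /IH ->.
by move=> /near_eq_derive <-; exact: derive_cst.
Qed.

Lemma partials_bounded g (r : R) s : smooth g -> (forall x, r < `|x| -> g x = 0) ->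
  exists G : R, forall x, `|partials s g x| <= G.
Proof.
move=> sg g0; have cK : compact [set x : 'rV[R]_n | `|x| <= r].
  apply: bounded_closed_compact.
    by exists r; split; [exact: num_real|move=> t rt x /= xr; rewrite ltW// (le_lt_trans xr)].
  apply: (@closed_comp _ _ (fun y : 'rV[R]_n => `|y|) [set t | t <= r]); last exact: closed_le.
  by move=> y _; exact: norm_continuous.
have /compact_bounded[G [_ GP]] : compact (partials s g @` [set x | `|x| <= r]).
  apply: continuous_compact => //; apply: continuous_subspaceT => x; exact: (sg s).1.
exists (Num.max 0 (G + 1)) => x; have [xr|rx] := leP `|x| r; last first.
  by rewrite (partials_supp _ g0)// normr0 le_max lexx.
rewrite le_max; apply/orP; right; apply: (GP (G + 1)); first by rewrite ltrDl.
by exists x.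
Qed.

(** Sequences of length at most [N] in finitely many directions are finite in number; this merges
    separate bounds on derivatives into one. *)
Lemma seq_bound (B : seq 'I_n -> R) N : exists M : R,
  0 <= M /\ forall s, (size s <= N)%N -> B s <= M.
Proof.
elim: N B => [|N IH] B.
  by exists `|B [::]|; split => // -[|//] _; exact: ler_norm.
have [M MP] : {M : 'I_n -> R & forall i, 0 <= M i /\ forall s, (size s <= N)%N -> B (i :: s) <= M i}.
  by apply: (@choice _ _ (fun i M => 0 <= M /\ forall s, (size s <= N)%N -> B (i :: s) <= M)) => i.
have S0 : 0 <= \sum_i M i by apply: sumr_ge0 => i _; case: (MP i).
exists (`|B [::]| + \sum_i M i); split; first by rewrite addr_ge0.
case=> [_|i s sN]; first by rewrite (le_trans (ler_norm _))// lerDl.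
rewrite (le_trans ((MP i).2 s sN))// (bigD1 i)//= addrCA lerDl addr_ge0//.
by apply: sumr_ge0 => j _; case: (MP j).
Qed.

(** Taylor's formula of order 1 at [y]: a polynomial of degree less than 1 is constant, and
    comparing both [g x] and [g y] with it doubles the factor. *)
Lemma smooth_lipschitz g (G : R) : smooth g -> 0 <= G ->
  (forall i x, `|partials [:: i] g x| <= G) ->
  forall x y, `|g x - g y| <= (2 ^ n).*2%:R * G * `|x - y|.
Proof.
move=> sg G0 gG x y.
have [|P P1 gP] := @taylor R n 1%N g G y G0 sg.
  by case=> [|i []]// x' _; exact: gG.
have [s [s0 PE]] := P1.
have Pc z : P z = P y.
  rewrite !PE; elim: s s0 {PE} => [|t s IH] s0; first by rewrite !big_nil.
  rewrite !big_cons IH => [|t' t's]; last by apply: s0; right.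
  have /eqP : (\sum_(i < n) t.2 i)%N = 0%N.
    by apply/eqP; rewrite -leqn0 -ltnS; apply: s0; left.
  rewrite sum_nat_eq0 => /forallP t0; congr (_ * _ + _).
  by apply: eq_bigr => i _; rewrite (eqP (t0 i)) !expr0.
have := gP `|x - y| x (lexx _); have := gP `|x - y| y _.
rewrite subrr normr0 => /(_ (normr_ge0 _)); rewrite Pc expr1 => h1 h2.
rewrite -(subrKA (P y)) (le_trans (ler_normD _ _))// [X in _ + X]distrC.
by rewrite -addnn natrD !mulrDl lerD// -mulrA.
Qed.

End smooth_functions.

Local Open Scope complex_scope.

(** * Test functions, their dilates, and continuity of the convolution with a distribution *)

Section test_functions.
Context {R : realType} {n : nat}.
Implicit Types (psi phi : 'rV[R]_n -> R[i]) (x y : 'rV[R]_n).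

Lemma closed_normball (r : R) : closed [set x : 'rV[R]_n | `|x| <= r].
Proof.
apply: (@closed_comp _ _ (fun y : 'rV[R]_n => `|y|) [set t | t <= r]); last exact: closed_le.
by move=> y _; exact: norm_continuous.
Qed.

Lemma compact_normball (r : R) : compact [set x : 'rV[R]_n | `|x| <= r].
Proof.
apply: bounded_closed_compact; last exact: closed_normball.
by exists r; split; [exact: num_real|move=> t rt x /= xr; rewrite ltW// (le_lt_trans xr)].
Qed.

Lemma csupp_normball psi (r : R) :
  (forall x, r < `|x| -> psi x = 0) -> csupp psi `<=` [set x | `|x| <= r].
Proof.
move=> psi0; rewrite /csupp closureE; apply: smallest_sub; first exact: closed_normball.
by move=> x /= xN0; rewrite leNgt; apply/negP => /psi0 x0; rewrite x0 eqxx in xN0.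
Qed.

Lemma test_functionP psi : test_function psi <->
  csmooth psi /\ exists r : R, forall x, r < `|x| -> psi x = 0.
Proof.
split=> [[spsi /compact_bounded[r [_ rP]]]|[spsi [r psi0]]]; split => //.
  exists (r + 1) => x rx; apply/eqP; apply: contraTT rx => xN0.
  rewrite -leNgt; apply: (rP (r + 1)); first by rewrite ltrDl.
  exact: subset_closure.
apply: (@subclosed_compact _ (csupp psi) [set x | `|x| <= r]).
- exact: closed_closure.
- exact: compact_normball.
- exact: csupp_normball.
Qed.

Lemma test_function_bound phi N : test_function phi -> exists (G r : R),
  [/\ 0 < G, 0 < r, forall x, r < `|x| -> phi x = 0 &
   forall s x, (size s <= N)%N ->
     `|partials s (fun y => complex.Re (phi y)) x| <= G /\
     `|partials s (fun y => complex.Im (phi y)) x| <= G].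
Proof.
move=> /test_functionP[[sRe sIm] [r phi0]].
have Re0 x : r < `|x| -> complex.Re (phi x) = 0 by move=> /phi0 ->.
have Im0 x : r < `|x| -> complex.Im (phi x) = 0 by move=> /phi0 ->.
have [B BP] : {B : seq 'I_n -> R & forall s x,
    `|partials s (fun y => complex.Re (phi y)) x| <= B s /\
    `|partials s (fun y => complex.Im (phi y)) x| <= B s}.
  apply: (@choice _ _ (fun s B => forall x,
    `|partials s (fun y => complex.Re (phi y)) x| <= B /\
    `|partials s (fun y => complex.Im (phi y)) x| <= B)) => s.
  have [G1 G1P] := partials_bounded s sRe Re0.
  have [G2 G2P] := partials_bounded s sIm Im0.
  exists (Num.max G1 G2) => x.
  by split; rewrite le_max ?G1P ?G2P ?orbT.
have [G [G0 GP]] := seq_bound B N.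
exists (G + 1), (Num.max r 1); split.
- by rewrite ltr_wpDl.
- by rewrite lt_max ltr01 orbT.
- by move=> x; rewrite gt_max => /andP[/phi0].
- move=> s x /GP sG; have [h1 h2] := BP s x.
  by split; [apply: le_trans h1 _|apply: le_trans h2 _]; rewrite ler_wpDr.
Qed.

Lemma Re_dilate phi (t : R) x : (fun y => complex.Re (dilate phi t (x - y))) =
  fun y => t ^- n * complex.Re (phi (t^-1 *: x + - t^-1 *: y)).
Proof. by apply/funext => y; rewrite /dilate cReM/= mul0r subr0 scalerBr scaleNr. Qed.

Lemma Im_dilate phi (t : R) x : (fun y => complex.Im (dilate phi t (x - y))) =
  fun y => t ^- n * complex.Im (phi (t^-1 *: x + - t^-1 *: y)).
Proof. by apply/funext => y; rewrite /dilate cImM/= mul0r addr0 scalerBr scaleNr. Qed.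

Lemma dilate_partials phi (t G : R) N x s y : 0 < t -> csmooth phi ->
  (forall s x, (size s <= N)%N ->
     `|partials s (fun y => complex.Re (phi y)) x| <= G /\
     `|partials s (fun y => complex.Im (phi y)) x| <= G) -> (size s <= N)%N ->
  `|partials s (fun y => complex.Re (dilate phi t (x - y))) y| <= G * t ^- (n + size s) /\
  `|partials s (fun y => complex.Im (dilate phi t (x - y))) y| <= G * t ^- (n + size s).
Proof.
move=> t0 [sRe sIm] GP sN; rewrite Re_dilate Im_dilate.
rewrite (partials_affine (t ^- n) (- t^-1) (t^-1 *: x) s sRe).1.
rewrite (partials_affine (t ^- n) (- t^-1) (t^-1 *: x) s sIm).1.
have E : `|t ^- n * (- t^-1) ^+ size s| = t ^- (n + size s).
  rewrite normrM normrX normrN !normfV normrX !gtr0_norm//.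
  by rewrite exprD invfM exprVn.
have [h1 h2] := GP s (t^-1 *: x + - t^-1 *: y) sN.
by rewrite ![`|_ * partials _ _ _|]normrM E mulrC [X in _ /\ X <= _]mulrC; split;
  rewrite ler_wpM2r// invr_ge0 exprn_ge0// ltW.
Qed.

Lemma test_function_affine phi (a c : R) b : c != 0 -> test_function phi ->
  test_function (fun y => a%:C * phi (b + c *: y)).
Proof.
move=> c0 /test_functionP[[sRe sIm] [r phi0]]; apply/test_functionP; split.
  split.
    have -> : (fun y => complex.Re (a%:C * phi (b + c *: y))) =
        fun y => a * complex.Re (phi (b + c *: y)).
      by apply/funext => y; rewrite cReM/= mul0r subr0.
    exact: (@smooth_affine _ _ (fun y => complex.Re (phi y))).
  have -> : (fun y => complex.Im (a%:C * phi (b + c *: y))) =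
      fun y => a * complex.Im (phi (b + c *: y)).
    by apply/funext => y; rewrite cImM/= mul0r addr0.
  exact: (@smooth_affine _ _ (fun y => complex.Im (phi y))).
exists ((r + `|b|) / `|c|) => x; rewrite ltr_pdivrMr ?normr_gt0// => rx.
rewrite phi0 ?mulr0//; have := ler_normB (b + c *: x) b.
by rewrite [b + _]addrC addrK normrZ mulrC => h; lra.
Qed.

Lemma test_function_dilate phi (t : R) : 0 < t -> test_function phi ->
  test_function (dilate phi t).
Proof.
move=> t0 tphi; have := @test_function_affine phi (t ^- n) t^-1 0 _ tphi.
rewrite invr_eq0 gt_eqF// => /(_ isT).
by rewrite /dilate; under eq_fun do rewrite add0r.
Qed.

Lemma test_function_reflect phi x : test_function phi ->
  test_function (fun y => phi (x - y)).
Proof.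
move=> tphi; have := @test_function_affine phi 1 (-1) x _ tphi.
rewrite oppr_eq0 oner_eq0 => /(_ isT).
by under eq_fun do rewrite mul1r scaleN1r.
Qed.

Lemma partials_reflect_sub (g : 'rV[R]_n -> R) s x x' y : smooth g ->
  partials s (fun y => - g (x' - y) + g (x - y)) y =
  (-1) ^+ size s * (partials s g (x - y) - partials s g (x' - y)).
Proof.
move=> sg.
have -> : (fun y => - g (x' - y) + g (x - y)) =
   fun y => (-1) * (1 * g (x' + (-1) *: y)) + 1 * (1 * g (x + (-1) *: y)).
  by apply/funext => z; rewrite !mul1r mulN1r !scaleN1r.
rewrite partials_lin; try exact: smooth_affine.
rewrite !(partials_affine _ _ _ _ sg).1 !scaleN1r; ring.
Qed.

Lemma partials_reflect_sub_le (g : 'rV[R]_n -> R) s (G : R) x x' y :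
  smooth g -> 0 <= G -> (forall i z, `|partials (i :: s) g z| <= G) ->
  `|partials s (fun y => - g (x' - y) + g (x - y)) y| <= (2 ^ n).*2%:R * G * `|x - x'|.
Proof.
move=> sg G0 gG; rewrite partials_reflect_sub// normrM normrX normrN1 expr1n mul1r.
have -> : x - x' = (x - y) - (x' - y) by rewrite opprB subrKA.
exact: (smooth_lipschitz (smooth_partials s sg)).
Qed.

(** For x' within distance 1 of x all the functions phi (x' - .) live in a single ball, so one
    seminorm estimate of the distribution serves for all of them; the seminorm of the difference is
    Lipschitz in x'. *)
Lemma dconv_continuous (f : ('rV[R]_n -> R[i]) -> R[i]) phi x (e : R) :
  is_distribution f -> test_function phi -> 0 < e -> exists2 d : R, 0 < d &
  forall x', `|x - x'| < d -> cabs (dconv f phi x - dconv f phi x') < e.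
Proof.
move=> [lf df] tphi e0; have /test_functionP[[sRe sIm] _] := tphi.
have [_ [r [_ r0 phi0 _]]] := test_function_bound 0 tphi.
have [B [N fB]] := df _ (@compact_normball (`|x| + 1 + r)).
(* One order more than the distribution asks for: the Lipschitz constant of a derivative is given by
   the next ones. *)
have [G [_ [G0 _ _ GP]]] := test_function_bound N.+1 tphi.
pose L : R := ((2 ^ n).*2%:R * G) *+ 2.
have L0 : 0 <= L by rewrite mulrn_wge0// mulr_ge0// ltW.
have BL : 0 < `|B| * L + 1 by rewrite ltr_wpDl// mulr_ge0.
exists (Num.min 1 (e / (`|B| * L + 1))); first by rewrite lt_min ltr01 divr_gt0.
move=> x'; rewrite lt_min => /andP[xx1 xxe].
(* The difference in the form to which [linear_on] applies. *)
pose psi y := - 1 * phi (x' - y) + phi (x - y).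
have tx z := test_function_reflect z tphi.
have -> : dconv f phi x - dconv f phi x' = f psi.
  by rewrite /psi lf// /dconv mulN1r addrC.
have psi0 y : `|x| + 1 + r < `|y| -> psi y = 0.
  move=> h; rewrite /psi !phi0 ?mulr0 ?addr0//.
    by have := ler_normB (x - y) x; rewrite addrAC subrr add0r normrN => h'; lra.
  have := ler_normB (x' - y) x'; rewrite addrAC subrr add0r normrN.
  by have := ler_normB (x - x') x; rewrite addrAC subrr add0r normrN => h1 h2; lra.
have Lxx : 0 <= L * `|x - x'| by rewrite mulr_ge0.
apply: le_lt_trans (fB psi (L * `|x - x'|) _ (csupp_normball psi0) _) _.
- apply/test_functionP; split; last by eexists; exact: psi0.
  have E (g : 'rV[R]_n -> R) : (fun y => - g (x' - y) + g (x - y)) =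
     fun y => (-1) * (1 * g (x' + (-1) *: y)) + 1 * (1 * g (x + (-1) *: y)).
    by apply/funext => z; rewrite !mul1r mulN1r !scaleN1r.
  split; rewrite /psi.
    under eq_fun do rewrite mulN1r cReD raddfN.
    rewrite (E (fun y => complex.Re (phi y))).
    by apply: smooth_lin; exact: (@smooth_affine _ _ (fun y => complex.Re (phi y))).
  under eq_fun do rewrite mulN1r cImD raddfN.
  rewrite (E (fun y => complex.Im (phi y))).
  by apply: smooth_lin; exact: (@smooth_affine _ _ (fun y => complex.Im (phi y))).
- move=> s y sN; apply: le_trans (cabs_le _) _; rewrite /cpartials/= /psi.
  under eq_fun do rewrite mulN1r cReD raddfN.
  under [X in _ + `|partials _ X _|]eq_fun do rewrite mulN1r cImD raddfN.
  rewrite /L mulr2n mulrDl; apply: lerD.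
    apply: (@partials_reflect_sub_le (fun y => complex.Re (phi y))) => //; first exact: ltW.
    by move=> i z; exact: (GP (i :: s) z _).1.
  apply: (@partials_reflect_sub_le (fun y => complex.Im (phi y))) => //; first exact: ltW.
  by move=> i z; exact: (GP (i :: s) z _).2.
apply: le_lt_trans (_ : (`|B| * L + 1) * `|x - x'| < _).
  rewrite mulrA ler_wpM2r// (le_trans _ (_ : `|B| * L <= _))//; last by rewrite lerDl.
  by rewrite ler_wpM2r// ler_norm.
by rewrite mulrC -ltr_pdivlMr.
Qed.

End test_functions.

(** * Integral estimates, with and without cancellation *)

Section integral_bounds.
Context {R : realType} {n : nat}.
Notation mu := (@lebesgue R n).
Implicit Types (g h b : Rn R n -> R) (H : Rn R n -> \bar R) (I : set (Rn R n)).

Lemma le_integralT (f1 f2 : Rn R n -> \bar R) :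
  measurable_fun setT f1 -> measurable_fun setT f2 ->
  (forall x, 0 <= f1 x)%E -> (forall x, f1 x <= f2 x)%E ->
  (\int[mu]_x f1 x <= \int[mu]_x f2 x)%E.
Proof.
move=> m1 m2 f10 f12.
exact: (@ge0_le_integral _ (Rn R n) R mu setT measurableT f1 f2
  (fun x _ => f10 x) m1 m2 (fun x _ => f12 x)).
Qed.

Lemma integralZT (k : R) H : 0 <= k -> measurable_fun setT H -> (forall x, 0 <= H x)%E ->
  (\int[mu]_x (k%:E * H x) = k%:E * \int[mu]_x H x)%E.
Proof.
move=> k0 mH H0.
exact: (@ge0_integralZl_EFin _ (Rn R n) R mu setT measurableT H (fun x _ => H0 x) mH k k0).
Qed.

Lemma measurable_EFinT g : measurable_fun setT g -> measurable_fun setT (EFin \o g).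
Proof. by move=> mg; apply/measurable_EFinP. Qed.

Lemma measurable_indicE I : measurable I -> measurable_fun setT (fun x : Rn R n => (\1_I x : R)%:E).
Proof. by move=> mI; apply: measurable_EFinT; exact: (measurable_indic mI). Qed.

Lemma Rintegral_le_abs g H : measurable_fun setT g -> measurable_fun setT H ->
  (forall y, `|g y|%:E <= H y)%E -> (`|\int[mu]_y g y|%:E <= \int[mu]_y H y)%E.
Proof.
move=> mg mH gH; rewrite /Rintegral.
have mEg := measurable_EFinT mg.
(* [fine] is 0 at infinite values, so the estimate persists when the integral of [g] is infinite. *)
have fle (x : \bar R) : (`|fine x|%:E <= `|x|)%E by case: x => [r||] //=; rewrite leey.
apply: le_trans (fle _) _; apply: (le_trans (le_abse_integral mu measurableT mEg)).
apply: le_integralT mH _ gH => [|x].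
  exact: (measurableT_comp (@abse_measurable R setT) mEg).
by rewrite lee_fin.
Qed.

Lemma integral_cst_indic (K : R) I : 0 <= K -> measurable I ->
  (\int[mu]_y (K%:E * (\1_I y)%:E) = K%:E * mu I)%E.
Proof.
move=> K0 mI; rewrite (integralZT K0 (measurable_indicE mI)); last by move=> x; rewrite lee_fin.
by rewrite (@integral_indic _ (Rn R n) R mu setT measurableT I mI) setIT.
Qed.

Lemma cintegral_le (psi : 'rV[R]_n -> R[i]) H : cmeasurable psi ->
  measurable_fun setT H -> (forall y, (cabs (psi y))%:E <= H y)%E ->
  ((cabs (cintegral psi))%:E <= 2%:E * \int[mu]_y H y)%E.
Proof.
move=> [mRe mIm] mH psiH; apply: (@le_trans _ _ (`|complex.Re (cintegral psi)|%:E +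
  `|complex.Im (cintegral psi)|%:E)%E); first by rewrite -EFinD lee_fin cabs_le.
have -> (x : \bar R) : (2%:E * x = x + x)%E by rewrite mule_natl mule2n.
apply: leeD; apply: Rintegral_le_abs => // y; apply: le_trans (psiH y);
  rewrite lee_fin; [exact: cabs_Re|exact: cabs_Im].
Qed.

Lemma cmeasurableM (psi1 psi2 : 'rV[R]_n -> R[i]) :
  cmeasurable psi1 -> cmeasurable psi2 -> cmeasurable (fun y => psi1 y * psi2 y).
Proof.
move=> [m1 m1'] [m2 m2']; split.
  have := measurable_funB (measurable_funM m1 m2) (measurable_funM m1' m2').
  by apply: eq_measurable_fun => y _; rewrite /= cReM.
have := measurable_funD (measurable_funM m1 m2') (measurable_funM m1' m2).
by apply: eq_measurable_fun => y _; rewrite /= cImM.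
Qed.

Lemma csmooth_measurable (psi : 'rV[R]_n -> R[i]) : csmooth psi -> cmeasurable psi.
Proof.
by move=> [sRe sIm]; split; apply: measurable_continuous; [exact: (sRe [::]).1|exact: (sIm [::]).1].
Qed.

Lemma continuous_bounded_ball (g : 'rV[R]_n -> R) (r : R) : continuous g ->
  exists2 K : R, 0 <= K & forall x, `|x| <= r -> `|g x| <= K.
Proof.
move=> cg; have /compact_bounded[G [_ GP]] : compact (g @` [set x | `|x| <= r]).
  by apply: continuous_compact (@compact_normball R n r); exact: continuous_subspaceT.
exists (Num.max 0 (G + 1)) => [|x xr]; first by rewrite le_max lexx.
rewrite le_max; apply/orP; right; apply: (GP (G + 1)); first by rewrite ltrDl.
by exists x.
Qed.

(** Models the real and the imaginary part of an atom; [w] bounds the height, and [m] will be one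
    more than the order of the vanishing moments. *)
Definition atom_like b I (w : R) (m : nat) :=
  [/\ measurable_fun setT b, forall y, `|b y| <= w * \1_I y &
   forall P, polylt m P -> \int[mu]_y (b y * P y) = 0].

Lemma integrable_bounded_supp b h I (w K : R) :
  0 <= w -> 0 <= K -> measurable I -> (mu I < +oo)%E ->
  measurable_fun setT b -> (forall y, `|b y| <= w * \1_I y) ->
  measurable_fun setT h -> (forall y, I y -> `|h y| <= K) ->
  mu.-integrable setT (EFin \o (fun y => b y * h y)).
Proof.
move=> w0 K0 mI Ioo mb bI mh hK; apply/integrableP; split.
  exact: measurable_EFinT (measurable_funM mb mh).
have wK0 : 0 <= w * K by rewrite mulr_ge0.
apply: (@le_lt_trans _ _ (\int[mu]_y ((w * K)%:E * (\1_I y)%:E))%E); last first.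
  by rewrite (integral_cst_indic wK0 mI); apply: lte_mul_pinfty; rewrite ?lee_fin.
apply: le_integralT.
- exact: (measurableT_comp (@abse_measurable R setT) (measurable_EFinT (measurable_funM mb mh))).
- exact: measurable_funeM (measurable_indicE mI).
- by move=> y; exact: abse_ge0.
- move=> y; rewrite /= -EFinM lee_fin normrM.
  have := bI y; rewrite indicE; case: (boolP (y \in I)) => [/set_mem yI|_].
    by rewrite mulr1 mulr1 => by_; rewrite ler_pM// hK.
  by rewrite mulr0 normr_le0 => /eqP ->; rewrite normr0 mul0r mulr0.
Qed.

Lemma continuous_monomial (alpha : 'I_n -> nat) :
  continuous (fun x : 'rV[R]_n => \prod_(i < n) x 0 i ^+ alpha i).
Proof.
elim: (index_enum _) => [|i r IH].
  rewrite (_ : (fun x => _) = cst 1); first exact: cst_continuous.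
  by apply/funext => x; rewrite big_nil.
rewrite (_ : (fun x => _) = (fun x : 'rV[R]_n => x 0 i ^+ alpha i) \*
    (fun x => \prod_(j <- r) x 0 j ^+ alpha j)); last first.
  by apply/funext => x; rewrite big_cons.
move=> x; apply: continuousM; last exact: IH.
apply: (@continuous_comp _ _ _ (fun y : 'rV[R]_n => y 0 i) (fun t : R => t ^+ alpha i)).
  exact: coord_continuous.
exact: exprn_continuous.
Qed.

Lemma continuous_polylt (m : nat) (P : 'rV[R]_n -> R) : polylt m P -> continuous P.
Proof.
move=> [s [_ PE]].
rewrite (_ : P = fun x => \sum_(t <- s) t.1 * \prod_(i < n) x 0 i ^+ t.2 i); last exact/funext.
elim: s {PE} => [|t s IH].
  rewrite (_ : (fun x => _) = cst 0); first exact: cst_continuous.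
  by apply/funext => x; rewrite big_nil.
rewrite (_ : (fun x => _) = (cst t.1 \* (fun x : 'rV[R]_n => \prod_(i < n) x 0 i ^+ t.2 i)) \+
    (fun x => \sum_(t <- s) t.1 * \prod_(i < n) x 0 i ^+ t.2 i)); last first.
  by apply/funext => x; rewrite big_cons.
move=> x; apply: continuousD; last exact: IH.
by apply: continuousM; [exact: cst_continuous|exact: continuous_monomial].
Qed.

Lemma box_norm_le (u x : 'rV[R]_n) (l : R) : 0 <= l ->
  box u (u + const_mx l) x -> `|x - u| <= l.
Proof.
move=> l0 xb; apply: norm_le_coord => // i; have := xb i; rewrite !mxE => /andP[h1 h2].
by rewrite ler_norml; apply/andP; split; lra.
Qed.

(** Subtracting the Taylor polynomial of [g] at the corner [u] does not change the integral, by the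
    vanishing moments. On the cube the remainder is of size l^m, and the cube has volume at most
    l^n. *)
Lemma atom_like_taylor b I (w l M : R) (m : nat) u (g : 'rV[R]_n -> R) :
  cube_spec I u l -> 0 <= w -> atom_like b I w m -> smooth g -> 0 <= M ->
  (forall s x, size s = m -> `|partials s g x| <= M) ->
  `|\int[mu]_y (b y * g y)| <= w * ((m.+1 ^ n)%:R * (M * l ^+ m)) * l ^+ n.
Proof.
move=> [l0 mI Isub IE /andP[_ Il]] w0 [mb bI bP] sg M0 gM.
have [P mP gP] := taylor u M0 sg gM.
have Ioo : (mu I < +oo)%E by rewrite IE ltry.
have muI_le : (mu I <= (l ^+ n)%:E)%E by rewrite IE lee_fin.
have cg : continuous g := (sg [::]).1.
have mg : measurable_fun setT (g : Rn R n -> R) by exact: measurable_continuous.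
have [K K0 gK] := continuous_bounded_ball (`|u| + l) cg.
set E := (m.+1 ^ n)%:R * (M * l ^+ m).
have E0 : 0 <= E by rewrite !mulr_ge0// exprn_ge0// ltW.
have gPI y : I y -> `|g y - P y| <= E.
  by move=> /Isub/(box_norm_le (ltW l0)) yl; exact: gP.
have gKI y : I y -> `|g y| <= K.
  move=> /Isub/(box_norm_le (ltW l0)) yl; apply: gK.
  by have := ler_normD (y - u) u; rewrite subrK => h; lra.
have mPoly : measurable_fun setT (P : Rn R n -> R).
  apply: measurable_continuous; exact: continuous_polylt mP.
have ig : mu.-integrable setT (EFin \o (fun y => b y * g y)).
  exact: (integrable_bounded_supp w0 K0).
have iP : mu.-integrable setT (EFin \o (fun y => b y * P y)).
  apply: (integrable_bounded_supp w0 (addr_ge0 K0 E0)) => // y Iy.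
  have := ler_normB (g y) (g y - P y); rewrite opprB addrC subrK.
  by have := gPI y Iy; have := gKI y Iy => h1 h2 h3; lra.
have -> : \int[mu]_y (b y * g y) = \int[mu]_y (b y * (g y - P y)).
  rewrite -[LHS]subr0 -(bP P mP) -RintegralB//.
  by apply: eq_Rintegral => y _; rewrite mulrBr.
rewrite -lee_fin; apply: le_trans (@Rintegral_le_abs _
  (fun y => (w * E)%:E * (\1_I y)%:E)%E _ _ _) _.
- exact: measurable_funM mb (measurable_funB mg mPoly).
- exact: measurable_funeM (measurable_indicE mI).
- move=> y; rewrite -EFinM lee_fin normrM.
  have := bI y; rewrite indicE; case: (boolP (y \in I)) => [/set_mem yI|_].
    by rewrite mulr1 mulr1 => by_; rewrite ler_pM// gPI.
  by rewrite mulr0 normr_le0 => /eqP ->; rewrite normr0 mul0r mulr0.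
- have wE0 : 0 <= w * E by rewrite mulr_ge0.
  rewrite (integral_cst_indic wE0 mI).
  have wE0e : (0 <= (w * E)%:E)%E by rewrite lee_fin.
  exact: (lee_wpmul2l wE0e muI_le).
Qed.

End integral_bounds.

(** * Pairing an atom with a smooth function *)

Section atoms.
Context {R : realType} {n : nat}.
Notation mu := (@lebesgue R n).
Variables (p : R) (I : set 'rV[R]_n) (a : 'rV[R]_n -> R[i]) (u : 'rV[R]_n) (l : R).
Hypotheses (v0 : 0 < @unit_vol R n) (atomI : atom p I a) (specI : cube_spec I u l).
Let w := vol I `^ p^-1.
Let m := (@moment_order R n p).+1.

Lemma cube_vol_gt0 : 0 < vol I.
Proof.
case: specI => l0 _ _ _ /andP[h _]; apply: lt_le_trans h.
by rewrite mulr_gt0// exprn_gt0// divr_gt0.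
Qed.

Lemma atom_weight_gt0 : 0 < w. Proof. exact: powR_gt0 cube_vol_gt0. Qed.

Lemma atom_supp y : ~ I y -> a y = 0.
Proof.
case: atomI => _ _ sI _ _ nI; apply/eqP; apply: contraPT isT => /= aN0 _; apply: nI.
by apply: sI; exact: subset_closure.
Qed.

Lemma atom_le y : cabs (a y) <= w^-1 * \1_I y.
Proof.
rewrite indicE; case: (boolP (y \in I)) => [_|/negP nI].
  rewrite mulr1 -[leRHS]div1r ler_pdivlMr ?atom_weight_gt0// mulrC.
  by case: atomI => _ _ _ + _; apply.
by rewrite atom_supp ?cabs0 ?mulr0// => /mem_set.
Qed.

Let w'0 : 0 <= w^-1. Proof. by rewrite invr_ge0 ltW// atom_weight_gt0. Qed.

Lemma atom_like_of_moments (b : 'rV[R]_n -> R) : measurable_fun setT (b : Rn R n -> R) ->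
  (forall y, `|b y| <= cabs (a y)) ->
  (forall alpha : 'I_n -> nat, (\sum_(i < n) alpha i < m)%N ->
    \int[mu]_y ((\prod_(i < n) (y : 'rV[R]_n) 0 i ^+ alpha i) * b y) = 0) ->
  atom_like b I w^-1 m.
Proof.
move=> mb ba b0; have bI y : `|b y| <= w^-1 * \1_I y by apply: le_trans (ba y) (atom_le y).
split => // P [s [sm PE]]; rewrite (_ : P = fun x => \sum_(t <- s) t.1 * \prod_(i < n) x 0 i ^+ t.2 i); last exact/funext.
case: specI => l0 mI Isub IE _.
have Ioo : (mu I < +oo)%E by rewrite IE ltry.
have intb (h : 'rV[R]_n -> R) : continuous h ->
    mu.-integrable setT (EFin \o (fun y : Rn R n => b y * h y)).
  move=> ch; have [K K0 hK] := continuous_bounded_ball (`|u| + l) ch.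
  apply: (integrable_bounded_supp w'0 K0) => //; first exact: measurable_continuous.
  move=> y /Isub/(box_norm_le (ltW l0)) yl; apply: hK.
  by have := ler_normD (y - u) u; rewrite subrK => h'; lra.
elim: s sm {PE} => [|t s IH] sm.
  rewrite /Rintegral integral0_eq//= => y _; by rewrite big_nil mulr0.
have st : polylt m (fun x => \sum_(t <- s) t.1 * \prod_(i < n) x 0 i ^+ t.2 i).
  by exists s; split => // t' t's; apply: sm; right.
transitivity (\int[mu]_y (t.1 * (b y * \prod_(i < n) (y : 'rV[R]_n) 0 i ^+ t.2 i) +
    b y * \sum_(t <- s) t.1 * \prod_(i < n) (y : 'rV[R]_n) 0 i ^+ t.2 i)).
  by apply: eq_Rintegral => y _; rewrite big_cons; ring.
have i1 := intb _ (@continuous_monomial R n t.2).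
rewrite RintegralD//; last 2 first.
  exact: (integrableZl measurableT t.1 i1).
  exact: intb (continuous_polylt st).
rewrite IH => [|t' t's]; last by apply: sm; right.
rewrite addr0 RintegralZl// -[RHS](mulr0 t.1); congr (_ * _).
have := b0 t.2 (sm t (or_introl erefl)) => <-.
by apply: eq_Rintegral => y _; rewrite mulrC.
Qed.

Lemma atom_like_Re : atom_like (fun y => complex.Re (a y)) I w^-1 m.
Proof.
case: atomI => _ [mRe mIm] _ _ mom; apply: atom_like_of_moments => //.
  by move=> y; exact: cabs_Re.
move=> alpha /mom /(congr1 (@complex.Re R)) /= <-.
by apply: eq_Rintegral => y _; rewrite cReM/= mul0r subr0.
Qed.

Lemma atom_like_Im : atom_like (fun y => complex.Im (a y)) I w^-1 m.
Proof.
case: atomI => _ [mRe mIm] _ _ mom; apply: atom_like_of_moments => //.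
  by move=> y; exact: cabs_Im.
move=> alpha /mom /(congr1 (@complex.Im R)) /= <-.
by apply: eq_Rintegral => y _; rewrite cImM/= mul0r addr0.
Qed.

Lemma atom_integrable (g b : 'rV[R]_n -> R) : continuous g ->
  measurable_fun setT (b : Rn R n -> R) -> (forall y, `|b y| <= cabs (a y)) ->
  mu.-integrable setT (EFin \o (fun y : Rn R n => b y * g y)).
Proof.
move=> cg mb ba; case: specI => l0 mI Isub IE _.
have [K K0 gK] := continuous_bounded_ball (`|u| + l) cg.
apply: (@integrable_bounded_supp _ _ _ _ I w^-1 K) => //.
- by rewrite IE ltry.
- by move=> y; apply: le_trans (ba y) (atom_le y).
- exact: measurable_continuous.
move=> y /Isub/(box_norm_le (ltW l0)) yl; apply: gK.
by have := ler_normD (y - u) u; rewrite subrK => h'; lra.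
Qed.

(** The cancellation estimate. The factor 4 counts the real products in the complex product of [a]
    and [psi]. *)
Lemma atom_cintegral_smooth (psi : 'rV[R]_n -> R[i]) (M : R) : csmooth psi -> 0 <= M ->
  (forall s x, size s = m -> `|partials s (fun y => complex.Re (psi y)) x| <= M /\
    `|partials s (fun y => complex.Im (psi y)) x| <= M) ->
  cabs (cintegral (fun y => a y * psi y)) <=
    4 * (w^-1 * ((m.+1 ^ n)%:R * (M * l ^+ m)) * l ^+ n).
Proof.
move=> [sRe sIm] M0 psiM; set E := w^-1 * _ * _.
have B b g : atom_like b I w^-1 m -> smooth g ->
    (forall s x, size s = m -> `|partials s g x| <= M) -> `|\int[mu]_y (b y * g y)| <= E.
  by move=> ab sg; exact: (atom_like_taylor specI).
have cRe : continuous (fun y => complex.Re (psi y)) := (sRe [::]).1.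
have cIm : continuous (fun y => complex.Im (psi y)) := (sIm [::]).1.
have [_ [mRe mIm] _ _ _] := atomI.
have aRe y : `|complex.Re (a y)| <= cabs (a y) by exact: cabs_Re.
have aIm y : `|complex.Im (a y)| <= cabs (a y) by exact: cabs_Im.
apply: le_trans (cabs_le _) _; rewrite /cintegral/=.
have -> : 4 * E = (E + E) + (E + E) by ring.
apply: lerD.
  rewrite (_ : Rintegral _ _ _ = \int[mu]_y (complex.Re (a y) * complex.Re (psi y)) -
      \int[mu]_y (complex.Im (a y) * complex.Im (psi y))); last first.
    rewrite -RintegralB//; try exact: atom_integrable.
    by apply: eq_Rintegral => y _; rewrite cReM.
  rewrite (le_trans (ler_normB _ _))// lerD//.
    by apply: (B _ _ atom_like_Re sRe) => s x /psiM-/(_ x)[].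
  by apply: (B _ _ atom_like_Im sIm) => s x /psiM-/(_ x)[].
rewrite (_ : Rintegral _ _ _ = \int[mu]_y (complex.Re (a y) * complex.Im (psi y)) +
    \int[mu]_y (complex.Im (a y) * complex.Re (psi y))); last first.
  rewrite -RintegralD//; try exact: atom_integrable.
  by apply: eq_Rintegral => y _; rewrite cImM.
rewrite (le_trans (ler_normD _ _))// lerD//.
  by apply: (B _ _ atom_like_Re sIm) => s x /psiM-/(_ x)[].
by apply: (B _ _ atom_like_Im sRe) => s x /psiM-/(_ x)[].
Qed.

(** The size estimate. The indicator stays under the integral so that bounded overlap can be used
    after summing over the cubes. *)
Lemma atom_cintegral_le (psi : 'rV[R]_n -> R[i]) (H : Rn R n -> \bar R) :
  cmeasurable psi -> measurable_fun setT H ->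
  (forall y, (cabs (psi y))%:E <= H y)%E ->
  ((cabs (cintegral (fun y => a y * psi y)))%:E <=
    (2 * w^-1)%:E * \int[mu]_y ((\1_I y)%:E * H y))%E.
Proof.
move=> mpsi mH psiH; have [_ ma _ _ _] := atomI; have [_ mI _ _ _] := specI.
have H0 y : (0 <= H y)%E by apply: le_trans (psiH y); rewrite lee_fin cabs_ge0.
have m1H : measurable_fun setT (fun y : Rn R n => (\1_I y)%:E * H y)%E.
  exact: (emeasurable_funM (measurable_indicE mI) mH).
apply: le_trans (@cintegral_le _ _ _ (fun y => (w^-1)%:E * ((\1_I y)%:E * H y))%E _ _ _) _.
- exact: cmeasurableM.
- exact: measurable_funeM m1H.
- move=> y; rewrite muleA cabsM EFinM; apply: lee_pmul => //.
  + by rewrite lee_fin cabs_ge0.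
  + by rewrite lee_fin cabs_ge0.
  + by rewrite -EFinM lee_fin atom_le.
rewrite (integralZT w'0 m1H) => [|y]; last by rewrite mule_ge0// lee_fin.
by rewrite muleA -EFinM.
Qed.

End atoms.

Section dyadic.
Context {R : realType}.

Lemma dyadic_nat (s : R) : 1 <= s -> exists i : nat, 2 ^+ i <= s < 2 ^+ i.+1.
Proof.
move=> s1; have ex : exists i : nat, s < 2 ^+ i.+1.
  exists (Num.truncn s); apply: lt_le_trans (truncnS_gt s) _.
  by rewrite -natrX ler_nat ltnW// ltn_expl.
case: (ex_minnP ex) => -[|i] si imin; first by exists 0%N; rewrite expr0 s1.
exists i.+1; rewrite si andbT leNgt; apply/negP => /imin; by rewrite ltnn.
Qed.

Lemma dyadic_int (s : R) : 0 < s -> exists k : int, 2 ^ k <= s < 2 ^ (k + 1).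
Proof.
move=> s0; have [s1|s1] := leP 1 s.
  have [i /andP[h1 h2]] := dyadic_nat s1; exists i%:Z.
  by rewrite -exprnP h1/= -PoszD addn1 -exprnP.
have s'1 : 1 <= s^-1 by rewrite invf_ge1// ltW.
have [i /andP[h1 h2]] := dyadic_nat s'1.
have {}h1 : s <= 2 ^ (- i%:Z).
  by rewrite -invr_expz -exprnP -[s]invrK lef_pV2// posrE ?exprn_gt0 ?invr_gt0.
have {}h2 : 2 ^ (- i.+1%:Z) < s.
  by rewrite -invr_expz -exprnP -[s]invrK ltf_pV2// posrE ?exprn_gt0 ?invr_gt0.
move: h1; rewrite le_eqVlt => /orP[/eqP sE|sl].
  by exists (- i%:Z); rewrite sE lexx/= ltr_eXz2l ?ltr1n// ltrDl.
exists (- i.+1%:Z); rewrite ltW//=.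
by rewrite (_ : - i.+1%:Z + 1 = - i%:Z)// -addn1 PoszD opprD subrK.
Qed.

End dyadic.

(** * Decay of an atom convolved with the dilates of phi, uniformly in t *)

Section dilations.
Context {R : realType} {n : nat}.
Notation mu := (@lebesgue R n).
Variables (phi : 'rV[R]_n -> R[i]) (m : nat) (G r : R).
Hypotheses (tphi : test_function phi) (G0 : 0 < G) (r0 : 0 < r)
  (phi0 : forall x, r < `|x| -> phi x = 0)
  (phiG : forall s x, (size s <= m)%N ->
     `|partials s (fun y => complex.Re (phi y)) x| <= G /\
     `|partials s (fun y => complex.Im (phi y)) x| <= G).

(** A step function dominating the dilate centred at [x], with integral bounded independently of
    [t]; the 2 accounts for real and imaginary parts. *)
Definition dilate_dom (t : R) (x : 'rV[R]_n) : Rn R n -> \bar R := fun y =>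
  ((2 * G * t ^- n)%:E *
   (\1_(box (x - const_mx (r * t)) (x - const_mx (r * t) + const_mx (2 * (r * t)))) y)%:E)%E.

Lemma measurable_dilate_dom t x : measurable_fun setT (dilate_dom t x).
Proof.
exact: measurable_funeM (measurable_indicE (measurable_box _ _)).
Qed.

Lemma dilate_eq0 (t : R) (x y : 'rV[R]_n) : 0 < t -> r * t < `|x - y| -> dilate phi t (x - y) = 0.
Proof.
move=> t0 rt; rewrite /dilate phi0 ?mulr0// normrZ ger0_norm ?invr_ge0 ?ltW//.
by rewrite mulrC ltr_pdivlMr.
Qed.

Lemma dilate_le (t : R) (x y : 'rV[R]_n) : 0 < t ->
  ((cabs (dilate phi t (x - y)))%:E <= dilate_dom t x y)%E.
Proof.
move=> t0; rewrite /dilate_dom -EFinM lee_fin indicE.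
have C0 : 0 <= 2 * G * t ^- n by rewrite !mulr_ge0 ?invr_ge0 ?exprn_ge0// ltW.
case: (boolP (_ \in _)) => [_|nb].
  rewrite mulr1; apply: le_trans (cabs_le _) _.
  have [sphi _] := tphi.
  have [] := @dilate_partials R n phi t G m x [::] y t0 sphi phiG (leq0n _).
  rewrite addn0/= => h1 h2.
  by rewrite -mulrA mulr_natl mulr2n lerD.
rewrite mulr0 dilate_eq0 ?cabs0// ltNge; apply: contra nb => xy; apply/mem_set => i.
have := le_trans (coord_le_norm (x - y) i) xy.
rewrite !mxE ler_norml => /andP[h1 h2]; apply/andP; split; lra.
Qed.

Lemma integral_dilate_dom (t : R) x : 0 < t ->
  (\int[mu]_y dilate_dom t x y <= (2 * G * (2 * r) ^+ n)%:E)%E.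
Proof.
move=> t0; have C0 : 0 <= 2 * G * t ^- n by rewrite !mulr_ge0 ?invr_ge0 ?exprn_ge0// ltW.
have rt0 : 0 <= 2 * (r * t) by rewrite !mulr_ge0// ltW.
rewrite (integral_cst_indic C0 (measurable_box _ _)).
have C0' : (0 <= (2 * G * t ^- n)%:E)%E by rewrite lee_fin.
apply: le_trans (lee_wpmul2l C0' (lebesgue_cube_le _ rt0)) _.
rewrite -EFinM lee_fin mulrA [(2 * r * t) ^+ n]exprMn.
have : t ^+ n != 0 by rewrite expf_neq0// gt_eqF.
by move: (t ^+ n) ((2 * r) ^+ n) => T A T0; rewrite le_eqVlt; apply/orP; left; apply/eqP; field.
Qed.

Lemma dilate_dom_ge0 (t : R) x y : 0 < t -> (0 <= dilate_dom t x y)%E.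
Proof.
by move=> t0; rewrite mule_ge0 ?lee_fin// !mulr_ge0 ?invr_ge0 ?exprn_ge0// ltW.
Qed.

Variables (p : R) (I : set 'rV[R]_n) (a : 'rV[R]_n -> R[i]) (u : 'rV[R]_n) (l : R).
Hypotheses (v0 : 0 < @unit_vol R n) (atomI : atom p I a) (specI : cube_spec I u l)
  (mE : m = (@moment_order R n p).+1).

(** The first summand comes from the size estimate near the cube, the second from cancellation away
    from it. *)
Definition decay_cst : R := 4 * G * (2 * r) ^+ n + 4 * (m.+1 ^ n)%:R * G * (2 * r) ^+ (n + m).

(** Near the cube the size of the atom suffices. Away from it, either the support of the dilate
    misses the cube and the pairing is 0, or [t] is at least a constant times the distance from [x]
    to [u]; then l / t is at most a multiple of 2^(-i), and the cancellation estimate is a power of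
    l / t. *)
Lemma atom_dilate_decay (t : R) x : 0 < t -> exists i : nat,
  `|x - u| <= 2 ^+ i.+1 * l /\
  cabs (cintegral (fun y => a y * dilate phi t (x - y))) <=
    decay_cst * (vol I `^ p^-1)^-1 * 2 ^- (i * (n + m)).
Proof.
move=> t0; have [l0 mI Isub IE _] := specI.
have w0 := @atom_weight_gt0 R n p I u l v0 specI.
set w := vol I `^ p^-1 in w0 *.
have [sphi _] := tphi.
have K1 : 0 <= 4 * G * (2 * r) ^+ n by rewrite !mulr_ge0 ?exprn_ge0 ?mulr_ge0// ltW.
have K2 : 0 <= 4 * (m.+1 ^ n)%:R * G * (2 * r) ^+ (n + m).
  by rewrite !mulr_ge0 ?exprn_ge0 ?mulr_ge0// ltW.
have tdil : test_function (fun y => dilate phi t (x - y)).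
  by apply: test_function_reflect; exact: test_function_dilate.
have [near|far] := leP (`|x - u|) (2 * l).
  exists 0%N; rewrite expr1; split => //; rewrite mul0n expr0 invr1 mulr1.
  rewrite -lee_fin; apply: le_trans (atom_cintegral_le v0 atomI specI
    (csmooth_measurable tdil.1) (measurable_dilate_dom t x) _) _.
    by move=> y; exact: dilate_le.
  apply: (@le_trans _ _ ((2 * w^-1)%:E * (2 * G * (2 * r) ^+ n)%:E)%E).
    apply: lee_wpmul2l; first by rewrite lee_fin mulr_ge0// invr_ge0 ltW.
    apply: le_trans (integral_dilate_dom x t0); apply: le_integralT.
    - exact: (emeasurable_funM (measurable_indicE mI) (measurable_dilate_dom t x)).
    - exact: measurable_dilate_dom.
    - by move=> y; rewrite mule_ge0 ?dilate_dom_ge0// lee_fin.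
    - move=> y; rewrite -[leRHS]mul1e; apply: lee_pmul.
      + by rewrite lee_fin.
      + exact: dilate_dom_ge0.
      + by rewrite lee_fin indicE lern1 leq_b1.
      + by [].
  rewrite -EFinM lee_fin /decay_cst [leRHS]mulrDl.
  apply: ler_wpDr; first by rewrite mulr_ge0// invr_ge0 ltW.
  by rewrite le_eqVlt; apply/orP; left; apply/eqP; ring.
have [i /andP[h1 h2]] : exists i : nat, 2 ^+ i <= `|x - u| / l < 2 ^+ i.+1.
  by apply: dyadic_nat; rewrite ler_pdivlMr// mul1r; lra.
rewrite ler_pdivlMr// in h1; rewrite ltr_pdivrMr// in h2.
exists i; split; first exact: ltW.
have [Z|/existsNP[y /not_implyP[Iy xy]]] := pselect (forall y, I y -> r * t < `|x - y|).
  rewrite (_ : cintegral _ = 0) ?cabs0.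
    by rewrite !mulr_ge0 ?invr_ge0 ?exprn_ge0 ?addr_ge0// ltW.
  have E0 : (fun y => a y * dilate phi t (x - y)) = fun=> 0.
    apply/funext => y; have [Iy|nI] := pselect (I y); first by rewrite dilate_eq0 ?mulr0// Z.
    by rewrite (atom_supp atomI)// mul0r.
  by rewrite E0 /cintegral/= /Rintegral !integral0_eq.
have {}xy : `|x - y| <= r * t by rewrite leNgt; apply/negP.
(* In the far case [l] is less than half the distance from [x] to [u], so the distance from [y] to
   [u] is absorbed. *)
have td : `|x - u| <= 2 * r * t.
  have := box_norm_le (ltW l0) (Isub _ Iy); have := ler_normD (x - y) (y - u).
  by rewrite subrKA => h3 h4; lra.
set M := G * t ^- (n + m).
have M0 : 0 <= M by rewrite mulr_ge0 ?invr_ge0 ?exprn_ge0// ltW.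
apply: le_trans (atom_cintegral_smooth v0 atomI specI tdil.1 M0 _) _.
  move=> s z sm; rewrite -mE in sm; have := @dilate_partials R n phi t G m x s z t0 sphi phiG.
  by rewrite sm; apply.
rewrite -mE -/w.
apply: (@le_trans _ _ (4 * (m.+1 ^ n)%:R * G * w^-1 * (l / t) ^+ (n + m))).
  rewrite le_eqVlt; apply/orP; left; apply/eqP.
  by rewrite /M expr_div_n [l ^+ (n + m)]exprD; ring.
have lt : l / t <= 2 * r * 2 ^- i.
  rewrite ler_pdivrMr// mulrAC ler_pdivlMr ?exprn_gt0// mulrC.
  exact: le_trans h1 td.
apply: (@le_trans _ _ (4 * (m.+1 ^ n)%:R * G * w^-1 * (2 * r * 2 ^- i) ^+ (n + m))).
  rewrite ler_wpM2l//; first by rewrite !mulr_ge0 ?invr_ge0// ltW.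
  by rewrite lerXn2r// nnegrE ?divr_ge0 ?mulr_ge0 ?invr_ge0 ?exprn_ge0// ltW.
rewrite exprMn exprVn -exprM /decay_cst -[leRHS]mulrA [leRHS]mulrDl.
apply: ler_wpDl; first by rewrite (mulr_ge0 K1)// mulr_ge0 ?invr_ge0 ?exprn_ge0// ltW.
by rewrite le_eqVlt; apply/orP; left; apply/eqP; ring.
Qed.

End dilations.

(** * Inequalities for unordered sums and powers *)

Section esum_more.
Context {R : realType}.
Local Open Scope ereal_scope.

Lemma esum_ge_term {T : choiceType} (D : set T) (a : T -> \bar R) t :
  (forall i, 0 <= a i) -> D t -> a t <= \esum_(i in D) a i.
Proof.
move=> a0 Dt; rewrite -(esum_set1 (t := t) (a := a))//.
by apply: esum_subset => _ ->.
Qed.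

Lemma esum_exchange {T T' : choiceType} (D : set T) (D' : set T') (a : T -> T' -> \bar R) :
  (forall i j, 0 <= a i j) ->
  \esum_(i in D) \esum_(j in D') a i j = \esum_(j in D') \esum_(i in D) a i j.
Proof.
move=> a0; rewrite !esum_esum//.
pose sw (x : T' * T) := (x.2, x.1).
rewrite (reindex_esum (D' `*`` (fun=> D)) (D `*`` (fun=> D')) sw)//.
split.
- by move=> [i j] /= [].
- by move=> [i j] [i' j'] _ _ [-> ->].
- by move=> [i j] /= [Di D'j]; exists (j, i).
Qed.

Lemma esum_shift (c : int) (a : int -> \bar R) :
  \esum_(k in [set: int]) a (k + c)%R = \esum_(k in [set: int]) a k.
Proof.
rewrite [RHS](reindex_esum [set: int] [set: int] (fun k : int => (k + c)%R))//.
split=> // [x y _ _ /addIr//|k _]; by exists (k - c)%R; rewrite // subrK.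
Qed.

Lemma esum_geometric (A q : R) : (0 <= A)%R -> (0 <= q < 1)%R ->
  \esum_(i in [set: nat]) (A * q ^+ i)%:E <= (A / (1 - q))%:E.
Proof.
move=> A0 /andP[q0 q1].
have pos i : (0 <= A * q ^+ i)%R by rewrite mulr_ge0// exprn_ge0.
rewrite -nneseries_esumT => [|i]; last by rewrite lee_fin.
apply: lime_le; first by apply: is_cvg_nneseries => i _ _; rewrite lee_fin.
apply: nearW => N; rewrite sumEFin lee_fin ler_pdivlMr ?subr_gt0//.
rewrite -mulr_sumr -mulrA ler_piMr//.
have -> : ((\sum_(0 <= i < N) q ^+ i) * (1 - q) = 1 - q ^+ N)%R.
  rewrite big_mkord; have := subrX1 q N => h.
  by rewrite -[RHS]opprB h; ring.
by rewrite gerBl exprn_ge0.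
Qed.

Lemma esum_geometric_mull (q : R) (W : \bar R) : (0 < q < 1)%R -> 0 <= W ->
  \esum_(i in [set: nat]) ((q ^+ i)%:E * W) <= ((1 - q)^-1)%:E * W.
Proof.
move=> /andP[q0 q1]; case: W => [W| |] // W0; last first.
  by rewrite gt0_muley ?leey// lte_fin invr_gt0 subr_gt0.
rewrite lee_fin in W0.
rewrite (eq_esum (b := fun i => W%:E * (1 * q ^+ i)%:E)) => [|i _]; last first.
  by rewrite mul1r muleC.
rewrite esumZl// => [|i]; last by rewrite lee_fin mul1r exprn_ge0// ltW.
rewrite [leRHS]muleC lee_wpmul2l ?lee_fin//.
have q01 : (0 <= q < 1)%R by rewrite (ltW q0).
by apply: le_trans (esum_geometric ler01 q01) _; rewrite div1r.
Qed.

(** If the sum of the powers were below 1, each [y j] would be below 1, hence at most its own r-th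
    power, and the sum of the [y j] would be below 1 as well. *)
Lemma esum_powR_ge1 {T : choiceType} (D : set T) (y : T -> R) (r : R) :
  (forall j, 0 <= y j)%R -> (0 < r <= 1)%R -> 1 < \esum_(j in D) (y j)%:E ->
  1 <= \esum_(j in D) (y j `^ r)%:E.
Proof.
move=> y0 /andP[r0 r1] y1; rewrite leNgt; apply/negP => s1.
suff : \esum_(j in D) (y j)%:E <= \esum_(j in D) (y j `^ r)%:E.
  by move=> /(lt_le_trans y1)/lt_trans/(_ s1); rewrite ltxx.
apply: le_esum => j Dj; rewrite lee_fin.
have yr1 : (y j `^ r < 1)%R.
  rewrite -lte_fin; apply: le_lt_trans s1.
  by apply: (@esum_ge_term _ _ (fun j => (y j `^ r)%:E)) => // i; rewrite lee_fin powR_ge0.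
have [->|yN0] := eqVneq (y j) 0%R; first exact: powR_ge0.
apply: ger1_powR => //; rewrite lt_neqAle eq_sym yN0 y0/=.
rewrite leNgt; apply/negP => y_gt1.
have := ler_powR (ltW y_gt1) (ltW r0); rewrite powRr0 => h.
by have := le_lt_trans h yr1; rewrite ltxx.
Qed.

Lemma le_poweR (x y : \bar R) (r : R) : (0 <= r)%R -> 0 <= x -> x <= y -> x `^ r <= y `^ r.
Proof.
move=> r0 x0 xy; apply: (gt0_ler_poweR r0) => //; rewrite in_itv/= leey andbT//.
exact: le_trans x0 xy.
Qed.

Lemma powR_expn (a s : R) i : (0 <= a)%R -> ((a ^+ i) `^ s = (a `^ s) ^+ i)%R.
Proof.
by move=> a0; rewrite -powR_mulrn// -powRrM mulrC powRrM powR_mulrn// powR_ge0.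
Qed.

(** One of the two factors [th ^+ i] bounds each term by the power 1/s of the sum on the right, the
    other makes the series converge. The argument is the same for s below and above 1, which is why
    the decay is written as a square. *)
Lemma poweR_esum_geometric (th s : R) (S : nat -> \bar R) :
  (0 < th < 1)%R -> (0 < s)%R -> (forall i, 0 <= S i) ->
  (\esum_(i in [set: nat]) ((th ^+ i) ^+ 2)%:E * S i) `^ s <=
  ((1 - th)^-1 `^ s)%:E * \esum_(i in [set: nat]) ((th `^ s) ^+ i)%:E * S i `^ s.
Proof.
move=> /andP[th0 th1] s0 S0.
have thp i : (0 < th ^+ i)%R by rewrite exprn_gt0.
set Z := \esum_(i in _) ((th `^ s) ^+ i)%:E * S i `^ s.
have Z0 : 0 <= Z.
  by apply: esum_ge0 => i _; rewrite mule_ge0 ?poweR_ge0// lee_fin exprn_ge0// powR_ge0.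
have th'0 : (0 <= (1 - th)^-1)%R by rewrite invr_ge0 subr_ge0 ltW.
have le_i i : (th ^+ i)%:E * S i <= Z `^ s^-1.
  have : ((th ^+ i)%:E * S i) `^ s <= Z.
    rewrite poweRM ?lee_fin ?(ltW (thp i))// poweR_EFin powR_expn ?(ltW th0)//.
    apply: (@esum_ge_term _ _ (fun i => ((th `^ s) ^+ i)%:E * S i `^ s)) => // j.
    by rewrite mule_ge0 ?poweR_ge0// lee_fin exprn_ge0// powR_ge0.
  have i0 : 0 <= (th ^+ i)%:E * S i by rewrite mule_ge0// lee_fin ltW.
  move=> /(le_poweR (r := s^-1)); rewrite invr_ge0 (ltW s0) poweR_ge0 => /(_ isT isT).
  by rewrite -poweRrM mulfV ?gt_eqF// poweRe1.
have : \esum_(i in [set: nat]) ((th ^+ i) ^+ 2)%:E * S i <= ((1 - th)^-1)%:E * Z `^ s^-1.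
  apply: (@le_trans _ _ (\esum_(i in [set: nat]) (th ^+ i)%:E * Z `^ s^-1)).
    apply: le_esum => i _; rewrite expr2 EFinM -muleA lee_wpmul2l//.
    by rewrite lee_fin ltW.
  by apply: esum_geometric_mull; rewrite ?th0// poweR_ge0.
move=> /(le_poweR (ltW s0)) h; apply: le_trans (h _) _.
  by apply: esum_ge0 => i _; rewrite mule_ge0// lee_fin exprn_ge0// ltW.
rewrite poweRM ?poweR_ge0 ?lee_fin// poweR_EFin -poweRrM mulVf ?gt_eqF// poweRe1//.
Qed.

End esum_more.

(** * A discrete Hardy inequality *)

Section discrete_norm.
Context {R : realType}.
Local Open Scope ereal_scope.

(** [coef_qnorm] as a function of the level masses alone, so that the next inequality involves
    sequences only. *)
Definition block_qnorm (p : R) (q : \bar R) (S : int -> \bar R) : \bar R :=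
  if q is r%:E then (\esum_(k in [set: int]) S k `^ (r / p)) `^ r^-1
  else ereal_sup [set S k `^ p^-1 | k in [set: int]].

Lemma poweR_level (p r : R) (x : R) (D : \bar R) : (0 < p)%R -> (0 <= x)%R -> 0 <= D ->
  (x%:E * D `^ p^-1) `^ r = ((x `^ p)%:E * D) `^ (r / p).
Proof.
move=> p0 x0 D0; rewrite !poweRM ?poweR_ge0 ?lee_fin ?powR_ge0// !poweR_EFin -poweRrM.
by rewrite -powRrM mulrCA mulfV ?gt_eqF// mulr1 [(_ * r)%R]mulrC.
Qed.

(** The constant precedes [S] and [D]. The shift by [s] does not change the norm of [S], because
    sums and suprema run over all integers. *)
Lemma ell_qnorm_geometric (p th K : R) (q : \bar R) (s : int) :
  (0 < p)%R -> (0 < th < 1)%R -> (0 <= K)%R -> 0 < q ->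
  exists2 c : R, (0 <= c)%R & forall S D : int -> \bar R,
    (forall k, 0 <= S k) -> (forall k, 0 <= D k) ->
    (forall k : int, (((2 ^ k) `^ p)%R)%:E * D k <=
      K%:E * \esum_(i in [set: nat]) (((th ^+ i) ^+ 2)%:E * S (k + (i%:Z - s))%R)) ->
    ell_qnorm q (fun k : int => (2 ^ k)%R%:E * D k `^ p^-1) <= c%:E * block_qnorm p q S.
Proof.
move=> p0 th01 K0; have /andP[th0 th1] := th01.
have p'0 : (0 < p^-1)%R by rewrite invr_gt0.
have x0 (k : int) : (0 <= 2 ^ k :> R)%R by rewrite exprz_ge0.
case: q => [r r0|_|//].
- rewrite lte_fin in r0.
  (* Here [r] is the finite value of q. Raising to the power q / p turns the ratio [th] into [rho];
     exchanging the sums then leaves a shifted copy of the norm for each i. *)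
  pose sg := (r / p)%R; have sg0 : (0 < sg)%R by rewrite divr_gt0.
  pose rho := (th `^ sg)%R.
  have rho01 : (0 < rho < 1)%R.
    rewrite powR_gt0//=; have := @gt0_ltr_powR R sg sg0 th 1%R.
    by rewrite powR1 !nnegrE ler01 (ltW th0) => /(_ isT isT th1).
  pose c2 := (K `^ sg * (1 - th)^-1 `^ sg)%R.
  have c20 : (0 <= c2)%R by rewrite mulr_ge0// powR_ge0.
  pose c3 := (c2 * (1 - rho)^-1)%R.
  have c30 : (0 <= c3)%R.
    by rewrite mulr_ge0// invr_ge0 subr_ge0 ltW//; case/andP: rho01.
  exists (c3 `^ r^-1)%R => [|S D S0 D0 SD]; first exact: powR_ge0.
  have N0 : 0 <= \esum_(k in [set: int]) S k `^ sg by apply: esum_ge0 => k _; exact: poweR_ge0.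
  rewrite /block_qnorm -/sg -poweR_EFin -poweRM ?lee_fin//.
  apply: le_poweR; rewrite ?invr_ge0 ?(ltW r0)//.
    by apply: esum_ge0 => k _; exact: poweR_ge0.
  apply: (@le_trans _ _ (\esum_(k in [set: int]) (c2%:E *
      \esum_(i in [set: nat]) ((rho ^+ i)%:E * S (k + (i%:Z - s))%R `^ sg)))).
    apply: le_esum => k _; rewrite poweR_level// -/sg.
    apply: le_trans (le_poweR (ltW sg0) _ (SD k)) _.
      by rewrite mule_ge0// lee_fin powR_ge0.
    rewrite poweRM ?lee_fin//; last first.
      by apply: esum_ge0 => i _; rewrite mule_ge0// lee_fin exprn_ge0// exprn_ge0// ltW.
    rewrite poweR_EFin /c2 EFinM -muleA lee_wpmul2l ?lee_fin ?powR_ge0//.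
    exact: (poweR_esum_geometric (S := fun i : nat => S (k + (i%:Z - s))%R)).
  have t0 (k : int) (i : nat) : 0 <= (rho ^+ i)%:E * S (k + (i%:Z - s))%R `^ sg.
    by rewrite mule_ge0 ?poweR_ge0// lee_fin exprn_ge0// powR_ge0.
  rewrite esumZl// => [|k]; last by apply: esum_ge0 => i _.
  have -> : c3%:E = c2%:E * ((1 - rho)^-1)%:E by rewrite -EFinM.
  rewrite -muleA; apply: lee_wpmul2l; rewrite ?lee_fin// esum_exchange//.
  apply: le_trans (esum_geometric_mull rho01 N0); apply: le_esum => i _.
  rewrite esumZl; last 2 first.
    by rewrite exprn_ge0// powR_ge0.
    by move=> k; exact: poweR_ge0.
  by rewrite (esum_shift _ (fun k => S k `^ sg)).
(* For infinite q each [S k] is at most the p-th power of the supremum, and a geometric series of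
   ratio [th ^+ 2] remains. *)
- pose c := ((K * (1 - th ^+ 2)^-1) `^ p^-1)%R.
  have th2 : (0 < th ^+ 2 < 1)%R by rewrite exprn_gt0// expr_lt1// ltW.
  have th2' : (0 <= (1 - th ^+ 2)^-1)%R by rewrite invr_ge0 subr_ge0 ltW//; case/andP: th2.
  exists c => [|S D S0 D0 SD]; first exact: powR_ge0.
  rewrite /ell_qnorm /block_qnorm; set N := ereal_sup [set S k `^ p^-1 | k in _].
  have SN k : S k `^ p^-1 <= N by apply: ereal_sup_ubound; exists k.
  have N0 : 0 <= N by apply: le_trans (SN 0%R); exact: poweR_ge0.
  have SNp k : S k <= N `^ p.
    have := le_poweR (ltW p0) (poweR_ge0 _ _) (SN k).
    by rewrite -poweRrM mulVf ?gt_eqF// poweRe1.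
  apply: ge_ereal_sup => _ [k _ <-].
  rewrite -[leLHS]poweRe1 ?mule_ge0 ?poweR_ge0 ?lee_fin// poweR_level// div1r.
  apply: (@le_trans _ _ (((K * (1 - th ^+ 2)^-1)%:E * N `^ p) `^ p^-1)); last first.
    by rewrite poweRM ?poweR_ge0 ?lee_fin ?mulr_ge0// -poweRrM mulfV ?gt_eqF// poweRe1.
  apply: le_poweR; rewrite ?(ltW p'0)//.
    by rewrite mule_ge0// lee_fin powR_ge0.
  apply: le_trans (SD k) _; rewrite EFinM -muleA lee_wpmul2l ?lee_fin//.
  apply: le_trans (esum_geometric_mull th2 (poweR_ge0 _ _)); apply: le_esum => i _.
  by rewrite exprAC lee_wpmul2l// lee_fin exprn_ge0// exprn_ge0// ltW.
Qed.

End discrete_norm.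

(** * Integration of sums over sets of indices *)

Section esum_integral.
Context {R : realType} {n : nat}.
Notation mu := (@lebesgue R n).
Local Open Scope ereal_scope.

(** Turns sums over a set of indices into series, to which monotone convergence applies. *)
Lemma esum_nneseries (D : set nat) (a : nat -> \bar R) : (forall j, 0 <= a j) ->
  \esum_(j in D) a j = \sum_(j <oo) (if j \in D then a j else 0).
Proof.
by move=> a0; rewrite esum_mkcond nneseries_esumT// => j; case: ifP.
Qed.

Lemma measurable_esum (D : set nat) (f : nat -> Rn R n -> \bar R) :
  (forall j, measurable_fun setT (f j)) -> (forall j x, 0 <= f j x) ->
  measurable_fun setT (fun x => \esum_(j in D) f j x).
Proof.
move=> mf f0; under eq_fun do rewrite esum_nneseries//.
have := @ge0_emeasurable_sum _ (Rn R n) R setT (fun j x => if j \in D then f j x else 0) predT.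
apply => [j x _ _|j _]; first by case: ifP.
by case: (j \in D) => //; exact: measurable_cst.
Qed.

Lemma integral_esum (D : set nat) (f : nat -> Rn R n -> \bar R) :
  (forall j, measurable_fun setT (f j)) -> (forall j x, 0 <= f j x) ->
  \int[mu]_x (\esum_(j in D) f j x) = \esum_(j in D) \int[mu]_x f j x.
Proof.
move=> mf f0; under eq_integral do rewrite esum_nneseries//.
have mg j : measurable_fun setT (fun x => if j \in D then f j x else 0).
  by case: (j \in D); [exact: mf|exact: measurable_cst].
have g0 j x : setT x -> 0 <= (if j \in D then f j x else 0) by move=> _; case: ifP.
rewrite (@integral_nneseries _ (Rn R n) R mu setT measurableT _ mg g0).
rewrite esum_nneseries => [|j]; last by apply: integral_ge0 => x _; exact: f0.
by apply: eq_eseriesr => j _; case: (j \in D) => //; exact: integral0.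
Qed.

Lemma markov_ge1 (f : Rn R n -> \bar R) : measurable_fun setT f -> (forall x, 0 <= f x) ->
  mu [set x | 1 <= f x] <= \int[mu]_x f x.
Proof.
move=> mf f0; pose E : set (Rn R n) := [set x | 1 <= f x].
have mE : measurable E.
  rewrite -[X in measurable X]setTI; exact: emeasurable_fun_c_infty.
have -> : mu [set x | 1 <= f x] = \int[mu]_x (\1_E x)%:E.
  by rewrite (@integral_indic _ (Rn R n) R mu setT measurableT E mE) setIT.
apply: (le_integralT (measurable_indicE mE) mf) => x; first by rewrite lee_fin.
rewrite indicE; case: (boolP (x \in E)) => [/set_mem //|_]; exact: f0.
Qed.

End esum_integral.

(** * Decomposition into dyadic levels *)

Section levels.
Context {R : realType}.
Variable b : nat -> R.

Definition dyadic_level (k : int) : set nat := [set j | 2 ^ k <= b j < 2 ^ (k + 1)].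

Lemma dyadic_level_inj k k' j : dyadic_level k j -> dyadic_level k' j -> k = k'.
Proof.
suff le k1 k2 : dyadic_level k1 j -> dyadic_level k2 j -> (k1 <= k2)%R.
  by move=> h h'; apply/eqP; rewrite eq_le !le.
move=> /andP[h _] /andP[_ h']; have := le_lt_trans h h'.
by rewrite ltr_eXz2l ?ltr1n// ltzD1.
Qed.

Lemma trivIset_dyadic_level (e : nat -> int) : injective e ->
  trivIset setT (fun i => dyadic_level (e i)).
Proof. by move=> ei i i' _ _ [j [h h']]; apply: ei; exact: dyadic_level_inj h h'. Qed.

(** The levels are disjoint, and by [dyadic_int] every positive value lies in one of them. *)
Lemma esum_levels_up (k : int) (X : nat -> \bar R) : (forall j, 0 <= X j)%E ->
  (\esum_(j in [set j | 2 ^ k <= b j]%R) X j =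
   \esum_(i in [set: nat]) \esum_(j in dyadic_level (k + i%:Z)) X j)%E.
Proof.
move=> X0; rewrite -esum_bigcupT//; last first.
  by apply: trivIset_dyadic_level => i i' /addrI [].
congr esum; apply/seteqP; split=> [j /= kj|j [i _ /= /andP[ij _]]]; last first.
  by apply: le_trans ij; rewrite ler_eXz2l ?ltr1n// lerDl.
have bj : 0 < b j by apply: lt_le_trans kj; rewrite exprz_gt0.
have [k' /andP[h h']] := dyadic_int bj.
have kk' : k <= k'.
  by have := le_lt_trans kj h'; rewrite ltr_eXz2l ?ltr1n// ltzD1.
exists (absz (k' - k)%R) => //=; rewrite /dyadic_level/= gez0_abs ?subr_ge0//.
by rewrite [k + _]addrC subrK h.
Qed.

(** The highest level below [2 ^ k] has index [k - 1], whence the offset. *)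
Lemma esum_levels_down (k : int) (X : nat -> \bar R) : (forall j, 0 <= X j)%E ->
  (\esum_(j in [set j | 0 < b j < 2 ^ k]%R) X j =
   \esum_(i in [set: nat]) \esum_(j in dyadic_level (k - 1 - i%:Z)) X j)%E.
Proof.
move=> X0; rewrite -esum_bigcupT//; last first.
  by apply: trivIset_dyadic_level => i i' /addrI /oppr_inj [].
congr esum; apply/seteqP; split=> [j /= /andP[bj kj]|j [i _ /= /andP[ij ij']]]; last first.
  rewrite (lt_le_trans _ ij) ?exprz_gt0//=.
  by apply: lt_le_trans ij' _; rewrite ler_eXz2l ?ltr1n// addrAC subrK gerBl.
have [k' /andP[h h']] := dyadic_int bj.
have kk' : k' < k.
  by have := le_lt_trans h kj; rewrite ltr_eXz2l ?ltr1n.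
exists (absz (k - 1 - k')%R) => //=; rewrite /dyadic_level/= gez0_abs; last by rewrite subr_ge0 lerBrDr lezD1.
by rewrite opprB [k - 1 + _]addrC subrK h.
Qed.

End levels.

(** * Heights of the terms, and the estimates for low and high levels *)

Section atomic_levels.
Context {R : realType} {n : nat}.
Notation mu := (@lebesgue R n).
Variables (p C : R) (lam : nat -> R[i]) (I : nat -> set 'rV[R]_n)
  (u : nat -> 'rV[R]_n) (l : nat -> R).
Hypotheses (v0 : 0 < @unit_vol R n) (p0 : 0 < p)
  (specI : forall j, cube_spec (I j) (u j) (l j))
  (overlap : bounded_overlap p lam I C).

Definition height j : R := cabs (lam j) / vol (I j) `^ p^-1.

Definition level_mass (k : int) : \bar R :=
  (\esum_(j in level p lam I k) (cabs (lam j) `^ p)%:E)%E.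

Let w0 j : 0 < vol (I j) `^ p^-1.
Proof. exact: atom_weight_gt0. Qed.

Lemma height_ge0 j : 0 <= height j.
Proof. by rewrite divr_ge0 ?cabs_ge0// ltW. Qed.

Lemma level_mass_ge0 k : (0 <= level_mass k)%E.
Proof. by apply: esum_ge0 => j _; rewrite lee_fin powR_ge0. Qed.

(** Allows level masses to be traded for heights and volumes: the mass of a term is the p-th power
    of its height times the volume of its cube. *)
Lemma height_powR j : cabs (lam j) `^ p = height j `^ p * vol (I j).
Proof.
have vj := cube_vol_gt0 v0 (specI j).
rewrite /height powRM ?cabs_ge0 ?invr_ge0 ?(ltW (w0 j))// -powRN -powRrM.
by rewrite mulNr mulVf ?gt_eqF// powR_inv1 ?(ltW vj)// divfK ?gt_eqF.
Qed.

Lemma side_le_vol j : l j ^+ n <= 2 ^+ n / @unit_vol R n * vol (I j).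
Proof.
have [l0 _ _ _ /andP[h _]] := specI j.
rewrite mulrAC ler_pdivlMr// mulrC.
have : 2 ^+ n * (@unit_vol R n * (l j / 2) ^+ n) <= 2 ^+ n * vol (I j).
  by rewrite ler_pM2l// exprn_gt0.
by rewrite mulrCA -exprMn [2 * _]mulrC divfK ?gt_eqF.
Qed.

Lemma overlap_ge0 : 0 <= C.
Proof.
by rewrite -lee_fin; apply: le_trans (overlap 0 0); apply: esum_ge0 => j _; rewrite lee_fin.
Qed.

(** On level [k - 1 - i] the heights are below [2 ^ (k - i)] and the indicators at [y] sum to at
    most [C]; the geometric series contributes the factor 2. *)
Lemma low_levels_sum (k : int) y :
  (\esum_(j in [set j | 0 < height j < 2 ^ k]%R) (height j * \1_(I j) y)%:E
    <= (2 * 2 ^ k * C)%:E)%E.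
Proof.
rewrite esum_levels_down; last by move=> j; rewrite lee_fin mulr_ge0// height_ge0.
have k0 : 0 <= 2 ^ k * C by rewrite mulr_ge0 ?overlap_ge0// exprz_ge0.
have h01 : 0 <= (2^-1 : R) < 1 by apply/andP; split; lra.
apply: le_trans (le_trans (esum_geometric k0 h01) _); last first.
  by rewrite lee_fin (_ : 1 - 2^-1 = 2^-1 :> R) ?invrK; [rewrite mulrC mulrA|lra].
apply: le_esum => i _.
apply: (@le_trans _ _ (\esum_(j in level p lam I (k - 1 - i%:Z))
    ((2 ^ (k - i%:Z))%:E * (\1_(I j) y)%:E))%E).
  apply: le_esum => j /andP[_ h]; rewrite -EFinM lee_fin ler_wpM2r//.
  by apply: ltW; rewrite (_ : k - i%:Z = k - 1 - i%:Z + 1)//; ring.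
have z0 : 0 <= 2 ^ (k - i%:Z) :> R by rewrite exprz_ge0.
rewrite esumZl//.
apply: le_trans (_ : ((2 ^ (k - i%:Z))%:E * C%:E <= _)%E).
  by apply: lee_wpmul2l; [rewrite lee_fin|exact: overlap].
by rewrite -EFinM lee_fin expfzDr// -invr_expz -exprnP -exprVn mulrAC.
Qed.

Variables (e : nat) (r : R).
Hypotheses (r0 : 0 < r) (rp : r < p) (er : n%:R < e%:R * r).

(** The cube with centre [u j] and half side [2 ^+ i.+1 * l j]; it contains the points at which the
    decay estimate holds with index [i]. *)
Definition dilated_box j i : set 'rV[R]_n :=
  box (u j - const_mx (2 ^+ i.+1 * l j))
    (u j - const_mx (2 ^+ i.+1 * l j) + const_mx (2 * (2 ^+ i.+1 * l j))).

(** A geometric series: the i-th dilate has side 4 * 2^i * l, hence measure at most 4^n 2^(in) l^n,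
    and it carries the weight 2^(-ier). *)
Definition weak_cst : R := 4 ^+ n / (1 - 2 ^+ n * (2 ^- e) `^ r).

Lemma weak_ratio : 0 < (2 ^+ n * (2 ^- e) `^ r : R) < 1.
Proof.
rewrite mulr_gt0 ?exprn_gt0 ?powR_gt0 ?invr_gt0 ?exprn_gt0//=.
rewrite -powR_invn// -powRrM -powR_mulrn// -powRD; last by rewrite pnatr_eq0 implybT.
rewrite (_ : n%:R + - e%:R * r = - (e%:R * r - n%:R)); last by ring.
rewrite powRN invf_lt1 ?powR_gt0//.
have := @gt0_ltr_powR R (e%:R * r - n%:R) _ 1 2.
by rewrite powR1 !nnegrE ler01 ler0n subr_gt0 ltr1n; apply.
Qed.

(** Markov's inequality, after which the sum is integrated term by term; the growth of the dilates
    is beaten by their weights since n < e r. *)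
Lemma height_weak (tau A : R) (D : set nat) : 0 < tau -> 0 <= A ->
  (mu [set x | 1 <= \esum_(j in D) \esum_(i in [set: nat])
      ((height j * A / tau * 2 ^- (i * e)) `^ r * \1_(dilated_box j i) x)%:E]
   <= (weak_cst * (A / tau) `^ r)%:E * \esum_(j in D) (height j `^ r * l j ^+ n)%:E)%E.
Proof.
move=> tau0 A0.
have c0 j i : 0 <= (height j * A / tau * 2 ^- (i * e)) `^ r by exact: powR_ge0.
have mf1 j i : measurable_fun setT (fun x : Rn R n =>
    ((height j * A / tau * 2 ^- (i * e)) `^ r * \1_(dilated_box j i) x)%:E).
  apply: measurable_EFinT; apply: measurable_funM; first exact: measurable_cst.
  exact: (measurable_indic (measurable_box _ _)).
have f10 j i x : (0 <= ((height j * A / tau * 2 ^- (i * e)) `^ r * \1_(dilated_box j i) x)%:E)%E.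
  by rewrite lee_fin mulr_ge0.
have mf j : measurable_fun setT (fun x : Rn R n => \esum_(i in [set: nat])
    ((height j * A / tau * 2 ^- (i * e)) `^ r * \1_(dilated_box j i) x)%:E)%E.
  exact: measurable_esum.
have f0 j x : (0 <= \esum_(i in [set: nat])
    ((height j * A / tau * 2 ^- (i * e)) `^ r * \1_(dilated_box j i) x)%:E)%E.
  exact: esum_ge0.
apply: le_trans (markov_ge1 _ _) _; [exact: measurable_esum| by move=> x; exact: esum_ge0|].
have wc0 : 0 <= weak_cst.
  rewrite divr_ge0 ?exprn_ge0// subr_ge0 ltW//; by case/andP: weak_ratio.
rewrite integral_esum// -esumZl; last 2 first.
  by rewrite mulr_ge0// powR_ge0.
  move=> j; have [l0 _ _ _ _] := specI j.
  by rewrite lee_fin mulr_ge0 ?powR_ge0 ?exprn_ge0// ltW.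
apply: le_esum => j _; rewrite integral_esum//.
have [l0 _ _ _ _] := specI j; have h0 := height_ge0 j.
set B := (height j * A / tau) `^ r * (4 * l j) ^+ n.
have B0 : 0 <= B by rewrite mulr_ge0 ?powR_ge0// exprn_ge0// mulr_ge0// ltW.
have /andP[rho0 rho1] := weak_ratio.
have rho01 : 0 <= 2 ^+ n * (2 ^- e) `^ r < 1 by rewrite ltW.
apply: le_trans (le_trans (esum_geometric B0 rho01) _); last first.
  rewrite lee_fin /B /weak_cst -[height j * A / tau]mulrA powRM ?h0 // ?divr_ge0 ?(ltW tau0)//.
  by rewrite exprMn le_eqVlt; apply/orP; left; apply/eqP; ring.
apply: le_esum => i _.
under eq_integral do rewrite EFinM.
rewrite (integral_cst_indic (c0 j i) (measurable_box _ _)).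
have s0 : 0 <= 2 * (2 ^+ i.+1 * l j) by rewrite !mulr_ge0 ?exprn_ge0// ltW.
have ce0 : (0 <= ((height j * A / tau * 2 ^- (i * e)) `^ r)%:E)%E by rewrite lee_fin.
apply: le_trans (lee_wpmul2l ce0 (lebesgue_cube_le _ s0)) _.
have z0 : 0 <= height j * A / tau by rewrite (divr_ge0 (mulr_ge0 h0 A0)) ?ltW.
rewrite -EFinM lee_fin /B (powRM _ z0) ?invr_ge0 ?exprn_ge0//.
rewrite (mulnC i e) exprM -exprVn powR_expn ?invr_ge0 ?exprn_ge0//.
rewrite exprS !exprMn -!exprM [(i * n)%N]mulnC (_ : 4 = 2 * 2 :> R) ?exprMn; last by rewrite -natrM.
by rewrite le_eqVlt; apply/orP; left; apply/eqP; ring.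
Qed.

(** Write height^r as height^(r-p) height^p. The second factor times the volume is the mass of the
    term, and the first, with a negative exponent, is largest at the bottom of the level. *)
Lemma high_levels_mass (k : int) :
  (\esum_(j in [set j | 2 ^ k <= height j]%R) (height j `^ r * l j ^+ n)%:E <=
   (2 ^+ n / @unit_vol R n)%:E * \esum_(i in [set: nat])
     (((2 ^ (k + i%:Z)) `^ (r - p))%:E * level_mass (k + i%:Z)))%E.
Proof.
have X0 j : (0 <= (height j `^ r * l j ^+ n)%:E)%E.
  have [l0 _ _ _ _] := specI j.
  by rewrite lee_fin mulr_ge0 ?powR_ge0// exprn_ge0// ltW.
rewrite esum_levels_up//.
have c0 : 0 <= 2 ^+ n / @unit_vol R n by rewrite divr_ge0 ?exprn_ge0// ltW.
rewrite -esumZl//; last first.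
  by move=> i; rewrite mule_ge0 ?level_mass_ge0// lee_fin powR_ge0.
apply: le_esum => i _.
rewrite /level_mass muleA -EFinM -esumZl; last 2 first.
  by rewrite mulr_ge0 ?powR_ge0.
  by move=> j; rewrite lee_fin powR_ge0.
apply: le_esum => j /andP[hj _]; rewrite -EFinM lee_fin height_powR.
have k20 : 0 < 2 ^ (k + i%:Z) :> R by rewrite exprz_gt0.
have hj0 : 0 < height j by apply: lt_le_trans hj.
have vj := ltW (cube_vol_gt0 v0 (specI j)).
apply: (@le_trans _ _ (height j `^ r * (2 ^+ n / @unit_vol R n * vol (I j)))).
  by rewrite ler_wpM2l ?powR_ge0// side_le_vol.
set c := 2 ^+ n / _ in c0 *.
rewrite mulrCA -[leRHS]mulrA ler_wpM2l// [leRHS]mulrA ler_wpM2r//.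
rewrite (_ : height j `^ r = height j `^ (r - p) * height j `^ p); last first.
  by rewrite -powRD ?subrK// (gt_eqF hj0) implybT.
rewrite ler_wpM2r ?powR_ge0//.
have -> : r - p = - (p - r) by rewrite opprB.
rewrite !powRN lef_pV2 ?posrE ?powR_gt0//.
by apply: ge0_ler_powR; rewrite ?nnegrE ?(ltW hj0) ?(ltW k20)// subr_ge0 ltW.
Qed.

End atomic_levels.

(** * Limits and absolutely convergent series of complex numbers *)

Section complex_limits.
Context {R : realType}.
Implicit Types (z : nat -> R[i]) (w : R[i]).

Definition ccvg z w := (fun m : nat => cabs (z m - w)) @ \oo --> (0 : R).

Lemma ccvgP z w : ccvg z w <-> forall e : R, 0 < e -> \forall m \near \oo, cabs (z m - w) < e.
Proof.
split=> [/cvgrPdist_lt h e /h|h].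
  by apply: filterS => m; rewrite sub0r normrN ger0_norm ?cabs_ge0.
apply/cvgrPdist_lt => e /h; apply: filterS => m.
by rewrite sub0r normrN ger0_norm ?cabs_ge0.
Qed.

Lemma ccvg_unique z w w' : ccvg z w -> ccvg z w' -> w = w'.
Proof.
move=> /ccvgP h /ccvgP h'; apply/eqP; rewrite -subr_eq0; apply/eqP/cabs_eq0/eqP.
rewrite eq_le cabs_ge0 andbT; apply/ler_addgt0Pr => e e0; rewrite add0r.
have e2 : 0 < e / 2 by rewrite divr_gt0.
have [m [h1 h2]] := filter_ex (filterI (h _ e2) (h' _ e2)).
have -> : w - w' = - (z m - w) + (z m - w') by rewrite opprB subrKA.
by apply: le_trans (cabsD _ _) _; rewrite cabsN [leRHS]splitr lerD// ltW.
Qed.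

Lemma ccvg_lin z z' w w' (c : R[i]) : ccvg z w -> ccvg z' w' ->
  ccvg (fun m => c * z m + z' m) (c * w + w').
Proof.
move=> /ccvgP h /ccvgP h'; apply/ccvgP => e e0.
have c1 : 0 < cabs c + 1 by rewrite ltr_wpDl// cabs_ge0.
have e1 : 0 < e / 2 / (cabs c + 1) by rewrite !divr_gt0.
have e2 : 0 < e / 2 by rewrite divr_gt0.
apply: filterS (filterI (h _ e1) (h' _ e2)) => m [h1 h2].
have -> : c * z m + z' m - (c * w + w') = c * (z m - w) + (z' m - w').
  by rewrite mulrBr opprD addrACA.
apply: le_lt_trans (cabsD _ _) _; rewrite cabsM [ltRHS]splitr ltr_leD ?ltW//.
apply: le_lt_trans (_ : (cabs c + 1) * cabs (z m - w) < _).
  by rewrite ler_wpM2r ?cabs_ge0// lerDl.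
by rewrite mulrC -ltr_pdivlMr.
Qed.

Lemma cabs_sum (m : nat) (c : nat -> R[i]) : cabs (\sum_(j < m) c j) <= \sum_(j < m) cabs (c j).
Proof.
elim: m => [|m IH]; first by rewrite !big_ord0 cabs0.
by rewrite !big_ord_recr/= (le_trans (cabsD _ _))// lerD2r.
Qed.

Lemma sum_le_esum (m : nat) (c : nat -> R) : (forall j, 0 <= c j) ->
  ((\sum_(j < m) c j)%:E <= \esum_(j in [set: nat]) (c j)%:E)%E.
Proof.
move=> c0; rewrite -nneseries_esumT => [|j]; last by rewrite lee_fin.
by rewrite -(big_mkord xpredT c) -sumEFin; apply: nneseries_lim_ge => j _ _; rewrite lee_fin.
Qed.

Lemma ccvg_le_esum (c : nat -> R[i]) w : ccvg (fun m => \sum_(j < m) c j) w ->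
  ((cabs w)%:E <= \esum_(j in [set: nat]) (cabs (c j))%:E)%E.
Proof.
move=> /ccvgP h; apply/lee_addgt0Pr => e e0; have [m hm] := filter_ex (h _ e0).
apply: (@le_trans _ _ ((\sum_(j < m) cabs (c j))%:E + e%:E)%E).
  rewrite -EFinD lee_fin -[w]opprK cabsN.
  have -> : - w = (\sum_(j < m) c j - w) + - (\sum_(j < m) c j) by rewrite addrAC subrr add0r.
  rewrite (le_trans (cabsD _ _))// addrC lerD ?(ltW hm)// cabsN; exact: cabs_sum.
by rewrite leeD2r// sum_le_esum// => j; exact: cabs_ge0.
Qed.

Lemma ccvg_esum (c : nat -> R[i]) : (\esum_(j in [set: nat]) (cabs (c j))%:E < +oo)%E ->
  exists w, ccvg (fun m => \sum_(j < m) c j) w.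
Proof.
move=> coo.
have cv (g : nat -> R) : (forall j, `|g j| <= cabs (c j)) ->
    exists x : R, (fun m : nat => \sum_(j < m) g j) @ \oo --> x.
  move=> gc; have : cvgn (series g).
    apply: normed_cvg; apply: (@nnseries_is_cvg R (fun j => `|g j|)) => [j|].
      exact: normr_ge0.
    apply: le_lt_trans coo; rewrite nneseries_esumT => [|j]; last by rewrite lee_fin.
    by apply: le_esum => j _; rewrite lee_fin.
  move=> /cvg_ex[x gx]; exists x.
  by rewrite (_ : (fun m => _) = series g)//; apply/funext => m; rewrite /series/= big_mkord.
have [x /cvgrPdist_lt hx] := cv (fun j => complex.Re (c j)) (fun j => cabs_Re _).
have [y /cvgrPdist_lt hy] := cv (fun j => complex.Im (c j)) (fun j => cabs_Im _).
exists (x +i* y); apply/ccvgP => e e0; have e2 : 0 < e / 2 by rewrite divr_gt0.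
apply: filterS (filterI (hx _ e2) (hy _ e2)) => m [h1 h2].
apply: le_lt_trans (cabs_le _) _; rewrite [ltRHS]splitr; apply: ltrD.
  by apply: le_lt_trans h1; rewrite [leRHS]distrC raddfB/= raddf_sum.
by apply: le_lt_trans h2; rewrite [leRHS]distrC raddfB/= raddf_sum.
Qed.

End complex_limits.

(** * The terms of the series, split by height *)

Section atomic_terms.
Context {R : realType} {n : nat}.
Notation mu := (@lebesgue R n).
Variables (p C : R) (lam : nat -> R[i]) (a : nat -> 'rV[R]_n -> R[i])
  (I : nat -> set 'rV[R]_n) (u : nat -> 'rV[R]_n) (l : nat -> R).
Hypotheses (v0 : 0 < @unit_vol R n) (p0 : 0 < p) (p1 : p <= 1)
  (atomI : forall j, atom p (I j) (a j))
  (specI : forall j, cube_spec (I j) (u j) (l j))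
  (overlap : bounded_overlap p lam I C).

Let ht := height p lam I.

Definition pairing (psi : 'rV[R]_n -> R[i]) j : R :=
  cabs (lam j * cintegral (fun y => a j y * psi y)).

Lemma pairing_ge0 psi j : 0 <= pairing psi j. Proof. exact: cabs_ge0. Qed.

Let w0 j : 0 < vol (I j) `^ p^-1.
Proof. exact: (atom_weight_gt0 p v0 (specI j)). Qed.

Lemma height_eq0 j : ht j = 0 -> lam j = 0.
Proof.
move=> /eqP; rewrite /ht /height mulf_eq0 invr_eq0 (gt_eqF (w0 j)) orbF => /eqP.
exact: cabs_eq0.
Qed.

(** A term of height 0 lies on neither side of the splitting, but its coefficient is 0. *)
Lemma pairing_split (k : int) psi :
  (\esum_(j in [set: nat]) (pairing psi j)%:E <=
   \esum_(j in [set j | 0 < ht j < 2 ^ k]%R) (pairing psi j)%:E +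
   \esum_(j in [set j | 2 ^ k <= ht j]%R) (pairing psi j)%:E)%E.
Proof.
rewrite (esumID [set j | 2 ^ k <= ht j]%R) => [|j _]; last by rewrite lee_fin pairing_ge0.
rewrite !setTI addeC leeD2r// esum_mkcond [leRHS]esum_mkcond.
apply: le_esum => j _; case: ifPn => [/set_mem /= /negP nk|_]; last first.
  by case: ifP => // _; rewrite lee_fin pairing_ge0.
rewrite -ltNge in nk.
case: ifPn => // /negP h; rewrite /pairing height_eq0 ?mul0r ?cabs0//.
apply/eqP; apply: contra_notT h => h; apply/mem_set => /=.
by rewrite nk andbT lt_neqAle eq_sym h; exact: (height_ge0 p lam v0 specI j).
Qed.

(** The sum is moved under the integral, where bounded overlap bounds the low part pointwise by a
    multiple of [2 ^ k]. *)
Lemma low_pairing (k : int) psi (H : Rn R n -> \bar R) :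
  cmeasurable psi -> measurable_fun setT H -> (forall y, H y \is a fin_num) ->
  (forall y, (cabs (psi y))%:E <= H y)%E ->
  (\esum_(j in [set j | 0 < ht j < 2 ^ k]%R) (pairing psi j)%:E <=
    (4 * 2 ^ k * C)%:E * \int[mu]_y H y)%E.
Proof.
move=> mpsi mH Hfin psiH.
have H0 y : (0 <= H y)%E by apply: le_trans (psiH y); rewrite lee_fin cabs_ge0.
have mI j : measurable (I j : set (Rn R n)) by have [] := specI j.
have h0 j : 0 <= ht j := height_ge0 p lam v0 specI j.
have m1H j : measurable_fun setT (fun y : Rn R n => (\1_(I j) y)%:E * H y)%E.
  exact: (emeasurable_funM (measurable_indicE (mI j)) mH).
pose f j (y : Rn R n) := ((2 * ht j * \1_(I j) y)%:E * H y)%E.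
have f0 j y : (0 <= f j y)%E by rewrite mule_ge0// lee_fin mulr_ge0// mulr_ge0 ?h0.
have mf j : measurable_fun setT (f j).
  have m2 := measurable_EFinT (measurable_funM (measurable_cst (2 * ht j)) (measurable_indic (mI j))).
  exact: (emeasurable_funM m2 mH).
apply: (@le_trans _ _ (\esum_(j in [set j | 0 < ht j < 2 ^ k]%R) \int[mu]_y f j y)%E).
  apply: le_esum => j _; rewrite /pairing cabsM EFinM.
  have c0 : (0 <= (cabs (lam j))%:E)%E by rewrite lee_fin cabs_ge0.
  apply: le_trans (lee_wpmul2l c0 (atom_cintegral_le v0 (atomI j) (specI j) mpsi mH psiH)) _.
  rewrite muleA -EFinM le_eqVlt; apply/orP; left; apply/eqP.
  rewrite -(integralZT _ (m1H j)); last 2 first.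
    by rewrite mulr_ge0 ?cabs_ge0// mulr_ge0// invr_ge0 ltW.
    by move=> y; rewrite mule_ge0// lee_fin.
  apply: eq_integral => y _; rewrite /f muleA -EFinM; congr (_%:E * _)%E.
  by rewrite /ht /height; ring.
rewrite -integral_esum//.
have cst0 : 0 <= 4 * 2 ^ k * C.
  by rewrite mulr_ge0 ?(overlap_ge0 overlap)// mulr_ge0// exprz_ge0.
rewrite -(integralZT cst0 mH H0).
have mS := @measurable_esum R n [set j | 0 < ht j < 2 ^ k]%R f mf f0.
have mcH : measurable_fun setT (fun y : Rn R n => (4 * 2 ^ k * C)%:E * H y)%E.
  exact: measurable_funeM.
apply: (le_integralT mS mcH) => y.
  by apply: esum_ge0 => j _; exact: f0.
have Hy : H y = (fine (H y))%:E by rewrite fineK.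
have fH0 : 0 <= fine (H y) by rewrite fine_ge0.
rewrite (eq_esum (b := fun j => ((2 * fine (H y))%:E * (ht j * \1_(I j) y)%:E)%E)); last first.
  by move=> j _; rewrite /f Hy -!EFinM; congr EFin; rewrite /=; ring.
rewrite esumZl; last 2 first.
  by rewrite mulr_ge0.
  by move=> j; rewrite lee_fin mulr_ge0 ?h0.
have c0 : (0 <= (2 * fine (H y))%:E)%E by rewrite lee_fin mulr_ge0.
have h : (\esum_(j in [set j | 0 < ht j < 2 ^ k]%R) (ht j * \1_(I j) y)%:E
    <= (2 * 2 ^ k * C)%:E)%E.
  exact: (low_levels_sum v0 specI overlap).
apply: (le_trans (lee_wpmul2l c0 h)).
rewrite [in leRHS]Hy -!EFinM lee_fin le_eqVlt; apply/orP; left; apply/eqP; ring.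
Qed.

Lemma atomic_sum_le (f : ('rV[R]_n -> R[i]) -> R[i]) psi :
  atomic_sum f lam a -> test_function psi ->
  ((cabs (f psi))%:E <= \esum_(j in [set: nat]) (pairing psi j)%:E)%E.
Proof.
move=> fsum tpsi.
exact: (@ccvg_le_esum _ (fun j => lam j * cintegral (fun y => a j y * psi y)) _ (fsum _ tpsi)).
Qed.

End atomic_terms.

(** * The distribution function of the radial maximal function *)

Section weak_type.
Context {R : realType} {n : nat}.
Notation mu := (@lebesgue R n).
Variables (p C : R) (phi : 'rV[R]_n -> R[i]) (m : nat) (G rad r : R).
Hypotheses (v0 : 0 < @unit_vol R n) (p0 : 0 < p) (p1 : p <= 1)
  (tphi : test_function phi) (G0 : 0 < G) (rad0 : 0 < rad)
  (phi0 : forall x, rad < `|x| -> phi x = 0)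
  (phiG : forall s x, (size s <= m)%N ->
     `|partials s (fun y => complex.Re (phi y)) x| <= G /\
     `|partials s (fun y => complex.Im (phi y)) x| <= G)
  (mE : m = (@moment_order R n p).+1)
  (r0 : 0 < r) (rp : r < p) (er : n%:R < (n + m)%:R * r).

Lemma decay_cst_ge0 : 0 <= @decay_cst R n m G rad.
Proof.
have r2 : 0 <= 2 * rad by rewrite mulr_ge0// ltW.
by rewrite addr_ge0// mulr_ge0 ?exprn_ge0// mulr_ge0 ?(ltW G0)// mulr_ge0.
Qed.

Section fixed_decomposition.
Variables (lam : nat -> R[i]) (a : nat -> 'rV[R]_n -> R[i])
  (I : nat -> set 'rV[R]_n) (u : nat -> 'rV[R]_n) (l : nat -> R).
Hypotheses (atomI : forall j, atom p (I j) (a j))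
  (specI : forall j, cube_spec (I j) (u j) (l j))
  (overlap : bounded_overlap p lam I C).
Let ht := height p lam I.
Let A := @decay_cst R n m G rad.

(** The conclusion is free of [t]: this turns an estimate for each dilate into one for the maximal
    function. *)
Lemma high_pairing (D : set nat) (tau t : R) x : 0 < tau -> 0 < t ->
  (tau%:E < \esum_(j in D) (pairing lam a (fun y => dilate phi t (x - y)) j)%:E)%E ->
  (1 <= \esum_(j in D) \esum_(i in [set: nat])
      ((ht j * A / tau * 2 ^- (i * (n + m))) `^ r * \1_(dilated_box u l j i) x)%:E)%E.
Proof.
move=> tau0 t0 h; set psi := (fun y => dilate phi t (x - y)) in h.
have ti0 : 0 <= tau^-1 by rewrite invr_ge0 ltW.
have h1 : (1 <= \esum_(j in D) ((tau^-1 * pairing lam a psi j) `^ r)%:E)%E.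
  apply: esum_powR_ge1.
  - by move=> j; rewrite mulr_ge0// pairing_ge0.
  - by rewrite r0 (le_trans (ltW rp)).
  - rewrite (eq_esum (b := fun j => ((tau^-1)%:E * (pairing lam a psi j)%:E)%E))//.
    rewrite esumZl// => [|j]; last by rewrite lee_fin pairing_ge0.
    by rewrite -lte_pdivrMl ?invr_gt0// invrK mule1.
apply: (le_trans h1).
apply: le_esum => j _.
have [i [xi ci]] := atom_dilate_decay tphi G0 rad0 phi0 phiG v0 (atomI j) (specI j) mE x t0.
have -> : ((tau^-1 * pairing lam a psi j) `^ r)%:E =
    ((tau^-1 * pairing lam a psi j) `^ r * \1_(dilated_box u l j i) x)%:E.
  rewrite indicE mem_set ?mulr1// => k; rewrite !mxE.
  have := le_trans (coord_le_norm (x - u j) k) xi; rewrite !mxE ler_norml => /andP[g1 g2].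
  by apply/andP; split; lra.
(* The index comes from the decay estimate after [t] is given; the sum over all indices dominates
   whichever one it is. *)
apply: le_trans (@esum_ge_term _ _ [set: nat] (fun i => ((ht j * A / tau * 2 ^- (i * (n + m))) `^ r *
  \1_(dilated_box u l j i) x)%:E) i _ _) => //; last first.
  by move=> i'; rewrite lee_fin mulr_ge0// powR_ge0.
rewrite lee_fin ler_wpM2r//.
have h0 : 0 <= ht j := height_ge0 p lam v0 specI j.
have z0 : 0 <= tau^-1 * pairing lam a psi j by rewrite mulr_ge0// pairing_ge0.
have zle : tau^-1 * pairing lam a psi j <= ht j * A / tau * 2 ^- (i * (n + m)).
  rewrite [ht j * A / tau]mulrC -mulrA ler_wpM2l// /pairing cabsM.
  apply: le_trans (ler_wpM2l (cabs_ge0 _) ci) _.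
  by rewrite /ht /height /A le_eqVlt; apply/orP; left; apply/eqP; ring.
apply: ge0_ler_powR => //; first exact: ltW.
by rewrite nnegrE (le_trans z0).
Qed.

Lemma low_pairing_dilate (k : int) (t : R) x : 0 < t ->
  (\esum_(j in [set j | 0 < ht j < 2 ^ k]%R)
     (pairing lam a (fun y => dilate phi t (x - y)) j)%:E <=
   (4 * 2 ^ k * C * (2 * G * (2 * rad) ^+ n))%:E)%E.
Proof.
move=> t0.
have [sdil _] : test_function (fun y => dilate phi t (x - y)).
  by apply: test_function_reflect; exact: test_function_dilate.
apply: le_trans (low_pairing v0 atomI specI overlap k (csmooth_measurable sdil)
  (measurable_dilate_dom G rad t x) _ _) _ => [y|y|].
- by rewrite /dilate_dom -EFinM.
- exact: (dilate_le tphi G0 phi0 phiG x y t0).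
have c0 : (0 <= (4 * 2 ^ k * C)%:E)%E.
  by rewrite lee_fin mulr_ge0 ?(overlap_ge0 overlap)// mulr_ge0// exprz_ge0.
rewrite [X in (_ <= X)%E]EFinM.
exact: (lee_wpmul2l c0 (integral_dilate_dom G0 rad0 x t0)).
Qed.

Lemma radial_maximal_gt (f : ('rV[R]_n -> R[i]) -> R[i]) (y : R) x : 0 <= y ->
  (y%:E < `|radial_maximal phi f x|)%E ->
  exists2 t : R, 0 < t & y < cabs (dconv f (dilate phi t) x).
Proof.
move=> y0; rewrite gee0_abs; last first.
  apply: (@le_trans _ _ (cabs (dconv f (dilate phi 1) x))%:E); first by rewrite lee_fin cabs_ge0.
  by apply: ereal_sup_ubound; exists 1 => //=.
by move=> /ereal_sup_gt[_ [t /= t0 <-]]; rewrite lte_fin => h; exists t.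
Qed.

(** By the choice of [s] the levels below [k - s] contribute at most half of [2 ^ k] for every
    dilate. Where the maximal function exceeds [2 ^ k], the upper levels therefore exceed the other
    half for some [t]. *)
Lemma distrib_radial_maximal (f : ('rV[R]_n -> R[i]) -> R[i]) (s : nat) (k : int) :
  atomic_sum f lam a ->
  4 * C * (2 * G * (2 * rad) ^+ n) * 2 <= 2 ^+ s ->
  (distrib_fun (radial_maximal phi f) (2 ^ k) <=
   (@weak_cst R n (n + m) r * (A / (2 ^ k / 2)) `^ r)%:E *
   ((2 ^+ n / @unit_vol R n)%:E * \esum_(i in [set: nat])
     (((2 ^ (k - s%:Z + i%:Z)) `^ (r - p))%:E * level_mass p lam I (k - s%:Z + i%:Z))))%E.
Proof.
move=> fsum sC; have k20 : 0 < 2 ^ k :> R by rewrite exprz_gt0.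
have tau0 : 0 < 2 ^ k / 2 :> R by rewrite divr_gt0.
have [/andP[_ rho1] A0] := (weak_ratio er, decay_cst_ge0).
have c0 : (0 <= (@weak_cst R n (n + m) r * (A / (2 ^ k / 2)) `^ r)%:E)%E.
  by rewrite lee_fin mulr_ge0 ?powR_ge0// divr_ge0 ?exprn_ge0// subr_ge0 ltW.
apply: le_trans (lee_wpmul2l c0 (high_levels_mass lam v0 p0 specI rp (k - s%:Z))).
apply: le_trans (height_weak p lam v0 specI er _ tau0 A0).
apply: le_outer_measure => x /(radial_maximal_gt (ltW k20))[t t0].
rewrite -lte_fin => kt.
have tdil : test_function (fun y => dilate phi t (x - y)).
  by apply: test_function_reflect; exact: test_function_dilate.
have kt1 := lt_le_trans kt (atomic_sum_le fsum tdil).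
have kt2 := lt_le_trans kt1 (pairing_split p lam a v0 specI (k - s%:Z) _).
apply: (high_pairing tau0 t0).
have low := low_pairing_dilate (k - s%:Z) x t0.
have low' : 4 * 2 ^ (k - s%:Z) * C * (2 * G * (2 * rad) ^+ n) <= 2 ^ k / 2.
  rewrite expfzDr// -invr_expz -exprnP.
  have -> : 4 * (2 ^ k / 2 ^+ s) * C * (2 * G * (2 * rad) ^+ n) =
    2 ^ k / 2 * (4 * C * (2 * G * (2 * rad) ^+ n) * 2 / 2 ^+ s) by field.
  by rewrite ler_piMr// ?(ltW tau0)// ler_pdivrMr ?exprn_gt0// mul1r.
have kt3 := lt_le_trans kt2 (leeD2r _ (le_trans low _)).
have := kt3 (2 ^ k / 2)%:E; rewrite lee_fin low' => /(_ isT).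
rewrite -lteBlDl// -EFinB (_ : 2 ^ k - 2 ^ k / 2 = 2 ^ k / 2)//.
by field.
Qed.

End fixed_decomposition.
End weak_type.

(** * Choice of the constants and the quasinorm estimate *)

Section norm_bound.
Context {R : realType} {n : nat}.
Implicit Types (p q r : R).

(** The integer part gives N + 1 > n(1/p - 1); multiply by p. *)
Lemma moment_order_gt p : 0 < p -> n%:R < (n + (@moment_order R n p).+1)%:R * p.
Proof.
move=> p0; have := truncnS_gt (n%:R * (p^-1 - 1) : R).
rewrite -/(@moment_order R n p) natrD => h.
have : n%:R * (p^-1 - 1) * p < (@moment_order R n p).+1%:R * p by rewrite ltr_pM2r.
have -> : n%:R * (p^-1 - 1) * p = n%:R - n%:R * p by field; rewrite gt_eqF.
by rewrite mulrDl => h'; lra.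
Qed.

(** The powers of [2 ^ k] cancel, their exponents being p, -r and r - p. What remains decays in [i],
    in the squared form that [ell_qnorm_geometric] expects. *)
Lemma dyadic_exponents (p r A : R) (s i : nat) (k : int) : 0 <= A ->
  (2 ^ k) `^ p * (A / (2 ^ k / 2)) `^ r * (2 ^ (k - s%:Z + i%:Z)) `^ (r - p) =
  A `^ r * 2 `^ (r + s%:R * (p - r)) * ((2 `^ (- ((p - r) / 2))) ^+ i) ^+ 2.
Proof.
move=> A0.
have -> : A / (2 ^ k / 2) = A * 2 `^ (1 - k%:~R).
  by rewrite powRB ?powRr1// ?powR_intmul// ?invf_div//; rewrite pnatr_eq0 implybT.
have T (z : int) : 2 ^ z = 2 `^ z%:~R :> R by rewrite powR_intmul.
have -> : ((2 `^ (- ((p - r) / 2))) ^+ i) ^+ 2 = 2 `^ (- (p - r) * i%:R) :> R.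
  rewrite -exprM -powR_mulrn ?powR_ge0// -powRrM; congr (_ `^ _).
  by rewrite natrM; field.
rewrite powRM ?powR_ge0// !T -!powRrM mulrCA -!mulrA; congr (_ * _).
have D (x y : R) : 2 `^ x * 2 `^ y = 2 `^ (x + y) :> R by rewrite powRD// pnatr_eq0 implybT.
by rewrite !D; congr (_ `^ _); rewrite !intrD mulrNz -!pmulrn; ring.
Qed.

Lemma coef_qnormE p (q : \bar R) lam (I : nat -> set 'rV[R]_n) :
  coef_qnorm p q lam I = block_qnorm p q (level_mass p lam I).
Proof. by case: q. Qed.

Theorem hardy_lorentz_qnorm_le (p C : R) (q : \bar R) (phi : 'rV[R]_n -> R[i]) :
  0 < p -> p <= 1 -> (0 < q)%E -> test_function phi -> cintegral phi != 0 ->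
  exists2 c : R, 0 <= c & forall f lam a I,
    (forall j, atom p (I j) (a j)) -> atomic_sum f lam a -> bounded_overlap p lam I C ->
    (hardy_lorentz_qnorm phi p q f <= c%:E * coef_qnorm p q lam I)%E.
Proof.
move=> p0 p1 q0 tphi phi_int.
have v0 : 0 < @unit_vol R n := unit_vol_gt0 phi_int.
have [m mE] : exists m, m = (@moment_order R n p).+1 by eexists.
have [G [rad [G0 rad0 phi0 phiG]]] := test_function_bound m tphi.
have e0 : 0 < (n + m)%:R :> R by rewrite ltr0n mE addnS.
have ep : n%:R < (n + m)%:R * p by rewrite mE; exact: moment_order_gt.
have nep : n%:R / (n + m)%:R < p by rewrite ltr_pdivrMr// mulrC.
(* The midpoint of the admissible interval: above [n / (n + m)] the sum over dilates converges,
   below [p] the sum over levels does. *)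
pose r := (n%:R / (n + m)%:R + p) / 2.
have ne0 : 0 <= n%:R / (n + m)%:R :> R by rewrite divr_ge0.
have r0 : 0 < r by rewrite /r; lra.
have rp : r < p by rewrite /r; lra.
have er : n%:R < (n + m)%:R * r.
  by rewrite mulrC -ltr_pdivrMr// /r; lra.
(* The overlap constant enters the estimate here, and only through [s]. *)
have [s sC] : exists s : nat, 4 * C * (2 * G * (2 * rad) ^+ n) * 2 <= 2 ^+ s.
  pose y := 4 * C * (2 * G * (2 * rad) ^+ n) * 2; exists (Num.truncn y).+1.
  apply: le_trans (ltW (truncnS_gt y)) _.
  by rewrite -natrX ler_nat ltnW// ltn_expl.
pose A := @decay_cst R n m G rad.
have A0 : 0 <= A by exact: decay_cst_ge0 G0 rad0.
(* The square root of the ratio 2^(-(p-r)) found in [dyadic_exponents]. *)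
pose th : R := 2 `^ (- ((p - r) / 2)).
have th01 : 0 < th < 1.
  rewrite /th powR_gt0//= powRN invf_lt1 ?powR_gt0//.
  have := @gt0_ltr_powR R ((p - r) / 2) _ 1 2.
  rewrite powR1 !nnegrE ler01 ler0n ltr1n; apply => //.
  by rewrite divr_gt0// subr_gt0.
pose W := @weak_cst R n (n + m) r.
have W0 : 0 <= W.
  have /andP[_ rho1] := weak_ratio er.
  by rewrite divr_ge0 ?exprn_ge0// subr_ge0 ltW.
pose V := 2 ^+ n / @unit_vol R n.
have V0 : 0 <= V by rewrite divr_ge0 ?exprn_ge0// ltW.
pose K := W * V * (A `^ r * 2 `^ (r + s%:R * (p - r))).
have K0 : 0 <= K by apply: mulr_ge0; apply: mulr_ge0 => //; exact: powR_ge0.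
have [c c0 cP] := @ell_qnorm_geometric R p th K q s%:Z p0 th01 K0 q0.
exists c => // f lam a I atomI fsum overlap.
have [ul ulP] : {ul : nat -> 'rV[R]_n * R & forall j, cube_spec (I j) (ul j).1 (ul j).2}.
  apply: (@choice _ _ (fun j ul => cube_spec (I j) ul.1 ul.2)) => j.
  have [cI _ _ _ _] := atomI j; have [u [l ul]] := cubeP cI.
  by exists (u, l).
pose u j := (ul j).1; pose l j := (ul j).2.
have specI j : cube_spec (I j) (u j) (l j) by exact: ulP.
rewrite coef_qnormE /hardy_lorentz_qnorm /lorentz_qnorm.
apply: (cP (level_mass p lam I) (fun k => distrib_fun (radial_maximal phi f) (2 ^ k))).
- by move=> k; exact: level_mass_ge0.
- by move=> k; exact: outer_measure_ge0.
move=> k.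
have := @distrib_radial_maximal R n p C phi m G rad r v0 p0 p1 tphi G0 rad0 phi0 phiG mE r0 rp er
  lam a I u l atomI specI overlap f s k fsum sC.
have k0 : (0 <= ((2 ^ k) `^ p)%:E)%E by rewrite lee_fin powR_ge0.
move=> /(lee_wpmul2l k0) /le_trans; apply.
have S0 i : (0 <= level_mass p lam I i)%E by exact: level_mass_ge0.
rewrite !muleA -!EFinM -/A -/W -/V -!esumZl//; last 3 first.
- by apply: mulr_ge0 => //; apply: mulr_ge0; [|apply: mulr_ge0 => //]; exact: powR_ge0.
- by move=> i; rewrite mule_ge0// lee_fin powR_ge0.
- by move=> i; rewrite mule_ge0// lee_fin !exprn_ge0// ltW//; case/andP: th01.
apply: le_esum => i _; rewrite !muleA -!EFinM.
rewrite (_ : k + (i%:Z - s%:Z) = k - s%:Z + i%:Z); last by ring.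
rewrite le_eqVlt; apply/orP; left; apply/eqP; congr (_%:E * _)%E.
have := dyadic_exponents p r s i k A0; rewrite -/th => E.
rewrite /K -[RHS]mulrA -E; ring.
Qed.

End norm_bound.

(** * Measurability of the maximal function, and an integrable polynomial weight *)

Section measurability.
Context {R : realType} {n : nat}.

Lemma measurable_radial_maximal (phi : 'rV[R]_n -> R[i]) (f : ('rV[R]_n -> R[i]) -> R[i]) :
  is_distribution f -> test_function phi ->
  measurable_fun setT (radial_maximal phi f : Rn R n -> \bar R).
Proof.
move=> df tphi.
apply: (measurability (@ErealGenOInfty.G R)); first exact: ErealGenOInfty.measurableE.
move=> _ [_ [y ->] <-]; rewrite setTI.
apply: measurable_open; rewrite openE => x /=; rewrite in_itv/= andbT.
move=> /ereal_sup_gt[_ [t /= t0 <-]]; rewrite lte_fin => yt.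
have e0 : 0 < cabs (dconv f (dilate phi t) x) - y by rewrite subr_gt0.
have [d d0 dP] := dconv_continuous x df (test_function_dilate t0 tphi) e0.
apply/nbhs_ballP; exists d => //= x'; rewrite -ball_normE /= => /dP h.
rewrite in_itv/= andbT.
apply: (@lt_le_trans _ _ (cabs (dconv f (dilate phi t) x'))%:E); last first.
  by apply: ereal_sup_ubound; exists t.
rewrite lte_fin.
have := cabsD (dconv f (dilate phi t) x - dconv f (dilate phi t) x') (dconv f (dilate phi t) x').
by rewrite subrK => h'; lra.
Qed.

Definition poly_decay (x : 'rV[R]_n) : R := (1 + `|x|) ^- n.+1.

Lemma poly_decay_ge0 x : 0 <= poly_decay x.
Proof. by rewrite invr_ge0 exprn_ge0// addr_ge0. Qed.

Lemma measurable_poly_decay :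
  measurable_fun setT (fun x : Rn R n => (poly_decay x)%:E).
Proof.
apply/measurable_EFinP; apply: measurable_continuous => x.
apply: (@continuous_comp _ _ _ (fun x : 'rV[R]_n => (1 + `|x|) ^+ n.+1) (fun t : R => t^-1)).
  apply: (@continuous_comp _ _ _ (fun x : 'rV[R]_n => 1 + `|x|) (fun t : R => t ^+ n.+1)).
    apply: continuousD; first exact: cst_continuous.
    exact: norm_continuous.
  exact: exprn_continuous.
apply: inv_continuous.
by rewrite expf_neq0// gt_eqF// ltr_pwDl.
Qed.

Lemma integral_poly_decay :
  (\int[@lebesgue R n]_x (poly_decay x)%:E <= (2 * 4 ^+ n)%:E)%E.
Proof.
(* Where 1 + |x| is between 2^i and 2^(i+1) the weight is at most 2^(-i(n+1)), while the box has
   measure at most 4^n 2^(in): a geometric series of ratio 1/2. *)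
pose B i : set 'rV[R]_n := box (- const_mx (2 ^+ i.+1)) (- const_mx (2 ^+ i.+1) + const_mx (2 * 2 ^+ i.+1)).
pose g (i : nat) (x : Rn R n) : \bar R := ((2 ^- (i * n.+1))%:E * (\1_(B i) x)%:E)%E.
have c0 i : 0 <= 2 ^- (i * n.+1) :> R by rewrite invr_ge0 exprn_ge0.
have mB i : measurable (B i : set (Rn R n)) by exact: measurable_box.
have mg i : measurable_fun setT (g i).
  exact: measurable_funeM (measurable_indicE (mB i)).
have g0 i x : (0 <= g i x)%E by rewrite /g mule_ge0// lee_fin.
have mS := @measurable_esum R n setT g mg g0.
apply: (@le_trans _ _ (\int[@lebesgue R n]_x (\esum_(i in [set: nat]) g i x))%E).
  apply: (le_integralT measurable_poly_decay mS) => x.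
    by rewrite lee_fin poly_decay_ge0.
  have [i /andP[h1 h2]] : exists i : nat, 2 ^+ i <= 1 + `|x : 'rV[R]_n| < 2 ^+ i.+1.
    by apply: dyadic_nat; rewrite lerDl.
  apply: le_trans (@esum_ge_term _ _ [set: nat] (g^~ x) i _ _) => //.
  rewrite /g indicE mem_set ?mule1; last first.
    move=> k; rewrite !mxE; have := le_lt_trans (coord_le_norm x k) (lt_le_trans (ltr_pwDl ltr01 (lexx _)) (ltW h2)).
    by rewrite ltr_norml => /andP[? ?]; apply/andP; split; lra.
  rewrite lee_fin /poly_decay exprM lef_pV2 ?posrE ?exprn_gt0// ?ltr_pwDl//.
  by rewrite lerXn2r// nnegrE ?exprn_ge0// addr_ge0.
rewrite integral_esum//.
have h01 : 0 <= (2^-1 : R) < 1 by apply/andP; split; lra.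
have A0 : 0 <= 4 ^+ n :> R by rewrite exprn_ge0.
apply: le_trans (le_trans (esum_geometric A0 h01) _); last first.
  by rewrite lee_fin (_ : 1 - 2^-1 = 2^-1 :> R) ?invrK; [rewrite mulrC|lra].
apply: le_esum => i _; rewrite (integral_cst_indic (c0 i) (mB i)).
have s0 : 0 <= 2 * 2 ^+ i.+1 :> R by rewrite mulr_ge0 ?exprn_ge0.
have ce0 : (0 <= (2 ^- (i * n.+1) : R)%:E)%E by rewrite lee_fin.
apply: le_trans (lee_wpmul2l ce0 (lebesgue_cube_le _ s0)) _.
rewrite -EFinM lee_fin exprS mulrA exprMn (_ : 2 * 2 = 4 :> R); last by rewrite -natrM.
by rewrite mulrCA ler_wpM2l// mulnS exprD invfM -exprM -mulrA mulVf ?mulr1 ?exprVn//.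
Qed.

End measurability.

(** * Convergence of the series against Schwartz functions *)

Section tempered_sum.
Context {R : realType} {n : nat}.
Notation mu := (@lebesgue R n).
Variables (p C : R) (q : \bar R) (lam : nat -> R[i]) (a : nat -> 'rV[R]_n -> R[i])
  (I : nat -> set 'rV[R]_n) (u : nat -> 'rV[R]_n) (l : nat -> R).
Hypotheses (n0 : (0 < n)%N) (v0 : 0 < @unit_vol R n) (p0 : 0 < p) (p1 : p <= 1) (q0 : (0 < q)%E)
  (atomI : forall j, atom p (I j) (a j))
  (specI : forall j, cube_spec (I j) (u j) (l j))
  (overlap : bounded_overlap p lam I C)
  (coef_fin : (coef_qnorm p q lam I < +oo)%E).
Let ht := height p lam I.
Let m := (@moment_order R n p).+1.

(** A single level is dominated by the whole quasinorm, for finite and infinite q alike. *)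
Lemma level_mass_bounded :
  exists2 T : R, 0 <= T & forall k, (level_mass p lam I k <= T%:E)%E.
Proof.
have S0 k : (0 <= level_mass p lam I k)%E by exact: level_mass_ge0.
have B (s : R) (N : \bar R) : 0 < s -> (N < +oo)%E ->
    (forall k, level_mass p lam I k `^ s <= N)%E ->
    exists2 T : R, 0 <= T & forall k, (level_mass p lam I k <= T%:E)%E.
  move=> s0 Noo SN.
  have N0 : (0 <= N)%E by apply: le_trans (SN 0); exact: poweR_ge0.
  have Nfin : (N `^ s^-1)%E \is a fin_num by rewrite fin_num_poweR// ge0_fin_numE.
  exists (fine (N `^ s^-1)%E) => [|k]; first by rewrite fine_ge0// poweR_ge0.
  have s'0 : 0 <= s^-1 by rewrite invr_ge0 ltW.
  rewrite fineK//; have := le_poweR s'0 (poweR_ge0 _ _) (SN k).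
  by rewrite -poweRrM mulfV ?gt_eqF// poweRe1.
move: coef_fin; rewrite coef_qnormE; case: q q0 => [r r0|_|//] /=.
- rewrite lte_fin in r0 => /lty_poweRy; rewrite invr_eq0 gt_eqF// => /(_ isT) X.
  apply: (B (r / p) _ _ X) => [|k]; first by rewrite divr_gt0.
  apply: (@esum_ge_term _ _ [set: int] (fun k => level_mass p lam I k `^ (r / p))%E) => // i.
  exact: poweR_ge0.
- move=> X; apply: (B p^-1 _ _ X) => [|k]; first by rewrite invr_gt0.
  by apply: ereal_sup_ubound; exists k.
Qed.

(** High terms have small cubes: a mass of at most [T] at height h forces a volume of at most T
    h^(-p). Inserted into l^(n+m), this leaves a negative power of the height. *)
Lemma high_level_decay (T : R) : 0 <= T -> (forall k, level_mass p lam I k <= T%:E)%E ->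
  exists2 B : R, 0 <= B &
    (\esum_(j in [set j | 2 ^ 0 <= ht j]%R) (ht j * l j ^+ (n + m))%:E <= B%:E)%E.
Proof.
move=> T0 ST.
have nr0 : 0 < n%:R :> R by rewrite ltr0n.
pose c0 : R := 2 ^+ n / @unit_vol R n.
have c00 : 0 <= c0 by rewrite divr_ge0 ?exprn_ge0// ltW.
pose mn : R := m%:R / n%:R.
have mn0 : 0 <= mn by rewrite divr_ge0.
(* This is p(n+m)/n - 1, positive by [moment_order_gt]. *)
pose eps := p + p * mn - 1.
have eps0 : 0 < eps.
  have := moment_order_gt (n := n) p0; rewrite -/m natrD => h.
  have : 1 < p * (1 + mn).
    rewrite -(ltr_pM2r nr0) mul1r.
    have -> : p * (1 + mn) * n%:R = (n%:R + m%:R) * p by rewrite /mn; field; rewrite gt_eqF.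
    exact: h.
  by rewrite mulrDr mulr1 /eps => h'; lra.
pose rho : R := 2 `^ (- eps).
have rho0 : 0 < rho by exact: powR_gt0.
have rho1 : rho < 1.
  rewrite /rho powRN invf_lt1 ?powR_gt0//.
  have := @gt0_ltr_powR R eps eps0 1 2.
  by rewrite powR1 !nnegrE ler01 ler0n ltr1n; apply.
pose kap := c0 * (c0 * T) `^ mn.
have kap0 : 0 <= kap by rewrite mulr_ge0// powR_ge0.
(* The factor l^n retains the mass of the term, to be summed over the level; the factor l^m uses
   only that this mass is at most [T]. *)
have pt i j : dyadic_level ht i%:Z j ->
    ht j * l j ^+ (n + m) <= kap * rho ^+ i * cabs (lam j) `^ p.
  move=> Lj; have /andP[hj _] := Lj; rewrite -exprnP in hj.
  have hj0 : 0 < ht j by apply: lt_le_trans hj; rewrite exprn_gt0.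
  have hD x y : ht j `^ x * ht j `^ y = ht j `^ (x + y).
    by rewrite powRD// (gt_eqF hj0) implybT.
  have [l0 _ _ _ _] := specI j.
  set X := cabs (lam j) `^ p.
  have X0 : 0 <= X by exact: powR_ge0.
  have XT : X <= T.
    rewrite -lee_fin; apply: le_trans (ST i%:Z).
    by apply: (@esum_ge_term _ _ _ (fun j => (cabs (lam j) `^ p)%:E)) => // j'; rewrite lee_fin powR_ge0.
  have XE : X = ht j `^ p * vol (I j) := height_powR lam v0 p0 specI j.
  have vE : vol (I j) = X * ht j `^ (- p).
    by rewrite XE mulrAC hD subrr powRr0 mul1r.
  have hp0 : 0 < ht j `^ (- p) by exact: powR_gt0.
  have L1 : l j ^+ n <= c0 * X * ht j `^ (- p).
    by rewrite -mulrA -vE; exact: (side_le_vol v0 specI).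
  have L2 : l j ^+ m <= (c0 * T) `^ mn * ht j `^ (- (p * mn)).
    rewrite -mulNr (powRrM (ht j) (- p) mn) -(powRM mn (mulr_ge0 c00 T0) (ltW hp0)).
    have -> : l j ^+ m = (l j ^+ n) `^ mn.
      rewrite -!powR_mulrn ?ltW// -powRrM /mn; congr (_ `^ _).
      by rewrite mulrC divfK// gt_eqF.
    apply: ge0_ler_powR; rewrite ?nnegrE// ?exprn_ge0 ?(ltW l0)//.
      exact: (mulr_ge0 (mulr_ge0 c00 T0) (ltW hp0)).
    apply: le_trans L1 _; rewrite ler_wpM2r ?(ltW hp0)// ler_wpM2l//.
  rewrite exprD.
  apply: (@le_trans _ _ (ht j * ((c0 * X * ht j `^ (- p)) * ((c0 * T) `^ mn * ht j `^ (- (p * mn)))))).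
    rewrite ler_wpM2l ?(ltW hj0)// ler_pM ?exprn_ge0// ltW//.
  have -> : ht j * ((c0 * X * ht j `^ (- p)) * ((c0 * T) `^ mn * ht j `^ (- (p * mn)))) =
      kap * X * (ht j * ht j `^ (- p) * ht j `^ (- (p * mn))) by rewrite /kap; ring.
  rewrite -{1}[ht j]powRr1 ?(ltW hj0)// !hD.
  rewrite (_ : 1 + - p + - (p * mn) = - eps); last by rewrite /eps; ring.
  rewrite mulrAC ler_wpM2r// ler_wpM2l//.
  rewrite /rho -powR_expn// !powRN lef_pV2 ?posrE ?powR_gt0 ?exprn_gt0//.
  by apply: ge0_ler_powR; rewrite ?nnegrE ?exprn_ge0 ?(ltW eps0) ?(ltW hj0).
have rho01 : 0 <= rho < 1 by rewrite ltW.
have kT0 : 0 <= kap * T by rewrite mulr_ge0.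
exists (kap * T / (1 - rho)); first by rewrite divr_ge0// subr_ge0 ltW.
rewrite esum_levels_up => [|j]; last first.
  have [l0 _ _ _ _] := specI j.
  by rewrite lee_fin mulr_ge0 ?exprn_ge0 ?(height_ge0 p lam v0 specI) ?ltW.
apply: le_trans (esum_geometric kT0 rho01); apply: le_esum => i _; rewrite add0r.
apply: (@le_trans _ _ (\esum_(j in dyadic_level ht i%:Z)
    ((kap * rho ^+ i)%:E * (cabs (lam j) `^ p)%:E)))%E.
  by apply: le_esum => j Lj; rewrite -EFinM lee_fin pt.
have kr0 : 0 <= kap * rho ^+ i by rewrite mulr_ge0// exprn_ge0// ltW.
rewrite esumZl//; last by move=> j; rewrite lee_fin powR_ge0.
have kre0 : (0 <= (kap * rho ^+ i)%:E)%E by rewrite lee_fin.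
apply: le_trans (lee_wpmul2l kre0 (ST i%:Z)) _.
by rewrite -EFinM lee_fin mulrAC.
Qed.

(** The split is at height 1: overlap and the integrable weight below, cancellation and
    [high_level_decay] above. As [B] does not depend on [psi], the bound yields continuity together
    with convergence. *)
Lemma schwartz_pairing_sum : exists2 B : R, 0 <= B &
  forall (psi : 'rV[R]_n -> R[i]) (M : R), csmooth psi -> 0 <= M ->
    (forall s x, (size s <= n + m)%N ->
       (1 + `|x|) ^+ (n + m) * cabs (cpartials s psi x) <= M) ->
    (\esum_(j in [set: nat]) (pairing lam a psi j)%:E <= (B * M)%:E)%E.
Proof.
have [T T0 ST] := level_mass_bounded.
have [B' B'0 BP] := high_level_decay T0 ST.
have C0 : 0 <= C := overlap_ge0 overlap.
pose B1 := 4 * C * (2 * 4 ^+ n).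
have B10 : 0 <= B1 by rewrite !mulr_ge0 ?exprn_ge0.
pose B2 := 4 * (m.+1 ^ n)%:R * B'.
have B20 : 0 <= B2 by rewrite !mulr_ge0.
exists (B1 + B2) => [|psi M spsi M0 psiM]; first by rewrite addr_ge0.
have g1 x : 1 <= 1 + `|x : 'rV[R]_n| by rewrite lerDl.
have psiM' s x : (size s <= n + m)%N -> cabs (cpartials s psi x) <= M.
  move=> sN; apply: le_trans (psiM s x sN); rewrite ler_peMl ?cabs_ge0//.
  by rewrite exprn_ege1.
rewrite mulrDl EFinD; apply: le_trans (pairing_split p lam a v0 specI 0 psi) _.
apply: leeD.
  pose H (x : Rn R n) := (M%:E * (poly_decay x)%:E)%E.
  have mH : measurable_fun setT H by apply: measurable_funeM; exact: measurable_poly_decay.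
  have psiH y : ((cabs (psi y))%:E <= H y)%E.
    rewrite /H -EFinM lee_fin /poly_decay ler_pdivlMr ?exprn_gt0 ?ltr_pwDl// mulrC.
    have := psiM [::] y (leq0n _); rewrite /cpartials/=; case: (psi y) => re im /= h.
    apply: le_trans h; rewrite ler_wpM2r ?cabs_ge0//.
    by rewrite ler_weXn2l// /m addnS ltnS leq_addr.
  have Hfin y : H y \is a fin_num by rewrite /H -EFinM.
  apply: le_trans (low_pairing v0 atomI specI overlap 0 (csmooth_measurable spsi) mH Hfin psiH) _.
  rewrite /H (integralZT M0 measurable_poly_decay) => [|x]; last first.
    by rewrite lee_fin poly_decay_ge0.
  rewrite muleA -EFinM.
  have c0 : (0 <= (4 * 2 ^ 0 * C * M)%:E)%E by rewrite lee_fin !mulr_ge0.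
  apply: le_trans (lee_wpmul2l c0 integral_poly_decay) _.
  by rewrite -EFinM lee_fin /B1 expr0z le_eqVlt; apply/orP; left; apply/eqP; ring.
apply: (@le_trans _ _ (\esum_(j in [set j | 2 ^ 0 <= ht j]%R)
    ((4 * (m.+1 ^ n)%:R * M)%:E * (ht j * l j ^+ (n + m))%:E))%E).
  apply: le_esum => j _; rewrite -EFinM lee_fin /pairing cabsM.
  have h := atom_cintegral_smooth v0 (atomI j) (specI j) spsi M0.
  apply: le_trans (ler_wpM2l (cabs_ge0 _) (h _)) _.
    move=> s x sm; have sN : (size s <= n + m)%N by rewrite sm leq_addl.
    have := psiM' s x sN; rewrite /cpartials => cM.
    by split; apply: le_trans cM; [exact: (cabs_Re (_ +i* _))|exact: (cabs_Im (_ +i* _))].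
  rewrite -/m /ht /height exprD le_eqVlt; apply/orP; left; apply/eqP; ring.
have c0 : 0 <= 4 * (m.+1 ^ n)%:R * M by rewrite !mulr_ge0.
have hl0 j : (0 <= (ht j * l j ^+ (n + m))%:E)%E.
  have [l0 _ _ _ _] := specI j; rewrite lee_fin mulr_ge0 ?exprn_ge0 ?(ltW l0)//.
  exact: (height_ge0 p lam v0 specI).
rewrite esumZl//.
have c0e : (0 <= (4 * (m.+1 ^ n)%:R * M)%:E)%E by rewrite lee_fin.
apply: le_trans (lee_wpmul2l c0e BP) _.
by rewrite -EFinM lee_fin /B2 le_eqVlt; apply/orP; left; apply/eqP; ring.
Qed.

End tempered_sum.

(** * Linearity of the pairing with an atom *)

Section linearity.
Context {R : realType} {n : nat}.
Notation mu := (@lebesgue R n).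
Variables (p : R) (I : set 'rV[R]_n) (a : 'rV[R]_n -> R[i]) (u : 'rV[R]_n) (l : R).
Hypotheses (v0 : 0 < @unit_vol R n) (atomI : atom p I a) (specI : cube_spec I u l).

Let X (psi : 'rV[R]_n -> R[i]) (y : 'rV[R]_n) : R[i] := a y * psi y.

Lemma atom_integrable_ReIm psi : csmooth psi ->
  mu.-integrable setT (EFin \o (fun y : Rn R n => complex.Re (X psi y))) /\
  mu.-integrable setT (EFin \o (fun y : Rn R n => complex.Im (X psi y))).
Proof.
move=> [sRe sIm]; have [_ [mRe mIm] _ _ _] := atomI.
have cRe : continuous (fun y => complex.Re (psi y)) := (sRe [::]).1.
have cIm : continuous (fun y => complex.Im (psi y)) := (sIm [::]).1.
have aRe y : `|complex.Re (a y)| <= cabs (a y) by exact: cabs_Re.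
have aIm y : `|complex.Im (a y)| <= cabs (a y) by exact: cabs_Im.
have i1 := atom_integrable v0 atomI specI cRe mRe aRe.
have i2 := atom_integrable v0 atomI specI cIm mIm aIm.
have i3 := atom_integrable v0 atomI specI cIm mRe aRe.
have i4 := atom_integrable v0 atomI specI cRe mIm aIm.
split.
  have -> : (EFin \o (fun y : Rn R n => complex.Re (X psi y))) =
    ((EFin \o (fun y : Rn R n => complex.Re (a y) * complex.Re (psi y))%R) \-
     (EFin \o (fun y : Rn R n => complex.Im (a y) * complex.Im (psi y))%R))%E.
    by apply/funext => y; rewrite /X /= cReM EFinB.
  exact: integrableB.
have -> : (EFin \o (fun y : Rn R n => complex.Im (X psi y))) =
  ((EFin \o (fun y : Rn R n => complex.Re (a y) * complex.Im (psi y))%R) \+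
   (EFin \o (fun y : Rn R n => complex.Im (a y) * complex.Re (psi y))%R))%E.
  by apply/funext => y; rewrite /X /= cImM EFinD.
exact: integrableD.
Qed.

Lemma Rintegral_lin2 (g1 g2 g3 : Rn R n -> R) (c d : R) :
  mu.-integrable setT (EFin \o g1) -> mu.-integrable setT (EFin \o g2) ->
  mu.-integrable setT (EFin \o g3) ->
  \int[mu]_y (c * g1 y + d * g2 y + g3 y) =
  c * \int[mu]_y g1 y + d * \int[mu]_y g2 y + \int[mu]_y g3 y.
Proof.
move=> i1 i2 i3.
have j1 : mu.-integrable setT (EFin \o (fun y => c * g1 y)) := integrableZl measurableT c i1.
have j2 : mu.-integrable setT (EFin \o (fun y => d * g2 y)) := integrableZl measurableT d i2.
have j12 : mu.-integrable setT (EFin \o (fun y => c * g1 y + d * g2 y)) := integrableD measurableT j1 j2.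
by rewrite RintegralD// RintegralD// !RintegralZl.
Qed.

Lemma atom_cintegral_lin (c : R[i]) psi1 psi2 : csmooth psi1 -> csmooth psi2 ->
  cintegral (fun y => a y * (c * psi1 y + psi2 y)) =
  c * cintegral (fun y => a y * psi1 y) + cintegral (fun y => a y * psi2 y).
Proof.
move=> s1 s2; have [r1 i1] := atom_integrable_ReIm s1; have [r2 i2] := atom_integrable_ReIm s2.
apply/eqP; rewrite eq_complex; apply/andP; split; apply/eqP.
  rewrite cReD cReM /= -mulNr -Rintegral_lin2//.
  by apply: eq_Rintegral => y _; rewrite mulrDr mulrCA cReD cReM mulNr.
rewrite cImD cImM /= -Rintegral_lin2//.
by apply: eq_Rintegral => y _; rewrite mulrDr mulrCA cImD cImM.
Qed.

End linearity.

Theorem theorem2p3 (R : realType) (n : nat) (p : R) (q : \bar R)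
    (phi : 'rV[R]_n -> R[i]) (C : R)
    (n_gt0 : (0 < n)%N) (p_gt0 : 0 < p) (p_le1 : p <= 1) (q_gt0 : (0 < q)%E)
    (phi_test : test_function phi) (phi_int : cintegral phi != 0) :
  exists c : R,
    forall (f : ('rV[R]_n -> R[i]) -> R[i]) (lam : nat -> R[i])
      (a : nat -> 'rV[R]_n -> R[i]) (I : nat -> set 'rV[R]_n),
      is_distribution f ->
      (forall j, atom p (I j) (a j)) ->
      atomic_sum f lam a ->
      bounded_overlap p lam I C ->
      (coef_qnorm p q lam I < +oo)%E ->
      hardy_lorentz phi p q f /\
      (hardy_lorentz_qnorm phi p q f <= c%:E * coef_qnorm p q lam I)%E.
Proof.
have v0 : 0 < @unit_vol R n := unit_vol_gt0 phi_int.
have [c c0 cP] := @hardy_lorentz_qnorm_le R n p C q phi p_gt0 p_le1 q_gt0 phi_test phi_int.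
exists c => f lam a I df atomI fsum overlap coef_fin.
have fle := cP f lam a I atomI fsum overlap; split => //.
have lor : lorentz p q (radial_maximal phi f).
  split; first exact: measurable_radial_maximal.
  apply: le_lt_trans fle _; apply: lte_mul_pinfty => //.
split => //; split => //.
have [ul ulP] : {ul : nat -> 'rV[R]_n * R & forall j, cube_spec (I j) (ul j).1 (ul j).2}.
  apply: (@choice _ _ (fun j ul => cube_spec (I j) ul.1 ul.2)) => j.
  have [cI _ _ _ _] := atomI j; have [u [l ul]] := cubeP cI.
  by exists (u, l).
pose u j := (ul j).1; pose l j := (ul j).2.
have specI j : cube_spec (I j) (u j) (l j) by exact: ulP.
have [B B0 BP] := schwartz_pairing_sum n_gt0 v0 p_gt0 q_gt0 atomI specI overlap coef_fin.
set N := (n + _)%N in BP.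
pose psum (psi : 'rV[R]_n -> R[i]) (k : nat) : R[i] := \sum_(j < k) lam j * cintegral (fun y => a j y * psi y).
(* The value 0 is a placeholder where the series diverges; on Schwartz and on test functions it
   converges. *)
pose F (psi : 'rV[R]_n -> R[i]) : R[i] := xget 0 [set w | ccvg (psum psi) w].
have pairing_fin psi : csmooth psi -> (forall M, (forall s x, (size s <= N)%N ->
      (1 + `|x|) ^+ N * cabs (cpartials s psi x) <= M) -> ccvg (psum psi) (F psi) /\
      cabs (F psi) <= B * M).
  move=> spsi M psiM.
  have M0 : 0 <= M.
    apply: le_trans (psiM [::] 0 (leq0n _)).
    by rewrite mulr_ge0 ?cabs_ge0// exprn_ge0// addr_ge0.
  have bnd := BP psi M spsi M0 psiM.
  have [w cw] : exists w, ccvg (psum psi) w.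
    apply: (@ccvg_esum _ (fun j => lam j * cintegral (fun y => a j y * psi y))).
    by apply: le_lt_trans bnd _; rewrite ltry.
  have cF : ccvg (psum psi) (F psi) by apply: (xgetPex 0); exists w.
  split => //; rewrite -lee_fin; apply: le_trans bnd.
  exact: (@ccvg_le_esum _ (fun j => lam j * cintegral (fun y => a j y * psi y)) _ cF).
have schwartz_cvg psi : schwartz psi -> ccvg (psum psi) (F psi).
  move=> [spsi dpsi].
  (* Each sequence of directions has its own bound; only finitely many have length at most [N], so
     one [M] serves for all. *)
  have [D DP] : {D : seq 'I_n -> R & forall s x, (1 + `|x|) ^+ N * cabs (cpartials s psi x) <= D s}.
    by apply: (@choice _ _ (fun s D => forall x, (1 + `|x|) ^+ N * cabs (cpartials s psi x) <= D)) => s.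
  have [M [_ MP]] := seq_bound D N.
  have psiM s x : (size s <= N)%N -> (1 + `|x|) ^+ N * cabs (cpartials s psi x) <= M.
    by move=> sN; exact: le_trans (DP s x) (MP s sN).
  by have [] := pairing_fin psi spsi M psiM.
exists F; split; last first.
  (* On test functions the series converges to [f psi] by assumption, and limits are unique. *)
  move=> psi tpsi; have cf : ccvg (psum psi) (f psi) := fsum psi tpsi.
  apply: (ccvg_unique _ cf); apply: (xgetPex 0); by exists (f psi).
split=> [d psi1 psi2 s1 s2|].
  have c12 := ccvg_lin d (schwartz_cvg _ s1) (schwartz_cvg _ s2).
  have E : psum (fun x => d * psi1 x + psi2 x) = fun k => d * psum psi1 k + psum psi2 k.
    apply/funext => k; rewrite /psum mulr_sumr -big_split/=; apply: eq_bigr => j _.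
    rewrite (atom_cintegral_lin v0 (atomI j) (specI j) d s1.1 s2.1) mulrDr.
    by rewrite mulrCA.
  apply: (@ccvg_unique _ (psum (fun x => d * psi1 x + psi2 x))); last by rewrite E.
  by apply: (xgetPex 0); exists (d * F psi1 + F psi2); rewrite /= E.
exists B, N => psi M [spsi _] psiM.
by have [] := pairing_fin psi spsi M psiM.
Qed.
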